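(* Let $P\subseteq 4\Delta_3$ be a lattice polytope that is the Newton polytope of a smooth tropical quartic surface which has a bounded region in its complement and whose dual triangulation is central (equivalently, $P$ is a $3$-dimensional reflexive polytope contained in $4\Delta_3$). Let $f\in\mathbb{C}[x,y,z,w]$ be a homogeneous quartic polynomial with Newton polytope $P$ and general coefficients. Then the quartic surface $V(f)\subset\mathbb{P}^3$ is stable. That is, there is a nonempty Zariski open subset $U$ of the space of coefficient vectors $(\lambda_m)_{m\in P\cap\mathbb{Z}^3}$ such that $f=\sum_m\lambda_m\, m$ is stable for every $(\lambda_m)\in U$, where each lattice point of $P$ is identified with the corresponding quartic monomial.
   Context: Let $4\Delta_3=\mathrm{conv}\{(0,0,0),(4,0,0),(0,4,0),(0,0,4)\}$, with unique interior lattice point $\mathbf p=(1,1,1)$. The lattice point $(i,j,k)\in 4\Delta_3$ is identified with the quartic monomial $x^iy^jz^kw^{4-i-j-k}$; the Newton polytope of a homogeneous quartic $f$ is the convex hull of the lattice points corresponding to the monomials occurring in $f$. Tropical notions: with $a\oplus b=\min\{a,b\}$, $a\odot b=a+b$, a tropical quartic polynomial is $g=\bigoplus_{\mathbf v\in 4\Delta_3\cap\mathbb{Z}^3}c_{\mathbf v}\odot x^{\mathbf v}$ with $c_{\mathbf v}\in\mathbb{R}\cup\{\infty\}$; the tropical surface $T(g)\subset\mathbb{R}^3$ is the locus where the minimum of $c_{\mathbf v}+\mathbf v\cdot x$ is attained at least twice; $\mathrm{Newt}(g)=\mathrm{conv}\{\mathbf v:c_{\mathbf v}\neq\infty\}$.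 The coefficients induce a regular subdivision of $\mathrm{Newt}(g)\cap\mathbb{Z}^3$ by projecting the lower faces of the convex hull of the points $(\mathbf v,c_{\mathbf v})$. $T(g)$ is smooth if this subdivision is a unimodular triangulation (all maximal simplices have normalized volume $1$); this is its dual triangulation. It is central if every maximal simplex contains $\mathbf p$ as a vertex. Reflexive: write a $3$-dimensional lattice polytope as $P=\{\mathbf x\in\mathbb{R}^3: A\mathbf x\ge \mathbf c\}$ with one inequality per facet, rows of $A$ primitive integer vectors, $\mathbf c$ integral. If $P$ has exactly one interior lattice point $\mathbf p$, it is reflexive if $A\mathbf p-\mathbf c=(1,\ldots,1)^t$. Stability: $\mathrm{SL}(4)$ acts on the vector space $\mathbb{C}[x,y,z,w]_4$ of quartic forms by linear change of coordinates. A nonzero quartic form $f$ (or the surface $V(f)$) is stable if its $\mathrm{SL}(4)$-orbit is closed in $\mathbb{C}[x,y,z,w]_4$ and its stabilizer in $\mathrm{SL}(4)$ is finite. *)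

(* Defs.v *)
(* The real numbers are an arbitrary [R : realType], the complex numbers [R[i]].
   [mpoly] must be imported before the analysis files: in the reverse order the
   levels of their notations clash. *)
From HB Require Import structures.
From mathcomp Require Import all_boot all_order all_algebra.
From mathcomp Require Import mpoly.
From mathcomp Require Import complex.
From mathcomp Require Import boolp classical_sets functions cardinality.
From mathcomp Require Import reals ereal topology normedtype.

Set Implicit Arguments.
Unset Strict Implicit.
Unset Printing Implicit Defensive.

Import Order.TTheory GRing.Theory Num.Theory.
Import numFieldNormedType.Exports.

Local Open Scope classical_set_scope.
Local Open Scope ring_scope.

Section ConvexGeometry.
Variable R : realType.

Definition dot n (a x : 'rV[R]_n) : R := \sum_(j < n) a 0 j * x 0 j.

Definition conv_hull n (A : set 'rV[R]_n) : set 'rV[R]_n :=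
  [set y | exists (k : nat) (x : 'I_k -> 'rV[R]_n) (t : 'I_k -> R),
     [/\ forall i, A (x i), forall i, 0 <= t i, \sum_i t i = 1
       & y = \sum_i t i *: x i]].

Definition supported_face n (Q : set 'rV[R]_n) (a : 'rV[R]_n) (b : R) (F : set 'rV[R]_n) :=
  (forall x, Q x -> b <= dot a x) /\ F = Q `&` [set x | dot a x = b].

Definition is_face n (Q F : set 'rV[R]_n) := exists a b, supported_face Q a b F.

Definition is_vertex n (Q : set 'rV[R]_n) (x : 'rV[R]_n) := is_face Q [set x].

(* Q contains k + 1 affinely independent points *)
Definition affdim_ge n (Q : set 'rV[R]_n) (k : nat) :=
  exists (x : 'rV[R]_n) (M : 'M[R]_(k, n)),
    [/\ Q x, forall i, Q (x + row i M) & row_free M].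

Definition has_affdim n (Q : set 'rV[R]_n) (k : nat) :=
  affdim_ge Q k /\ ~ affdim_ge Q k.+1.

Definition is_facet (Q F : set 'rV[R]_3) := is_face Q F /\ has_affdim F 2.

Definition int_pt (v : 'rV[int]_3) : 'rV[R]_3 := map_mx intr v.

Definition lattice_polytope (P : set 'rV[R]_3) :=
  exists s : seq 'rV[int]_3, P = conv_hull [set int_pt v | v in [set` s]].

Definition simplex4 : set 'rV[R]_3 :=
  conv_hull ([set 0] `|` [set 4 *: delta_mx 0 j | j in [set: 'I_3]]).

End ConvexGeometry.

Section Reflexive.
Variable R : realType.

Definition primitive_row (a : 'rV[int]_3) := \big[gcdn/0%N]_(j < 3) absz (a 0 j) = 1%N.

(* P = { x | A x >= c }, the rows being in bijection with the facets of P *)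
Definition facet_presentation (P : set 'rV[R]_3) (k : nat)
    (A : 'M[int]_(k, 3)) (c : 'cV[int]_k) :=
  let F i := P `&` [set x | dot (int_pt R (row i A)) x = (c i 0)%:~R] in
  [/\ P = [set x | forall i, (c i 0)%:~R <= dot (int_pt R (row i A)) x],
      forall i, primitive_row (row i A),
      forall i, is_facet P (F i)
    & forall G, is_facet P G -> exists! i, G = F i].

Definition reflexive3 (P : set 'rV[R]_3) :=
  [/\ lattice_polytope P, has_affdim P 3 &
      exists p : 'rV[int]_3,
        (forall q : 'rV[int]_3, interior P (int_pt R q) <-> q = p) /\
        exists (k : nat) (A : 'M[int]_(k, 3)) (c : 'cV[int]_k),
          facet_presentation P A c /\ A *m p^T - c = const_mx 1].

End Reflexive.

(* The variables x, y, z, w are 'X_0, 'X_1, 'X_2, 'X_3.  The monomials of degree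
   4 serve as index type for the lattice points of 4 Delta_3, via [lpoint]. *)
Definition quartic_monomial := {m : 'X_{1..4 < 5} | mdeg m == 4%N}.

Definition lpoint (R : realType) (m : quartic_monomial) : 'rV[R]_3 :=
  \row_(j < 3) (val m (widen_ord (leqnSn 3) j))%:R.

Section Tropical.
Variable R : realType.

(* Coefficient families with values in R U {+oo}; that -oo does not occur is
   required in [central_tropical_polytope]. *)
Implicit Types c : quartic_monomial -> \bar R.

Definition trop_term c (x : 'rV[R]_3) (m : quartic_monomial) : \bar R :=
  (c m + (dot (lpoint R m) x)%:E)%E.

Definition trop_surface c : set 'rV[R]_3 :=
  [set x | exists m1 m2, [/\ m1 != m2,
     forall m, (trop_term c x m1 <= trop_term c x m)%E &
     forall m, (trop_term c x m2 <= trop_term c x m)%E]].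

Definition trop_newton c : set 'rV[R]_3 :=
  conv_hull [set lpoint R m | m in [set m | c m \is a fin_num]].

Definition lifted_hull c : set 'rV[R]_(3 + 1) :=
  conv_hull [set row_mx (lpoint R m) (fine (c m))%:M | m in [set m | c m \is a fin_num]].

(* Lower faces are those supported by a functional whose last coefficient is
   positive; the cells of the regular subdivision are their projections. *)
Definition subdivision_cell c (S : set 'rV[R]_3) :=
  exists (a : 'rV[R]_(3 + 1)) (b : R) (F : set 'rV[R]_(3 + 1)),
    [/\ 0 < a 0 ord_max, supported_face (lifted_hull c) a b F & S = lsubmx @` F].

Definition maximal_cell c (S : set 'rV[R]_3) :=
  subdivision_cell c S /\ forall S', subdivision_cell c S' -> S `<=` S' -> S' = S.

Definition normalized_volume (V : 'M[int]_(4, 3)) : nat :=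
  absz (\det (\matrix_(i < 3, j < 3) (V (lift ord0 i) j - V ord0 j))).

Definition unimodular_simplex (S : set 'rV[R]_3) :=
  exists V : 'M[int]_(4, 3),
    S = conv_hull [set int_pt R (row i V) | i in [set: 'I_4]] /\
    normalized_volume V = 1%N.

Definition trop_smooth c := forall S, maximal_cell c S -> unimodular_simplex S.

Definition trop_central c := forall S, maximal_cell c S -> is_vertex S (const_mx 1).

Definition has_bounded_region c :=
  exists2 x, (~` trop_surface c) x &
    bounded_set (connected_component (~` trop_surface c) x).

Definition central_tropical_polytope (P : set 'rV[R]_3) :=
  exists c, [/\ forall m, c m != -oo%E, trop_newton c = P, trop_smooth c,
    has_bounded_region c & trop_central c].

End Tropical.

Section Zariski.
Variable K : fieldType.

(* Zariski topology on the affine space K^I *)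
Definition zariski_closed (I : finType) (Z : set (I -> K)) :=
  exists E : set {mpoly K[#|I|]},
    Z = [set a | forall F, E F -> F.@[fun k => a (enum_val k)] = 0].

Definition zariski_open (I : finType) (U : set (I -> K)) := zariski_closed (~` U).

End Zariski.

Section Stability.
Variable K : fieldType.

(* (g . f)(X) = f(X g) for the row vector X of variables *)
Definition form_act (g : 'M[K]_4) (f : {mpoly K[4]}) : {mpoly K[4]} :=
  f \mPo [tuple \sum_(j < 4) g j i *: 'X_j | i < 4].

Definition form_coeffs (f : {mpoly K[4]}) : quartic_monomial -> K :=
  fun m => f@_(val m).

Definition stable_quartic (f : {mpoly K[4]}) :=
  [/\ f \is 4.-homog, f != 0,
      zariski_closed [set form_coeffs (form_act g f) | g in [set g | \det g = 1]]
    & finite_set [set g | \det g = 1 /\ form_act g f = f]].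

End Stability.

Section PolytopeForms.
Variables (R : realType) (P : set 'rV[R]_3).

Definition polytope_monomial := {m : quartic_monomial | `[< P (lpoint R m) >]}.

Definition polytope_form (lam : polytope_monomial -> R[i]) : {mpoly R[i][4]} :=
  \sum_(m : polytope_monomial) lam m *: 'X_[val (val m)].

End PolytopeForms.

(* Main.v *)
(** Stability.  By a valuative criterion (a Zariski closure is reached along a place of a
    larger field) and the Cartan decomposition, a form is stable as soon as every nontrivial
    diagonal one-parameter subgroup, in every system of coordinates, has a negative weight on
    it.  By the Iwasawa decomposition the failure of this condition is closed under
    specialization, so that it suffices to find one such form with the given monomials.
    Coefficients that are powers of a large prime with generic exponents make every subsum of
    the form nonsingular in the torus.  For such a form, the chain rule along a curve
    [t |-> (t ^ u_j y_j) k] shows that a one-parameter subgroup without negative weight either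
    contradicts the interior lattice point (1,1,1) or makes the form divisible by a
    coordinate, which nonsingularity excludes too.

    Polytopes.  If a dual triangulation is central and unimodular, the facets of its cells
    opposite to p = (1,1,1) lie at lattice distance one from p, and they span the facets of
    P.  Conversely, if P is reflexive, the heights [2 |v|^2], slightly perturbed, with p pulled
    far down, induce the cones from p over triangulations of the facets into empty lattice
    triangles; these cones are unimodular, because the facets have lattice distance one. *)

Require Import Defs.
From HB Require Import structures.
From mathcomp Require Import all_boot all_order fingroup perm all_algebra all_field.
From mathcomp Require Import mpoly.
From mathcomp Require Import complex ring_quotient generic_quotient.
From mathcomp Require Import ring lra zify.
From mathcomp Require Import boolp classical_sets functions cardinality.
From mathcomp Require Import reals ereal topology normedtype.

Set Implicit Arguments.
Unset Strict Implicit.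
Unset Printing Implicit Defensive.

Import Order.TTheory GRing.Theory Num.Theory.
Import numFieldNormedType.Exports.

Local Open Scope ring_scope.

(** Stability quantifies over infinite families of matrices over an abstract field whose only
    topology is Zariski's. A family indexed by [T] is therefore treated as one matrix over the ring
    [T -> K]; an ultrafilter containing the nonvanishing loci of all polynomials that do not vanish
    at the limit point turns this ring into a field [E], and Chevalley's extension theorem supplies
    a place of [E] that sends the generic point of the family to the limit. In the given coordinates
    the interior lattice point alone settles the weight condition; the obstacle is an arbitrary
    change of coordinates [k], which mixes all monomials. Its substitute is nonsingularity of all
    subsums in the torus: along a monomial curve, the leading part of [x_i d_i f] is the same
    expression for a subsum of [f] at a torus point, so it cannot vanish for every [i]. *)

(** * Farkas' lemma *)

Section Farkas.
Variables (F : realFieldType) (n : nat).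
Implicit Types (b : 'rV[F]_n) (w : 'cV[F]_n).

(** Induction on the number of generators. If the functional [w] found for the first [k] generators
    is negative on [A k], everything is projected along [A k] onto the kernel of [w] by [pr], and
    the induction hypothesis is used a second time; a functional for the projected vectors is pulled
    back along [pr]. *)
Lemma farkas_nat k (A : nat -> 'rV[F]_n) b :
  (exists2 t : nat -> F, forall i, 0 <= t i & b = \sum_(i < k) t i *: A i) \/
  (exists2 w : 'cV[F]_n, forall i, (i < k)%N -> 0 <= (A i *m w) 0 0 & (b *m w) 0 0 < 0).
Proof.
elim: k A b => [|k IHk] A b.
  have [->|b0] := eqVneq b 0; first by left; exists (fun=> 0); rewrite ?big_ord0.
  right; exists (- b^T) => //; rewrite mulmxN mxE oppr_lt0 mxE.
  rewrite lt_def sumr_ge0 ?andbT; last first.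
    by move=> j _; rewrite mxE -expr2 sqr_ge0.
  apply: contra_neq b0 => /eqP; rewrite psumr_eq0; last first.
    by move=> j _; rewrite mxE -expr2 sqr_ge0.
  move=> /allP b0; apply/rowP => j; rewrite mxE.
  have := b0 j; rewrite mem_index_enum mxE mulf_eq0 orbb => /(_ isT)/eqP->.
  by [].
have [[t t0 bE]|[w wA wb]] := IHk A b.
  left; exists (fun i => if i == k then 0 else t i).
    by move=> i; case: ifP.
  rewrite big_ord_recr /= eqxx scale0r addr0 bE; apply: eq_bigr => i _.
  by rewrite ltn_eqF.
have [wa|wa] := leP 0 ((A k *m w) 0 0).
  by right; exists w => // i; rewrite ltnS leq_eqVlt => /orP[/eqP->|/wA].
set aw := (A k *m w) 0 0 in wa.
pose pr v := v - ((v *m w) 0 0 / aw) *: A k.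
have [[t t0 bE]|[w' wA' wb']] := IHk (pr \o A) (pr b).
  left; exists (fun i => if i == k then (b *m w) 0 0 / aw -
      \sum_(l < k) t l * ((A l *m w) 0 0 / aw) else t i).
    move=> i; case: ifP => // _; rewrite addr_ge0 //.
      by rewrite -mulrNN -invrN divr_ge0 // oppr_ge0 ltW.
    rewrite oppr_ge0 sumr_le0 // => l _; rewrite mulr_ge0_le0 //.
    by rewrite mulr_ge0_le0 ?wA// invr_le0 ltW.
  rewrite big_ord_recr /= eqxx -[LHS](subrK (((b *m w) 0 0 / aw) *: A k)).
  rewrite -/(pr b) bE scalerBl [X in _ = _ + X]addrC addrA; congr (_ + _).
  rewrite scaler_suml -sumrB; apply: eq_bigr => i _.
  by rewrite ltn_eqF// /pr scalerBr scalerA.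
right.
have prE v : (v *m (w' - ((A k *m w') 0 0 / aw) *: w)) 0 0 = (pr v *m w') 0 0.
  rewrite mulmxBr mulmxBl -scalemxAr -scalemxAl !mxE.
  by rewrite mulrAC [RHS]addrC [LHS]addrC; congr (- _ + _); ring.
exists (w' - ((A k *m w') 0 0 / aw) *: w).
by move=> i; rewrite prE ltnS leq_eqVlt => /orP[/eqP->|/wA'//];
    rewrite /pr -/aw divff ?lt_eqF// scale1r subrr mul0mx mxE.
by rewrite prE.
Qed.

Lemma farkas (I : finType) (A : I -> 'rV[F]_n) b :
  (exists2 t : I -> F, forall i, 0 <= t i & b = \sum_i t i *: A i) \/
  (exists2 w : 'cV[F]_n, forall i, 0 <= (A i *m w) 0 0 & (b *m w) 0 0 < 0).
Proof.
pose A' j := oapp A 0 (nth None [seq Some i | i <- enum I] j).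
have A'E i : A' (enum_rank i) = A i.
  by rewrite /A' (nth_map i) -?cardE// nth_enum_rank.
have [[t t0 bE]|[w wA wb]] := farkas_nat #|I| A' b; [left|right].
  exists (fun i => t (enum_rank i)) => //.
  rewrite bE (reindex enum_rank) /=; last exact/onW_bij/enum_rank_bij.
  by apply: eq_bigr => i _; rewrite A'E.
by exists w => // i; rewrite -A'E wA.
Qed.

End Farkas.

(** * Places and Zariski closure *)

Section Places.
Variables (E : fieldType) (K : closedFieldType).
Local Open Scope classical_set_scope.
Implicit Types (G : set (E * K)) (p : {poly E}) (q : {poly K}).

(** The graph of a ring homomorphism from a subring of [E] to [K]. Sets of pairs are ordered by
    inclusion, which is the form in which Zorn's lemma produces maximal extensions. *)
Record specialization_graph G : Prop := SpecializationGraph {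
  graph1 : G (1, 1);
  graphB : forall x y a b, G (x, a) -> G (y, b) -> G (x - y, a - b);
  graphM : forall x y a b, G (x, a) -> G (y, b) -> G (x * y, a * b);
  graph_fun : forall a, G (0, a) -> a = 0 }.

Section Graph.
Variables (G : set (E * K)) (gG : specialization_graph G).

Lemma graph0 : G (0, 0).
Proof. by have := graphB gG (graph1 gG) (graph1 gG); rewrite !subrr. Qed.

Lemma graphN x a : G (x, a) -> G (- x, - a).
Proof. by move=> xa; rewrite -[- x]add0r -[- a]add0r; apply: graphB graph0 _. Qed.

Lemma graphD x y a b : G (x, a) -> G (y, b) -> G (x + y, a + b).
Proof.
by move=> xa yb; rewrite -[y]opprK -[b]opprK; apply: graphB xa (graphN yb).
Qed.

Lemma graphX x a n : G (x, a) -> G (x ^+ n, a ^+ n).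
Proof.
move=> xa; elim: n => [|n IHn]; first by rewrite !expr0; case: gG.
by rewrite !exprS; apply: graphM.
Qed.

Lemma graph_sum (I : Type) (r : seq I) (P : pred I) (f : I -> E) (g : I -> K) :
  (forall i, P i -> G (f i, g i)) ->
  G (\sum_(i <- r | P i) f i, \sum_(i <- r | P i) g i).
Proof.
move=> fg; elim/big_rec2: _ => [|i x y Pi xy]; first exact: graph0.
exact: graphD (fg i Pi) xy.
Qed.

Lemma graph_uniq x a b : G (x, a) -> G (x, b) -> a = b.
Proof.
move=> xa xb; apply/eqP; rewrite -subr_eq0; apply/eqP/(graph_fun gG).
by rewrite -(subrr x); apply: graphB.
Qed.

Definition poly_graph p q := forall i, G (p`_i, q`_i).

Lemma poly_graphC x a : G (x, a) -> poly_graph x%:P a%:P.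
Proof. by move=> xa i; rewrite !coefC; case: eqP => // _; apply: graph0. Qed.

Lemma poly_graphXn n : poly_graph 'X^n 'X^n.
Proof.
by move=> i; rewrite !coefXn; case: eqP => _; [apply: graph1 | apply: graph0].
Qed.

Lemma poly_graphB p1 p2 q1 q2 :
  poly_graph p1 q1 -> poly_graph p2 q2 -> poly_graph (p1 - p2) (q1 - q2).
Proof. by move=> h1 h2 i; rewrite !coefB; apply: graphB. Qed.

Lemma poly_graphM p1 p2 q1 q2 :
  poly_graph p1 q1 -> poly_graph p2 q2 -> poly_graph (p1 * p2) (q1 * q2).
Proof.
by move=> h1 h2 i; rewrite !coefM; apply: graph_sum => j _; apply: graphM.
Qed.

End Graph.

Section Maximal.
Variables (G : set (E * K)) (gG : specialization_graph G).
Hypothesis Gmax : forall H, specialization_graph H -> G `<=` H -> H `<=` G.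

(** Localization: since the value of [x] is a unit, the homomorphism extends to the fractions with
    powers of [x] as denominators. *)
Lemma maximal_graphV x a : G (x, a) -> a != 0 -> G (x^-1, a^-1).
Proof.
move=> xa a0; have x0 : x != 0.
  by apply: contraNneq a0 => x0; rewrite x0 in xa; rewrite (graph_fun gG xa).
pose H : set (E * K) :=
  [set z | exists y b n, G (y, b) /\ z = (y / x ^+ n, b / a ^+ n)].
apply: (Gmax (H := H)).
- split.
  + by exists 1, 1, 0%N; rewrite !expr0 !divr1; split=> //; case: gG.
  + move=> _ _ _ _ [y [b [n [yb [-> ->]]]]] [z [c [m [zc [-> ->]]]]].
    exists (y * x ^+ m - z * x ^+ n), (b * a ^+ m - c * a ^+ n), (n + m)%N.
    split; first by apply: graphB => //; apply: graphM => //; apply: graphX.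
    by congr (_, _); rewrite exprD; field; rewrite !expf_neq0.
  + move=> _ _ _ _ [y [b [n [yb [-> ->]]]]] [z [c [m [zc [-> ->]]]]].
    exists (y * z), (b * c), (n + m)%N; split; first exact: graphM.
    by congr (_, _); rewrite exprD; field; rewrite !expf_neq0.
  + move=> _ [y [b [n [yb [/esym/eqP + ->]]]]].
    rewrite mulf_eq0 invr_eq0 expf_eq0 (negPf x0) andbF orbF => /eqP y0.
    by rewrite y0 in yb; rewrite (graph_fun gG yb) mul0r.
- move=> [y b] yb; exists y, b, 0%N; rewrite !expr0 !divr1; split=> //.
- by exists 1, 1, 1%N; rewrite !expr1 !div1r; split=> //; case: gG.
Qed.

(** The hypothesis is exactly what makes evaluation of specialized polynomials at [c] well defined
    on the ring generated by [x], so the graph extends there and maximality applies. *)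
Lemma maximal_graph_root x c :
  (forall p q, poly_graph G p q -> p.[x] = 0 -> q.[c] = 0) -> G (x, c).
Proof.
move=> xc; pose H : set (E * K) :=
  [set z | exists p q, poly_graph G p q /\ z = (p.[x], q.[c])].
apply: (Gmax (H := H)).
- split.
  + exists 1%:P, 1%:P; rewrite !hornerC; split=> //.
    by apply: poly_graphC => //; case: gG.
  + move=> _ _ _ _ [p [q [pq [-> ->]]]] [p' [q' [pq' [-> ->]]]].
    by exists (p - p'), (q - q'); split; [apply: poly_graphB|rewrite !hornerE].
  + move=> _ _ _ _ [p [q [pq [-> ->]]]] [p' [q' [pq' [-> ->]]]].
    by exists (p * p'), (q * q'); split; [apply: poly_graphM|rewrite !hornerE].
  + by move=> _ [p [q [pq [/esym p0 ->]]]]; apply: xc pq p0.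
- move=> [y b] yb; exists y%:P, b%:P; rewrite !hornerC; split=> //.
  exact: poly_graphC.
- exists 'X^1, 'X^1; rewrite !hornerXn !expr1; split=> //.
  exact: (poly_graphXn gG 1).
Qed.

(** Consider the specializations of all polynomials that vanish at [x]. If they are all zero, or if
    one of least degree has a root [c] in the closed field, that root is common to all of them and
    [x] could be given a value. Hence one of them is a nonzero constant, normalized to 1. *)
Lemma maximal_graph_unit_relation x : ~ (exists a, G (x, a)) ->
  exists2 p, poly_graph G p 1 & p.[x] = 0.
Proof.
move=> xN; pose Q q := exists2 p, poly_graph G p q & p.[x] = 0.
have [Q0|] := pselect (forall q, Q q -> q = 0).
  case: xN; exists 0; apply: maximal_graph_root => p q pq p0.
  by rewrite (Q0 q) ?horner0//; exists p.
move=> /existsNP[q1 /not_implyP[Qq1 /eqP q1N0]].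
have ex : exists n, `[< exists2 q, Q q & (q != 0) && (size q == n) >].
  by exists (size q1); apply/asboolP; exists q1 => //; rewrite q1N0 eqxx.
case: (ex_minnP ex) => n /asboolP[q0 [p0 pq0 p0x] /andP[q0N0 /eqP sq0]] nmin.
(* Euclidean division by [q0]. The quotient [a] of leading coefficients lifts to [e] in [E] by
   [maximal_graphV], so the remainder again comes from a relation of [x], and by minimality of [n]
   the division ends at 0. *)
have divQ q c : q0.[c] = 0 -> Q q -> q.[c] = 0.
  move=> q0c; have [k] := ubnP (size q); elim: k q => // k IHk q sq [p pq px].
  have [->|qN0] := eqVneq q 0; first by rewrite horner0.
  have le_n : (n <= size q)%N.
    by apply: nmin; apply/asboolP; exists q; [exists p | rewrite qN0 eqxx].
  pose a := lead_coef q / lead_coef q0; pose d := (size q - size q0)%N.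
  have lN0 : lead_coef q0 != 0 by rewrite lead_coef_eq0.
  pose e := p`_(size q).-1 / p0`_(size q0).-1.
  have ea : G (e, a) by apply: graphM => //; apply: maximal_graphV.
  have Qr : Q (q - a%:P * 'X^d * q0).
    exists (p - e%:P * 'X^d * p0); last by rewrite !hornerE px p0x mulr0 subr0.
    apply: poly_graphB => //; apply: poly_graphM => //; apply: poly_graphM => //.
      exact: poly_graphC.
    exact: poly_graphXn.
  have := IHk _ _ Qr; rewrite !hornerE q0c mulr0 subr0; apply.
  rewrite (leq_trans _ (_ : size q <= k)%N)// -(prednK (_ : 0 < size q)%N) ?size_poly_gt0//.
  rewrite ltnS; apply/leq_sizeP => j; rewrite leq_eqVlt => /orP[/eqP <-|sj].
    rewrite coefB -mulrA coefCM coefXnM ifF; last first.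
      by apply/negbTE; rewrite -leqNgt /d sq0; move: (size_poly_gt0 q0) le_n; rewrite q0N0 sq0; lia.
    have -> : ((size q).-1 - d = (size q0).-1)%N.
      by move: (size_poly_gt0 q0); rewrite q0N0 sq0 /d sq0; lia.
    by rewrite -!lead_coefE /a divfK// subrr.
  rewrite coefB [q`_j]nth_default; last by rewrite (leq_trans (leqSpred _)).
  rewrite -mulrA coefCM coefXnM; case: ifP => [_|/negbT]; first by rewrite mulr0 subr0.
  rewrite -leqNgt => dj; rewrite [q0`_ _]nth_default ?mulr0 ?subr0//.
  by move: sj le_n dj; rewrite /d sq0; lia.
have [n1|n1] := eqVneq n 1%N.
  have /eqP/size_poly1P[a a0 q0E] : size q0 = 1%N by rewrite sq0.
  have p0a : G (p0`_0, a) by have := pq0 0%N; rewrite q0E coefC.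
  exists ((p0`_0)^-1%:P * p0); last by rewrite hornerM p0x mulr0.
  rewrite -[1]/(1%:P) -(mulVf a0) polyCM -q0E; apply: poly_graphM => //.
  by apply: poly_graphC => //; apply: maximal_graphV.
have /closed_rootP[c /rootP q0c] : size q0 != 1%N by rewrite sq0.
case: xN; exists c; apply: maximal_graph_root => p q pq p0'.
by apply: divQ => //; exists p.
Qed.

(** Chevalley's argument: if neither [x] nor its inverse is in the ring, both satisfy relations that
    specialize to 1. Taken of least degree, the longer of the two can be shortened by means of the
    other. *)
Lemma maximal_graph_total x : (exists a, G (x, a)) \/ G (x^-1, 0).
Proof.
have [|xN] := pselect (exists a, G (x, a)); [by left | right].
have [//|xV0] := pselect (G (x^-1, 0)); exfalso.
have x0 : x != 0 by apply/eqP => x0; case: xN; exists 0; rewrite x0; apply: graph0.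
have xVN : ~ exists a, G (x^-1, a).
  move=> [a xa]; have [a0|a0] := eqVneq a 0; first by rewrite a0 in xa.
  by case: xN; exists a^-1; rewrite -[x]invrK; apply: maximal_graphV.
pose Rel y n := `[< exists p, [/\ poly_graph G p 1, p.[y] = 0 & size p = n] >].
have minRel y : ~ (exists a, G (y, a)) -> {n | Rel y n /\ forall m, Rel y m -> (n <= m)%N}.
  move=> yN; have ex : exists n, Rel y n.
    have [p pG py] := maximal_graph_unit_relation yN.
    by exists (size p); apply/asboolP; exists p.
  by case: (ex_minnP ex) => n ? ?; exists n.
have [n [Rn nmin]] := minRel _ xN; have [m [Rm mmin]] := minRel _ xVN.
(* [r] is the relation [q] of the inverse of [y], reversed into a relation of [y]. The combination
   [q_0 p - p_(k-1) X^(k-l) r] cancels the leading term; it still specializes to 1 because [q_0]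
   goes to 1 and [p_(k-1)] to 0. *)
have red y k l : y != 0 -> Rel y k -> Rel y^-1 l -> (l <= k)%N ->
    exists2 i, Rel y i & (i < k)%N.
  move=> y0 /asboolP[p [pG py sp]] /asboolP[q [qG qy sq]] lk.
  have gt1 (r : {poly E}) z : poly_graph G r 1 -> r.[z] = 0 -> (1 < size r)%N.
    move=> rG rz; rewrite ltnNge; apply/negP => /size1_polyC rE.
    have := rG 0%N; rewrite rE coefC eqxx coef1 eqxx => r1.
    move: rz; rewrite rE hornerC => r0; move: r1; rewrite r0 => /(graph_fun gG)/eqP.
    by rewrite oner_eq0.
  have p1 := gt1 _ _ pG py; have q1 := gt1 _ _ qG qy.
  pose r := \poly_(j < l) q`_(l.-1 - j).
  pose r' : {poly K} := \poly_(j < l) (1 : {poly K})`_(l.-1 - j).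
  have rr' : poly_graph G r r'.
    by move=> i; rewrite !coef_poly; case: ifP => // _; apply: graph0.
  have ry : r.[y] = 0.
    have <- : q.[y^-1] * y ^+ l.-1 = 0 by rewrite qy mul0r.
    rewrite horner_poly horner_coef sq mulr_suml [LHS](reindex_inj rev_ord_inj)/=.
    apply: eq_bigr => j _; have jl := ltn_ord j.
    have -> : (l.-1 - (l - j.+1) = j)%N by lia.
    rewrite -mulrA; congr (_ * _); rewrite exprVn.
    have -> : l.-1 = (j + (l - j.+1))%N by lia.
    by rewrite exprD mulrA mulVf ?mul1r// expf_neq0.
  exists (size ((q`_0)%:P * p - (p`_k.-1)%:P * 'X^(k - l) * r)).
    apply/asboolP; eexists; split; last by [].
      rewrite (_ : 1 = 1%:P * 1 - 0%:P * 'X^(k - l) * r'); last first.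
        by rewrite mulr1 !mul0r subr0.
      apply: poly_graphB => //; apply: poly_graphM => //.
        by apply: poly_graphC => //; have := qG 0%N; rewrite coef1.
      apply: poly_graphM => //; last exact: poly_graphXn.
      apply: poly_graphC => //; have := pG k.-1; rewrite coef1.
      by rewrite -sp; case: (size p) p1 => [|[]].
    by rewrite !hornerE py ry !mulr0 subr0.
  apply: (@leq_ltn_trans k.-1); last by rewrite ltn_predL -sp; lia.
  apply/leq_sizeP => j; rewrite leq_eqVlt => /orP[/eqP <-|kj].
    rewrite coefB -mulrA !coefCM coefXnM ifF; last by move: q1 p1; rewrite sp sq; lia.
    rewrite coef_poly ifT; last by move: q1 p1; rewrite sp sq; lia.
    have -> : (l.-1 - (k.-1 - (k - l)) = 0)%N by lia.
    by rewrite mulrC subrr.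
  rewrite coefB -mulrA !coefCM coefXnM [p`_j]nth_default ?mulr0 ?sub0r; last by rewrite sp; lia.
  case: ifP => _; first by rewrite mulr0 oppr0.
  by rewrite coef_poly ifF ?mulr0 ?oppr0//; lia.
have [mn|nm] := leqP m n.
  by have [i /nmin] := red _ _ _ x0 Rn Rm mn; rewrite leqNgt => /negP.
have [i /mmin] := red _ _ _ (invr_neq0 x0) Rm (etrans (congr1 (Rel^~ n) (invrK x)) Rn) (ltnW nm).
by rewrite leqNgt => /negP.
Qed.

End Maximal.

Lemma graph_extension G : specialization_graph G ->
  exists H, [/\ specialization_graph H, G `<=` H &
    forall x, (exists a, H (x, a)) \/ H (x^-1, 0)].
Proof.
move=> gG; pose P X := specialization_graph (G `|` X).
have [|X [PX Xmax]] := @Zorn_bigcup _ P.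
  move=> F FP Ftot.
  pose U := G `|` \bigcup_(X in F) X.
  have common z1 z2 : U z1 -> U z2 ->
      exists H, [/\ specialization_graph H, H `<=` U, H z1 & H z2].
    have inP X : F X -> specialization_graph (G `|` X) /\ G `|` X `<=` U.
      move=> FX; split; first exact: FP.
      by move=> z [Gz|Xz]; [left | right; exists X].
    move=> [G1|[X1 F1 X1z]] [G2|[X2 F2 X2z]].
    - by exists G; split=> // z; left.
    - by exists (G `|` X2); have [? ?] := inP _ F2; split=> //; [left|right].
    - by exists (G `|` X1); have [? ?] := inP _ F1; split=> //; [right|left].
    - have [X12|X21] := Ftot _ _ F1 F2.
        exists (G `|` X2); have [? ?] := inP _ F2; split=> //; right=> //.
        exact: X12.
      exists (G `|` X1); have [? ?] := inP _ F1; split=> //; right=> //.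
      exact: X21.
  split.
  - by left; case: gG.
  - move=> x y a b h1 h2; have [H [gH HU H1 H2]] := common _ _ h1 h2.
    by apply: HU; apply: graphB.
  - move=> x y a b h1 h2; have [H [gH HU H1 H2]] := common _ _ h1 h2.
    by apply: HU; apply: graphM.
  - move=> a h; have [H [gH HU H1 _]] := common _ _ h h.
    exact: graph_fun gH _ H1.
exists (G `|` X); split=> // x.
apply: maximal_graph_total => // H gH XH z Hz; right.
have [//|Xz] := pselect (X z); exfalso; apply: (Xmax H).
  split; first by move=> y Xy; apply: XH; right.
  by move=> /(_ z Hz).
by rewrite /P setUidr// => y Gy; apply: XH; left.
Qed.

End Places.

(** * Ultrapowers of a field *)

Section Ultrapower.
Local Open Scope classical_set_scope.
Local Open Scope quotient_scope.
Variables (T : pointedType) (K : fieldType) (U : set_system T).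

Definition null_fun (UU : UltraFilter U) (f : T -> K) : bool :=
  `[< U (f @^-1` [set 0]) >].

Variable UU : UltraFilter U.

Lemma null_funP f : reflect (U (f @^-1` [set 0])) (f \in null_fun UU).
Proof. exact: asboolP. Qed.

Lemma null_fun_idealr : idealr_closed (null_fun UU).
Proof.
split=> [||a u v].
- apply/null_funP; apply: (filterS _ filterT) => t _ //=.
- apply/null_funP => U0; apply: (@filter_not_empty _ U _).
  by apply: filterS U0 => t /= /eqP; rewrite oner_eq0.
- move=> /null_funP u0 /null_funP v0; apply/null_funP.
  apply: filterS2 u0 v0 => t /= u0 v0.
  by rewrite -[LHS]/(a t * u t + v t) u0 v0 mulr0 addr0.
Qed.

HB.instance Definition _ :=
  @isIdealr.Build (T -> K) (null_fun UU) null_fun_idealr.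

Definition ultrapower : Type := {ideal_quot (null_fun UU : idealr _)}.
HB.instance Definition _ := GRing.ComNzRing.on ultrapower.

Definition to_ultrapower (f : T -> K) : ultrapower := \pi_{ideal_quot (null_fun UU : idealr _)} f.

HB.instance Definition _ := GRing.RMorphism.copy to_ultrapower
  (\pi_{ideal_quot (null_fun UU : idealr _)}).

Lemma to_ultrapower_eq0 f : to_ultrapower f = 0 <-> U (f @^-1` [set 0]).
Proof.
rewrite -(rmorph0 to_ultrapower); split=> [/eqP|f0].
  by rewrite /to_ultrapower -Quotient.idealrBE subr0 => /null_funP.
by apply/eqP; rewrite /to_ultrapower -Quotient.idealrBE subr0; apply/null_funP.
Qed.

Definition ultrapower_inv (x : ultrapower) : ultrapower :=
  to_ultrapower (fun t => (repr x t)^-1).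

Lemma ultrapower_mulVf x : x != 0 -> ultrapower_inv x * x = 1.
Proof.
move=> x0; rewrite -[x in _ * x]reprK -/(to_ultrapower _) -rmorphM.
apply/eqP; rewrite -(rmorph1 to_ultrapower) -subr_eq0 -rmorphB; apply/eqP.
apply/to_ultrapower_eq0; have [] := in_ultra_setVsetC (repr x @^-1` [set 0]) UU.
  move=> /to_ultrapower_eq0; rewrite /to_ultrapower reprK => x0'.
  by rewrite x0' eqxx in x0.
apply: filterS => t /= /eqP xt0.
by rewrite -[LHS]/((repr x t)^-1 * repr x t - 1) mulVf// subrr.
Qed.

Lemma ultrapower_inv0 : ultrapower_inv 0 = 0.
Proof.
apply/to_ultrapower_eq0; have /to_ultrapower_eq0 : to_ultrapower (repr (0 : ultrapower)) = 0.
  by rewrite /to_ultrapower reprK.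
by apply: filterS => t /= ->; rewrite invr0.
Qed.

HB.instance Definition _ :=
  GRing.ComNzRing_isField.Build ultrapower ultrapower_mulVf ultrapower_inv0.

End Ultrapower.

(** A place in the sense of valuation theory, as a valuation ring with a homomorphism to [K]. The
    function [residue] is total but carries meaning on [vring] only, and [K] may be larger than the
    residue field. *)
Record place (E : fieldType) (K : fieldType) := Place {
  vring : {pred E};
  residue : E -> K;
  vring1 : 1 \in vring;
  vringB : {in vring &, forall x y, x - y \in vring};
  vringM : {in vring &, forall x y, x * y \in vring};
  residue1 : residue 1 = 1;
  residueB : {in vring &, forall x y, residue (x - y) = residue x - residue y};
  residueM : {in vring &, forall x y, residue (x * y) = residue x * residue y};
  vringV : forall x, x \notin vring -> x^-1 \in vring /\ residue x^-1 = 0 }.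

Section PlaceTheory.
Variables (E K : fieldType) (v : place E K).

Lemma vring_subring : subring_closed (vring v).
Proof. by split; [apply: vring1 | apply: vringB | apply: vringM]. Qed.

HB.instance Definition _ := GRing.isSubringClosed.Build E (vring v) vring_subring.

Lemma residue0 : residue v 0 = 0.
Proof. by rewrite -(subrr 1) residueB ?rpred1// subrr. Qed.

Lemma residueN : {in vring v, forall x, residue v (- x) = - residue v x}.
Proof. by move=> x xO; rewrite -sub0r residueB ?rpred0// residue0 sub0r. Qed.

Lemma residueD : {in vring v &, forall x y, residue v (x + y) = residue v x + residue v y}.
Proof.
by move=> x y xO yO; rewrite -{1}[y]opprK residueB ?rpredN// residueN// opprK.
Qed.

Lemma residueX n : {in vring v, forall x, residue v (x ^+ n) = residue v x ^+ n}.
Proof.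
move=> x xO; elim: n => [|n IHn]; first by rewrite !expr0 residue1.
by rewrite !exprS residueM ?rpredX// IHn.
Qed.

Lemma residue_sum (I : Type) (r : seq I) (P : pred I) (f : I -> E) :
  (forall i, P i -> f i \in vring v) ->
  residue v (\sum_(i <- r | P i) f i) = \sum_(i <- r | P i) residue v (f i).
Proof.
move=> fO; suff [] : residue v (\sum_(i <- r | P i) f i) =
  \sum_(i <- r | P i) residue v (f i) /\ \sum_(i <- r | P i) f i \in vring v by [].
elim/big_rec2: _ => [|i x y Pi [<- yO]]; first by rewrite residue0 rpred0.
by rewrite residueD ?fO// rpredD ?fO.
Qed.

Lemma residue_prod (I : Type) (r : seq I) (P : pred I) (f : I -> E) :
  (forall i, P i -> f i \in vring v) ->
  residue v (\prod_(i <- r | P i) f i) = \prod_(i <- r | P i) residue v (f i).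
Proof.
move=> fO; suff [] : residue v (\prod_(i <- r | P i) f i) =
  \prod_(i <- r | P i) residue v (f i) /\ \prod_(i <- r | P i) f i \in vring v by [].
elim/big_rec2: _ => [|i x y Pi [<- yO]]; first by rewrite residue1 rpred1.
by rewrite residueM ?fO// rpredM ?fO.
Qed.

Lemma vring_inv x : x \in vring v -> residue v x != 0 -> x^-1 \in vring v.
Proof.
move=> xO; apply: contra_neqT => /vringV[_]; rewrite invrK.
by [].
Qed.

Lemma vring_total x : x \in vring v \/ x^-1 \in vring v.
Proof. by have [|/vringV[]] := boolP (x \in vring v); [left|right]. Qed.

(** Valuation rings are integrally closed; here, if [x] were outside, its inverse would have residue
    0, and so would [1 = x^n * x^-n]. *)
Lemma vring_pow n x : (0 < n)%N -> x ^+ n \in vring v -> x \in vring v.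
Proof.
case: n => // n _ xn; have [//|xO] := boolP (x \in vring v); have [xVO xV0] := vringV xO.
have [x0|x0] := eqVneq x 0; first by rewrite x0 rpred0 in xO.
have : residue v (x ^+ n.+1 * x^-1 ^+ n.+1) = 0.
  by rewrite residueM// ?(residueX _ xVO) ?xV0 ?expr0n ?mulr0// rpredX.
by rewrite -exprMn divff// expr1n residue1 => /eqP; rewrite oner_eq0.
Qed.

End PlaceTheory.

(** Chevalley's extension theorem for places: ring and residue map are read off a graph that
    contains, for each [x], either a value of [x] or the value 0 of its inverse. *)
Lemma place_extension (E : fieldType) (K : closedFieldType) (G : set (E * K)) :
  specialization_graph G -> exists v : place E K,
    forall x a, G (x, a) -> x \in vring v /\ residue v x = a.
Proof.
move=> /graph_extension[H [gH GH Htot]].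
pose O := [pred x | `[< exists a, H (x, a) >]].
pose r x := xget 0 (fun a => H (x, a)).
have rP x a : H (x, a) -> r x = a.
  move=> xa; apply: xget_unique => // b xb.
  exact: (graph_uniq gH xb xa).
have OP x : x \in O -> H (x, r x).
  by move=> /asboolP[a xa]; rewrite (rP _ _ xa).
have inO x a : H (x, a) -> x \in O by move=> xa; apply/asboolP; exists a.
have v1 := inO _ _ (graph1 gH).
have vB : {in O &, forall x y, x - y \in O}.
  by move=> x y /OP xr /OP yr; apply: inO (graphB gH xr yr).
have vM : {in O &, forall x y, x * y \in O}.
  by move=> x y /OP xr /OP yr; apply: inO (graphM gH xr yr).
have r1 := rP _ _ (graph1 gH).
have rB : {in O &, forall x y, r (x - y) = r x - r y}.
  by move=> x y /OP xr /OP yr; apply: rP (graphB gH xr yr).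
have rM : {in O &, forall x y, r (x * y) = r x * r y}.
  by move=> x y /OP xr /OP yr; apply: rP (graphM gH xr yr).
have vV x : x \notin O -> x^-1 \in O /\ r x^-1 = 0.
  move=> xO; have [[a /inO xO']|x0] := Htot x; first by rewrite xO' in xO.
  by split; [apply: inO x0 | apply: rP x0].
exists (Place v1 vB vM r1 rB rM vV) => x a /GH xa /=.
by split; [apply: inO xa | apply: rP xa].
Qed.

(** The hypothesis says that [a] lies in the Zariski closure of the points [z t]. It makes the
    nonvanishing loci of the [F] with [F(a) != 0] a filter base; in a finer ultrafilter, [F(z) = 0]
    in the ultrapower forces [F(a) = 0], so sending [F(z)] to [F(a)] is a well-defined
    specialization, which then extends to a place. *)
Lemma zariski_place (K : closedFieldType) (T : pointedType) n
    (z : T -> 'I_n -> K) (a : 'I_n -> K) :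
  (forall F : {mpoly K[n]}, (forall t, F.@[z t] = 0) -> F.@[a] = 0) ->
  exists (E : fieldType) (h : {rmorphism (T -> K) -> E}) (v : place E K),
    (forall c, h (cst c) \in vring v /\ residue v (h (cst c)) = c) /\
    (forall i, h (z^~ i) \in vring v /\ residue v (h (z^~ i)) = a i).
Proof.
move=> za.
pose B : set_system T := [set A | exists2 F : {mpoly K[n]}, F.@[a] != 0 &
  (fun t => F.@[z t] != 0) `<=` A]%classic.
have BF : ProperFilter B.
  split; last split.
  - move=> [F Fa F0]; case/eqP: Fa; apply: za => t.
    by apply: contrapT => /eqP/F0.
  - by exists 1%:MP => //; rewrite mevalC oner_eq0.
  - move=> P Q [F Fa FP] [G Ga GQ]; exists (F * G).
      by rewrite mevalM mulf_neq0.
    by move=> t; rewrite mevalM mulf_eq0 negb_or => /andP[/FP ? /GQ].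
  - by move=> P Q PQ [F Fa FP]; exists F => // t /FP/PQ.
have [U [UU BU]] := ultraFilterLemma BF.
pose h := to_ultrapower UU : (T -> K) -> ultrapower K UU.
pose G : set (ultrapower K UU * K) :=
  [set y | exists F : {mpoly K[n]}, y = (h (fun t => F.@[z t]), F.@[a])]%classic.
have gG : specialization_graph G.
  split.
  - exists 1; rewrite meval1; congr (_, _); rewrite -(rmorph1 h).
    by congr (h _); apply/funext => t; rewrite meval1.
  - move=> _ _ _ _ [F [-> ->]] [F' [-> ->]]; exists (F - F').
    rewrite mevalB; congr (_, _); rewrite -rmorphB.
    by congr (h _); apply/funext => t; rewrite mevalB.
  - move=> _ _ _ _ [F [-> ->]] [F' [-> ->]]; exists (F * F').
    rewrite mevalM; congr (_, _); rewrite -rmorphM.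
    by congr (h _); apply/funext => t; rewrite mevalM.
  - move=> _ [F [/esym/to_ultrapower_eq0 F0 ->]]; apply: contrapT => /eqP Fa.
    have /BU F0' : B (fun t => F.@[z t] != 0) by exists F.
    apply: (@filter_not_empty _ U _); apply: filterS2 F0 F0' => t /= ->.
    by rewrite eqxx.
have [v vG] := place_extension gG.
exists (ultrapower K UU), (to_ultrapower UU : {rmorphism (T -> K) -> _}), v.
split=> [c|i]; apply: vG.
  exists c%:MP; rewrite mevalC; congr (_, _); congr (h _).
  by apply/funext => t; rewrite mevalC.
exists 'X_i; rewrite mevalXU; congr (_, _); congr (h _).
by apply/funext => t; rewrite mevalXU.
Qed.

(** * Cartan and Iwasawa decompositions *)

Section IntegralMatrices.
Variables (E K : fieldType) (v : place E K).

Definition integral_mx m n (A : 'M[E]_(m, n)) := forall i j, A i j \in vring v.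

Definition integral_unitmx n (A : 'M[E]_n) :=
  [/\ A \in unitmx, integral_mx A & integral_mx (invmx A)].

Lemma integral_mulmx m n p (A : 'M[E]_(m, n)) (B : 'M[E]_(n, p)) :
  integral_mx A -> integral_mx B -> integral_mx (A *m B).
Proof. by move=> AO BO i j; rewrite mxE rpred_sum// => l _; rewrite rpredM. Qed.

Lemma integral_scalar_mx n a : a \in vring v -> integral_mx (a%:M : 'M_n).
Proof. by move=> aO i j; rewrite mxE rpredMn. Qed.

Lemma integral_block_mx m1 m2 n1 n2 (A : 'M[E]_(m1, n1)) (B : 'M_(m1, n2))
    (C : 'M_(m2, n1)) (D : 'M_(m2, n2)) :
  integral_mx A -> integral_mx B -> integral_mx C -> integral_mx D ->
  integral_mx (block_mx A B C D).
Proof.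
by move=> AO BO CO DO i j; rewrite mxE; case: splitP => i' _; rewrite mxE;
  case: splitP.
Qed.

Lemma integral_mx0 m n : integral_mx (0 : 'M[E]_(m, n)).
Proof. by move=> i j; rewrite mxE rpred0. Qed.

Lemma integral_unitmxI n (A B : 'M[E]_n) :
  integral_mx A -> integral_mx B -> A *m B = 1%:M -> integral_unitmx A.
Proof.
move=> AO BO AB; have [uA _] := mulmx1_unit AB; split=> //.
by rewrite -[invmx A]mulmx1 -AB mulKmx.
Qed.

Lemma integral_unitmxM n (A B : 'M[E]_n) :
  integral_unitmx A -> integral_unitmx B -> integral_unitmx (A *m B).
Proof.
move=> [uA AO AVO] [uB BO BVO].
apply: (@integral_unitmxI _ _ (invmx B *m invmx A)); try exact: integral_mulmx.
by rewrite mulmxA mulmxK// mulmxV.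
Qed.

Lemma integral_unitmxV n (A : 'M[E]_n) :
  integral_unitmx A -> integral_unitmx (invmx A).
Proof. by move=> [uA AO AVO]; split; rewrite ?unitmx_inv ?invmxK. Qed.

Lemma integral_unitmx1 n : integral_unitmx (1%:M : 'M_n).
Proof.
by apply: (@integral_unitmxI _ _ 1%:M); rewrite ?mulmx1//;
  apply/integral_scalar_mx/rpred1.
Qed.

Lemma integral_perm_mx n (s : 'S_n) : integral_unitmx (perm_mx s).
Proof.
have permO (s' : 'S_n) : integral_mx (perm_mx s').
  by move=> i j; rewrite !mxE rpredMn ?rpred1.
apply: (@integral_unitmxI _ _ (perm_mx s^-1)) => //.
by rewrite -perm_mxM mulgV perm_mx1.
Qed.

Lemma integral_block_unitmx n (p : 'cV[E]_n) (q : 'rV[E]_n) (A : 'M[E]_n) :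
  integral_mx p -> integral_mx q -> integral_unitmx A ->
  integral_unitmx (block_mx 1%:M 0 p A : 'M_(1 + n)) /\
  integral_unitmx (block_mx 1%:M q 0 A : 'M_(1 + n)).
Proof.
move=> pO qO [uA AO AVO].
have O1 : integral_mx (1%:M : 'M[E]_1) by apply/integral_scalar_mx/rpred1.
have O0 m m' : integral_mx (0 : 'M[E]_(m, m')) by apply: integral_mx0.
have NO m m' (B : 'M_(m, m')) : integral_mx B -> integral_mx (- B).
  by move=> BO i j; rewrite mxE rpredN.
split.
  apply: (@integral_unitmxI _ _ (block_mx 1%:M 0 (- (invmx A *m p)) (invmx A))).
  - exact: integral_block_mx.
  - by apply: integral_block_mx => //; apply/NO/integral_mulmx.
  rewrite mulmx_block !(mulmx0, mul0mx, mulmx1, mul1mx, addr0, add0r) mulmxV//.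
  by rewrite mulmxN mulmxA mulmxV// mul1mx subrr -scalar_mx_block.
apply: (@integral_unitmxI _ _ (block_mx 1%:M (- (q *m invmx A)) 0 (invmx A))).
- exact: integral_block_mx.
- by apply: integral_block_mx => //; apply/NO/integral_mulmx.
rewrite mulmx_block !(mulmx0, mul0mx, mulmx1, mul1mx, addr0, add0r) mulmxV//.
by rewrite addNr -scalar_mx_block.
Qed.

(** An element of least valuation: divisibility is a total preorder in a valuation ring, so a finite
    family has a member dividing all others. *)
Lemma vring_min (I : finType) (i0 : I) (f : I -> E) : exists i (q : I -> E),
  (forall j, q j \in vring v) /\ (forall j, f j = q j * f i).
Proof.
suff [i iP] : exists i, forall j, j \in enum I ->
    exists2 q, q \in vring v & f j = q * f i.
  have iP' j : {q | q \in vring v & f j = q * f i}.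
    by apply/cid2/iP; rewrite mem_enum.
  by exists i, (fun j => s2val (iP' j)); split=> j; case: (iP' j).
elim: (enum I) => [|a s [i iP]]; first by exists i0.
have [a0|a0] := eqVneq (f a) 0.
  exists i => j; rewrite inE => /orP[/eqP->|/iP//].
  by exists 0; rewrite ?rpred0 ?a0 ?mul0r.
have [aO|iO] := vring_total v (f i / f a).
  exists a => j; rewrite inE => /orP[/eqP->|/iP[q qO ->]].
    by exists 1; rewrite ?rpred1 ?mul1r.
  by exists (q * (f i / f a)); [rewrite rpredM | rewrite -mulrA divfK].
have [i0'|fi0] := eqVneq (f i) 0.
  exists a => j; rewrite inE => /orP[/eqP->|/iP[q qO ->]].
    by exists 1; rewrite ?rpred1 ?mul1r.
  by exists 0; rewrite ?rpred0// i0' mulr0 mul0r.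
exists i => j; rewrite inE => /orP[/eqP->|/iP//].
by exists (f a / f i); [rewrite -invf_div | rewrite divfK].
Qed.

(** Smith normal form over a valuation ring. An entry of least valuation is moved to the corner,
    where it clears its row and column integrally; the induction continues with the Schur
    complement. *)
Lemma cartan_decomposition n (g : 'M[E]_n) : exists k1 k2 (d : 'rV_n),
  [/\ integral_unitmx k1, integral_unitmx k2 & g = k1 *m diag_mx d *m k2].
Proof.
elim: n g => [|n IHn] g.
  exists 1%:M, 1%:M, 0; split; try exact: integral_unitmx1.
  by apply/matrixP => -[].
have [[i j] [q [qO gE]]] := @vring_min ('I_n.+1 * 'I_n.+1)%type (0, 0) (fun x => g x.1 x.2).
pose P := tperm_mx i 0 : 'M[E]_n.+1; pose Q := tperm_mx j 0 : 'M[E]_n.+1.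
have sq1 l : tperm_mx l 0 *m tperm_mx l 0 = 1%:M :> 'M[E]_n.+1.
  by rewrite -perm_mxM tperm2 perm_mx1.
pose g' : 'M_(1 + n) := P *m g *m Q.
have gg' : g = P *m g' *m Q.
  by rewrite /g' /P /Q !mulmxA sq1 mul1mx -mulmxA sq1 mulmx1.
have g'E x y : g' x y = q (tperm i 0 x, tperm j 0 y) * g i j.
  by rewrite /g' -xcolE -xrowE !mxE (gE (_, _)).
pose a := g i j.
pose c : 'cV[E]_n := \col_x q (tperm i 0 (rshift 1 x), tperm j 0 0).
pose r : 'rV[E]_n := \row_y q (tperm i 0 0, tperm j 0 (rshift 1 y)).
have cO : integral_mx c by move=> x y; rewrite mxE.
have rO : integral_mx r by move=> x y; rewrite mxE.
have a00 : g' 0 0 = a by rewrite /g' -xcolE -xrowE !mxE !tpermR.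
have ulE : ulsubmx g' = a%:M.
  by apply/matrixP => x y; rewrite !ord1 [RHS]mxE eqxx mulr1n mxE mxE -a00; congr (g' _ _); apply/val_inj.
have urE : ursubmx g' = a *: r.
  apply/matrixP => x y; rewrite !ord1 [RHS]mxE [r _ _]mxE mxE mxE g'E mulrC.
  by congr (_ * q (tperm i 0 _, _)); apply/val_inj.
have dlE : dlsubmx g' = a *: c.
  apply/matrixP => x y; rewrite !ord1 [RHS]mxE [c _ _]mxE mxE mxE g'E mulrC.
  by congr (_ * q (_, tperm j 0 _)); apply/val_inj.
have [k1 [k2 [d [k1O k2O BE]]]] := IHn (drsubmx g' - a *: (c *m r)).
have O0 m : integral_mx (0 : 'cV[E]_m) by apply: integral_mx0.
have O0' m : integral_mx (0 : 'rV[E]_m) by apply: integral_mx0.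
have [L1 _] := integral_block_unitmx cO rO (integral_unitmx1 n).
have [_ U1] := integral_block_unitmx cO rO (integral_unitmx1 n).
have [L2 _] := integral_block_unitmx (O0 _) (O0' _) k1O.
have [U2 _] := integral_block_unitmx (O0 _) (O0' _) k2O.
exists (P *m (block_mx 1%:M 0 c 1%:M *m block_mx 1%:M 0 0 k1)),
  (block_mx 1%:M 0 0 k2 *m block_mx 1%:M r 0 1%:M *m Q), (row_mx a%:M d); split.
- by apply: integral_unitmxM; [apply: integral_perm_mx | apply: integral_unitmxM].
- by apply: integral_unitmxM; [apply: integral_unitmxM | apply: integral_perm_mx].
rewrite [LHS]gg' -!mulmxA; congr (_ *m _); rewrite !mulmxA; congr (_ *m _).
have drE : drsubmx g' = a *: (c *m r) + k1 *m diag_mx d *m k2.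
  by rewrite -BE addrC subrK.
have blk : block_mx a%:M (a *: r) (a *: c) (a *: (c *m r) + k1 *m diag_mx d *m k2) =
    (block_mx 1%:M 0 c 1%:M : 'M_(1 + n)) *m (block_mx 1%:M 0 0 k1 : 'M_(1 + n)) *m
    diag_mx (row_mx a%:M d : 'rV_(1 + n)) *m (block_mx 1%:M 0 0 k2 : 'M_(1 + n)) *m
    (block_mx 1%:M r 0 1%:M : 'M_(1 + n)).
  have dE : diag_mx (a%:M : 'M_1) = a%:M.
    by apply/matrixP => x y; rewrite !ord1 !mxE.
  rewrite diag_mx_row dE !mulmx_block !(mulmx0, mul0mx, mulmx1, mul1mx, addr0, add0r).
  by rewrite mul_scalar_mx mul_mx_scalar -scalemxAl.
by rewrite -[LHS]/g' -[g']submxK ulE urE dlE drE.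
Qed.

(** Only column operations are used: the pivot is an entry of least valuation in the first row,
    which it clears to the right, leaving a lower triangular factor. *)
Lemma iwasawa_decomposition n (g : 'M[E]_n) : exists b k : 'M[E]_n,
  [/\ integral_unitmx k, forall i j : 'I_n, (i < j)%N -> b i j = 0 & g = b *m k].
Proof.
elim: n g => [|n IHn] g.
  exists 0, 1%:M; split; first exact: integral_unitmx1.
    by case.
  by apply/matrixP => -[].
have [j [q [qO gE]]] := @vring_min 'I_n.+1 0 (g 0).
pose Q := tperm_mx j 0 : 'M[E]_n.+1.
pose g' : 'M_(1 + n) := g *m Q.
have gg' : g = g' *m Q.
  by rewrite /g' /Q -mulmxA -perm_mxM tperm2 perm_mx1 mulmx1.
pose a := g 0 j.
pose r : 'rV[E]_n := \row_y q (tperm j 0 (rshift 1 y)).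
have rO : integral_mx r by move=> x y; rewrite mxE.
have a00 : g' 0 0 = a by rewrite /g' -xcolE !mxE !tpermR.
have ulE : ulsubmx g' = a%:M.
  by apply/matrixP => x y; rewrite !ord1 [RHS]mxE eqxx mulr1n mxE mxE -a00; congr (g' _ _); apply/val_inj.
have urE : ursubmx g' = a *: r.
  apply/matrixP => x y; rewrite !ord1 [RHS]mxE [r _ _]mxE mxE mxE /g' -xcolE mxE [RHS]mulrC -gE.
  by congr (g _ _); apply/val_inj.
have [b [k [kO bt BE]]] := IHn (drsubmx g' - dlsubmx g' *m r).
have O0 m : integral_mx (0 : 'cV[E]_m) by apply: integral_mx0.
have O0' m : integral_mx (0 : 'rV[E]_m) by apply: integral_mx0.
have [_ U1] := integral_block_unitmx (O0 _) rO (integral_unitmx1 n).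
have [U2 _] := integral_block_unitmx (O0 _) (O0' _) kO.
exists (block_mx a%:M 0 (dlsubmx g') b : 'M_(1 + n)),
  (block_mx 1%:M 0 0 k *m block_mx 1%:M r 0 1%:M *m Q); split.
- by apply: integral_unitmxM; [apply: integral_unitmxM | apply: integral_perm_mx].
- move=> x y xy; rewrite mxE; case: splitP => x' xE; rewrite mxE; case: splitP => y' yE.
  + by move: xy; rewrite xE yE !ord1.
  + by rewrite mxE.
  + by move: xy; rewrite xE yE ltnNge (ltnW _)// ltn_addr// ltn_ord.
  + by apply: bt; move: xy; rewrite xE yE ltn_add2l.
rewrite [LHS]gg' !mulmxA; congr (_ *m _).
rewrite -[g' in LHS]submxK ulE urE.
have -> : drsubmx g' = dlsubmx g' *m r + b *m k.
  by rewrite -BE addrC subrK.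
have blk (c : 'cV[E]_n) : block_mx a%:M (a *: r) c (c *m r + b *m k) =
    (block_mx a%:M 0 c b : 'M_(1 + n)) *m (block_mx 1%:M 0 0 k : 'M_(1 + n)) *m
    (block_mx 1%:M r 0 1%:M : 'M_(1 + n)).
  rewrite !mulmx_block !(mulmx0, mul0mx, mulmx1, mul1mx, addr0, add0r).
  by rewrite mul_scalar_mx.
exact: blk.
Qed.

End IntegralMatrices.

Lemma eq_mpoly_rmorphism n (R S : nzRingType) (f g : {rmorphism {mpoly R[n]} -> S}) :
  (forall c, f c%:MP = g c%:MP) -> (forall i, f 'X_i = g 'X_i) -> f =1 g.
Proof.
move=> fgC fgX p; rewrite [p]mpolyE !rmorph_sum; apply: eq_bigr => m _.
rewrite -mul_mpolyC !rmorphM fgC mpolyXE_id !rmorph_prod; congr (_ * _).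
by apply: eq_bigr => i _; rewrite !rmorphXn fgX.
Qed.

(** * Numerical stability *)

Section LinearSubstitution.
Variables (R : comNzRingType) (n : nat).
Implicit Types (g h : 'M[R]_n) (f : {mpoly R[n]}).

(** The substitution of [form_act], for any number of variables and over any commutative ring, since
    it is also applied over rings of functions and over the field carrying the place. *)
Definition lin_sub g f : {mpoly R[n]} :=
  f \mPo [tuple \sum_(j < n) g j i *: 'X_j | i < n].

HB.instance Definition _ g := GRing.LRMorphism.copy (lin_sub g)
  (comp_mpoly [tuple \sum_(j < n) g j i *: 'X_j | i < n]).

Lemma lin_subC g c : lin_sub g c%:MP = c%:MP.
Proof. exact: comp_mpolyC. Qed.

Lemma lin_subXU g i : lin_sub g 'X_i = \sum_(j < n) g j i *: 'X_j.
Proof. by rewrite /lin_sub comp_mpolyXU -tnth_nth tnth_mktuple. Qed.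

Lemma lin_subX g m :
  lin_sub g 'X_[m] = \prod_(i < n) (\sum_(j < n) g j i *: 'X_j) ^+ m i.
Proof.
by rewrite /lin_sub comp_mpolyX; apply: eq_bigr => i _; rewrite tnth_mktuple.
Qed.

Lemma lin_subE g f : lin_sub g f = \sum_(m <- msupp f) f@_m *: lin_sub g 'X_[m].
Proof.
rewrite [in LHS](mpolyE f) linear_sum; apply: eq_bigr => m _.
by rewrite linearZ.
Qed.

Lemma lin_subM g h f : lin_sub (g *m h) f = lin_sub g (lin_sub h f).
Proof.
apply: (@eq_mpoly_rmorphism _ _ _ (lin_sub (g *m h)) (lin_sub g \o lin_sub h)).
  by move=> c /=; rewrite !lin_subC.
move=> i /=; rewrite !lin_subXU linear_sum/=.
under [RHS]eq_bigr do rewrite linearZ/= lin_subXU scaler_sumr.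
rewrite exchange_big/=; apply: eq_bigr => j _; rewrite mxE scaler_suml.
by apply: eq_bigr => k _; rewrite scalerA mulrC.
Qed.

Lemma lin_sub1 f : lin_sub 1%:M f = f.
Proof.
apply: (@eq_mpoly_rmorphism _ _ _ (lin_sub 1%:M) idfun) => [c|i].
  exact: lin_subC.
rewrite /= lin_subXU (bigD1 i)//= mxE eqxx scale1r big1 ?addr0// => j ji.
by rewrite mxE (negPf ji) scale0r.
Qed.

Lemma lin_sub_homog g d f : f \is d.-homog -> lin_sub g f \is d.-homog.
Proof.
move=> fd; rewrite [f]mpolyE linear_sum/= big_seq rpred_sum// => m mf.
rewrite linearZ/= rpredZ// lin_subX.
have <- : (\sum_(i < n) m i)%N = d.
  by rewrite -mdegE; move/dhomogP: fd => /(_ _ mf).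
elim/big_rec2: _ => [|i p e _ pe]; first exact: dhomog1.
apply: dhomogM => //.
rewrite -[X in X.-homog]mul1n; apply: dhomogMn.
rewrite rpred_sum// => j _; rewrite rpredZ// dhomogX/=.
by rewrite mdeg1.
Qed.

Lemma meval_lin_sub g f (y : 'I_n -> R) :
  (lin_sub g f).@[y] = f.@[fun i => \sum_(j < n) g j i * y j].
Proof.
rewrite /lin_sub comp_mpoly_meval; apply: meval_eq => i.
rewrite tnth_mktuple raddf_sum/=; apply: eq_bigr => j _.
by rewrite mevalZ mevalXU.
Qed.

End LinearSubstitution.

Lemma map_lin_sub n (R S : comNzRingType) (h : {rmorphism R -> S}) (g : 'M[R]_n) f :
  map_mpoly h (lin_sub g f) = lin_sub (map_mx h g) (map_mpoly h f).
Proof.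
apply: (@eq_mpoly_rmorphism _ _ _ (map_mpoly h \o lin_sub g)
  (lin_sub (map_mx h g) \o map_mpoly h)) => [c|i] /=.
  by rewrite map_mpolyC !lin_subC map_mpolyC.
rewrite map_mpolyX !lin_subXU raddf_sum; apply: eq_bigr => j _ /=.
by rewrite map_mpolyZ map_mpolyX mxE.
Qed.

Section Specialization.
Variables (E K : fieldType) (v : place E K).

Definition specializes x a := x \in vring v /\ residue v x = a.

Lemma specializes0 : specializes 0 0.
Proof. by split; [apply: rpred0 | apply: residue0]. Qed.

Lemma specializes1 : specializes 1 1.
Proof. by split; [apply: rpred1 | apply: residue1]. Qed.

Lemma specializesD x y a b :
  specializes x a -> specializes y b -> specializes (x + y) (a + b).
Proof. by move=> [xO <-] [yO <-]; split; [rewrite rpredD | rewrite residueD]. Qed.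

Lemma specializesM x y a b :
  specializes x a -> specializes y b -> specializes (x * y) (a * b).
Proof. by move=> [xO <-] [yO <-]; split; [rewrite rpredM | rewrite residueM]. Qed.

Lemma specializesN x a : specializes x a -> specializes (- x) (- a).
Proof. by move=> [xO <-]; split; [rewrite rpredN | rewrite residueN]. Qed.

Lemma specializes_sum (I : Type) (r : seq I) (P : pred I) (f : I -> E) (g : I -> K) :
  (forall i, P i -> specializes (f i) (g i)) ->
  specializes (\sum_(i <- r | P i) f i) (\sum_(i <- r | P i) g i).
Proof.
move=> fg; elim/big_rec2: _ => [|i x y Pi xy]; first exact: specializes0.
exact: specializesD (fg i Pi) xy.
Qed.

Lemma specializes_prod (I : Type) (r : seq I) (P : pred I) (f : I -> E) (g : I -> K) :
  (forall i, P i -> specializes (f i) (g i)) ->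
  specializes (\prod_(i <- r | P i) f i) (\prod_(i <- r | P i) g i).
Proof.
move=> fg; elim/big_rec2: _ => [|i x y Pi xy]; first exact: specializes1.
exact: specializesM (fg i Pi) xy.
Qed.

Lemma specializes_det n (A : 'M[E]_n) (B : 'M[K]_n) :
  (forall i j, specializes (A i j) (B i j)) -> specializes (\det A) (\det B).
Proof.
move=> AB; apply: specializes_sum => s _; apply: specializesM; last first.
  by apply: specializes_prod.
by case: odd_perm; rewrite ?expr1 ?expr0; [apply: specializesN|]; apply: specializes1.
Qed.

Lemma specializes_uniq x a b : specializes x a -> specializes x b -> a = b.
Proof. by move=> [_ <-] []. Qed.

Section Polynomials.
Variable n : nat.
Implicit Types (p q : {mpoly E[n]}) (s t : {mpoly K[n]}).

Definition mspecializes p s := forall m, specializes p@_m s@_m.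

Lemma mspecializesD p q s t :
  mspecializes p s -> mspecializes q t -> mspecializes (p + q) (s + t).
Proof. by move=> ps qt m; rewrite !mcoeffD; apply: specializesD. Qed.

Lemma mspecializesZ x a p s :
  specializes x a -> mspecializes p s -> mspecializes (x *: p) (a *: s).
Proof. by move=> xa ps m; rewrite !mcoeffZ; apply: specializesM. Qed.

Lemma mspecializesM p q s t :
  mspecializes p s -> mspecializes q t -> mspecializes (p * q) (s * t).
Proof.
move=> ps qt m; rewrite !mcoeffM; apply: specializes_sum => k _.
exact: specializesM.
Qed.

Lemma mspecializesX m : mspecializes 'X_[m] 'X_[m].
Proof.
by move=> k; rewrite !mcoeffX; case: eqP => _; [apply: specializes1|apply: specializes0].
Qed.

Lemma mspecializes_sum (I : Type) (r : seq I) (P : pred I) (f : I -> {mpoly E[n]})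
    (g : I -> {mpoly K[n]}) : (forall i, P i -> mspecializes (f i) (g i)) ->
  mspecializes (\sum_(i <- r | P i) f i) (\sum_(i <- r | P i) g i).
Proof.
move=> fg; elim/big_rec2: _ => [|i x y Pi xy].
  by move=> m; rewrite !mcoeff0; apply: specializes0.
exact: mspecializesD (fg i Pi) xy.
Qed.

Lemma mspecializes1 : mspecializes 1 1.
Proof.
by move=> m; rewrite !mcoeff1; case: eqP => _; [apply: specializes1|apply: specializes0].
Qed.

Lemma mspecializes_prod (I : Type) (r : seq I) (P : pred I) (f : I -> {mpoly E[n]})
    (g : I -> {mpoly K[n]}) : (forall i, P i -> mspecializes (f i) (g i)) ->
  mspecializes (\prod_(i <- r | P i) f i) (\prod_(i <- r | P i) g i).
Proof.
move=> fg; elim/big_rec2: _ => [|i x y Pi xy]; first exact: mspecializes1.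
exact: mspecializesM (fg i Pi) xy.
Qed.

Lemma mspecializes_lin_sub (A : 'M[E]_n) (B : 'M[K]_n) p s :
  (forall i j, specializes (A i j) (B i j)) -> mspecializes p s ->
  mspecializes (lin_sub A p) (lin_sub B s).
Proof.
move=> AB ps; pose w := maxn (msize p) (msize s).
rewrite [p](@mpolywE _ _ w) ?leq_maxl// [s](@mpolywE _ _ w) ?leq_maxr//.
rewrite !linear_sum; apply: mspecializes_sum => m _; rewrite !linearZ/=.
apply: mspecializesZ => //; rewrite !lin_subX; apply: mspecializes_prod => i _.
elim: (m i) => [|k IHk]; first exact: mspecializes1.
rewrite !exprS; apply: mspecializesM IHk; apply: mspecializes_sum => j _.
by apply: mspecializesZ => //; apply: mspecializesX.
Qed.

Lemma mspecializes_uniq p s t : mspecializes p s -> mspecializes p t -> s = t.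
Proof.
by move=> ps pt; apply/mpolyP => m; apply: specializes_uniq (ps m) (pt m).
Qed.

End Polynomials.
End Specialization.

(* The condition of the Hilbert-Mumford criterion: every one-parameter subgroup,
   diagonal of weights [w] in the coordinates given by [k], has a negative weight
   on [f]. *)
Definition numerically_stable (K : fieldType) n (f : {mpoly K[n]}) :=
  forall (k : 'M[K]_n) (w : 'I_n -> int), k \in unitmx -> \sum_i w i = 0 ->
    (exists i, w i != 0) ->
    exists2 m, m \in msupp (lin_sub k f) & \sum_i w i *+ m i < 0.

Lemma common_denominator (I : finType) (w : I -> rat) :
  exists2 N : nat, (0 < N)%N & exists z : I -> int,
    forall i, w i * N%:R = (z i)%:~R.
Proof.
exists (\prod_i `|denq (w i)|)%N.
  by rewrite prodn_gt0// => i; rewrite absz_gt0 denq_neq0.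
exists (fun i => numq (w i) * \prod_(j | j != i) denq (w j)) => i.
rewrite (bigD1 i)//= natrM natr_absz (ger0_norm (denq_ge0 _)).
rewrite mulrA -numqE intrM; congr (_ * _).
rewrite natr_prod rmorph_prod; apply: eq_bigr => j _.
by rewrite natr_absz (ger0_norm (denq_ge0 _)).
Qed.

Section Cone.
Variables (n : nat) (s : seq 'X_{1..n}).
Hypothesis sP : forall w : 'I_n -> int, \sum_i w i = 0 -> (exists i, w i != 0) ->
  exists2 m, m \in s & \sum_i w i *+ m i < 0.

(** The hypothesis on [s] says that no nonzero weight of sum zero is nonnegative on [s]. By Farkas
    the monomials of [s] together with the vectors [(1,...,1)] and [-(1,...,1)] then generate every
    coordinate vector as a cone; clearing denominators writes a power of one coordinate through
    monomials of [s] and powers of the product of all coordinates. *)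
Lemma cone_exponents (i : 'I_n) : exists (N a b : nat) (c : seq_sub s -> nat),
  (0 < N)%N /\ forall j, ((i == j) * N + b = \sum_m c m * val m j + a)%N.
Proof.
pose gen (x : seq_sub s + bool) : 'rV[rat]_n :=
  match x with inl m => \row_j (val m j)%:R | inr b => const_mx ((-1) ^+ b) end.
have [[t t0 tE]|[w w0 wi]] := farkas gen (delta_mx 0 i).
  have [N N0 [z zE]] := common_denominator t.
  have z0 x : (0 <= z x).
    by rewrite -(ler0z rat) -zE mulr_ge0.
  exists N, `|z (inr false)|%N, `|z (inr true)|%N, (fun m => `|z (inl m)|%N); split=> // j.
  have /rowP/(_ j) := tE; rewrite summxE mxE eqxx/= => /(congr1 ( *%R^~ N%:R)).
  rewrite mulr_suml big_sumType/= => tEj.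
  apply/eqP; rewrite -(eqr_nat rat) !natrD natr_sum natrM.
  have -> : ((i == j)%:R : rat) * N%:R = (j == i)%:R * N%:R by rewrite eq_sym.
  rewrite tEj big_bool/= !mxE.
  have zN x : t x * N%:R = (`|z x|%N)%:R by rewrite zE natr_absz ger0_norm.
  rewrite expr1 expr0 mulr1 mulrN1 mulNr !zN -addrA (addrC (- _)) subrK.
  apply/eqP; congr (_ + _).
  by apply: eq_bigr => m _; rewrite !mxE mulrAC zN natrM.
have [N N0 [z zE]] := common_denominator (fun i => w i 0).
have zE' (c : 'I_n -> rat) : \sum_j (z j)%:~R * c j = N%:R * \sum_j c j * w j 0.
  rewrite mulr_sumr; apply: eq_bigr => j _; rewrite -zE; ring.
have wS : \sum_j w j 0 = 0.
  have := w0 (inr false); have := w0 (inr true); rewrite !mxE.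
  under eq_bigr do rewrite mxE expr1 mulN1r.
  under [X in _ -> 0 <= X -> _]eq_bigr do rewrite mxE expr0 mul1r.
  by rewrite sumrN oppr_ge0 => ? ?; apply/eqP; rewrite eq_le; apply/andP.
have [||m ms] := sP (w := z).
- apply/eqP; rewrite -(intr_eq0 rat) rmorph_sum/=.
  under eq_bigr do rewrite -[_%:~R]mulr1.
  by rewrite (zE' (fun=> 1)); under eq_bigr do rewrite mul1r; rewrite wS mulr0.
- exists i; apply: contraTneq wi => zi; rewrite -leNgt.
  rewrite mxE (bigD1 i)//= mxE !eqxx mul1r big1 ?addr0 => [|j /negPf ji]; last first.
    by rewrite mxE ji andbF mul0r.
  have /eqP := zE i; rewrite zi mulf_eq0 pnatr_eq0 (gtn_eqF N0) orbF.
  by move=> /eqP->.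
rewrite -(ltrz0 rat) rmorph_sum/= ltNge => /negP[].
under eq_bigr do rewrite rmorphMn/= -mulr_natr.
rewrite zE' mulr_ge0//; have := w0 (inl (SeqSub ms)); rewrite mxE.
by under eq_bigr do rewrite mxE.
Qed.

End Cone.

Section Properness.
Variables (E K : fieldType) (v : place E K) (n : nat).

Lemma mcoeff_lin_sub_diag (R : comNzRingType) (d : 'rV[R]_n) (f : {mpoly R[n]}) m :
  (lin_sub (diag_mx d) f)@_m = (\prod_i d 0 i ^+ m i) * f@_m.
Proof.
have dX k : lin_sub (diag_mx d) 'X_[k] = (\prod_i d 0 i ^+ k i) *: 'X_[k].
  rewrite lin_subX mpolyXE_id -mul_mpolyC rmorph_prod -big_split/=.
  apply: eq_bigr => i _; rewrite (bigD1 i)//= mxE eqxx mulr1n big1 ?addr0.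
    by rewrite -mul_mpolyC exprMn rmorphXn.
  by move=> j ji; rewrite mxE (negPf ji) mulr0n scale0r.
rewrite lin_subE raddf_sum/= [X in _ * X@__](mpolyE f) raddf_sum/= mulr_sumr.
apply: eq_bigr => k _; rewrite dX !mcoeffZ mcoeffX.
by case: eqP => [->|_]; rewrite ?mulr0// !mulr1 mulrC.
Qed.

Definition integral_mpoly (F : {mpoly E[n]}) := forall m, F@_m \in vring v.

Lemma integral_det m (A : 'M[E]_m) : integral_mx v A -> \det A \in vring v.
Proof.
move=> AO; rewrite /determinant rpred_sum// => s _; rewrite rpredM ?rpred_prod//.
by rewrite rpredX// rpredN rpred1.
Qed.

Lemma integral_lin_sub A F :
  integral_mx v A -> integral_mpoly F -> integral_mpoly (lin_sub A F).
Proof.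
move=> AO FO.
pose A' : 'M[K]_n := map_mx (residue v) A.
pose F' : {mpoly K[n]} := \sum_(m <- msupp F) residue v F@_m *: 'X_[m].
have [] : (forall i j, specializes v (A i j) (A' i j)) /\ mspecializes v F F'.
  split=> [i j|m]; first by rewrite mxE; split; first exact: AO.
  split; first exact: FO.
  rewrite raddf_sum/=; have [mF|mF] := boolP (m \in msupp F).
    rewrite (bigD1_seq m)//= ?msupp_uniq// mcoeffZ mcoeffX eqxx mulr1 big1 ?addr0//.
    by move=> k km; rewrite mcoeffZ mcoeffX (negPf km) mulr0.
  rewrite big1_seq ?memN_msupp_eq0 ?residue0// => k /= kF.
  rewrite mcoeffZ mcoeffX; case: eqP => [km|_]; last by rewrite mulr0.
  by rewrite -km kF in mF.
by move=> AA FF m; case: (mspecializes_lin_sub AA FF m).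
Qed.

(** Properness of the orbit map. The Cartan decomposition leaves a diagonal matrix [d]. A monomial
    of the specialized form has a unit as coefficient in [lin_sub k2 F], so the corresponding
    monomial in [d] is integral; the product [D] of the diagonal entries is a unit. [cone_exponents]
    then makes a power of each entry integral, hence the entry itself. *)
Lemma integral_of_bounded_orbit (g : 'M[E]_n) (F : {mpoly E[n]}) (f : {mpoly K[n]}) :
  numerically_stable f -> mspecializes v F f -> \det g = 1 ->
  integral_mpoly (lin_sub g F) -> integral_mx v g.
Proof.
move=> fS Ff g1 gF; have [k1 [k2 [d [[u1 k1O k1V] [u2 k2O k2V] gE]]]] := cartan_decomposition v g.
pose B : 'M[K]_n := map_mx (residue v) k2.
have k2B i j : specializes v (k2 i j) (B i j) by rewrite mxE; split; first exact: k2O.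
have uB : B \in unitmx.
  have /specializes_det := k2B; have : specializes v (\det (invmx k2)) (\det (map_mx (residue v) (invmx k2))).
    by apply: specializes_det => i j; rewrite mxE; split; first exact: k2V.
  move=> h1 h2; have := specializesM h1 h2; rewrite det_inv mulVf -?unitfE -?unitmxE//.
  move=> /(specializes_uniq (specializes1 v)) h; rewrite unitmxE unitfE.
  by apply: contraTneq (oner_neq0 K) => B0; rewrite h B0 mulr0 negbK.
have k2F : mspecializes v (lin_sub k2 F) (lin_sub B f) by apply: mspecializes_lin_sub.
have dO m : m \in msupp (lin_sub B f) -> \prod_i d 0 i ^+ m i \in vring v.
  rewrite mcoeff_msupp => m0; have [Fm Fm'] := k2F m.
  have /(_ m) : integral_mpoly (lin_sub (diag_mx d) (lin_sub k2 F)).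
    have -> : lin_sub (diag_mx d) (lin_sub k2 F) = lin_sub (invmx k1) (lin_sub g F).
      by rewrite -!lin_subM gE -mulmxA mulKmx.
    exact: integral_lin_sub.
  rewrite mcoeff_lin_sub_diag => h.
  have cV : ((lin_sub k2 F)@_m)^-1 \in vring v by apply: vring_inv => //; rewrite Fm'.
  rewrite -[\prod_i _](mulfK (x := (lin_sub k2 F)@_m)); first by rewrite rpredM.
  by apply: contraNneq m0 => m0; rewrite -Fm' m0 residue0.
pose D := \prod_i d 0 i.
have DE : \det k1 * D * \det k2 = 1 by rewrite /D -det_diag -!det_mulmx -gE.
have DO : D \in vring v.
  have -> : D = \det (invmx k1) * \det (invmx k2).
    rewrite !det_inv -[LHS]mul1r -[LHS]mulr1.
    rewrite -{1}(mulVf (x := \det k1)) -?unitfE -?unitmxE//.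
    rewrite -{1}(mulfV (x := \det k2)) -?unitfE -?unitmxE//.
    have -> : (\det k1)^-1 * \det k1 * D * (\det k2 / \det k2) =
       (\det k1)^-1 * (\det k1 * D * \det k2) / \det k2 by ring.
    by rewrite DE mulr1.
  by rewrite rpredM ?integral_det.
have D0 : D != 0.
  by apply/eqP => D0; move: DE; rewrite D0 mulr0 mul0r => /esym/eqP; rewrite oner_eq0.
have DVO : D^-1 \in vring v.
  have -> : D^-1 = \det k1 * \det k2.
    by rewrite -[LHS]mul1r -{1}DE (mulrAC _ D) mulfK.
  by rewrite rpredM ?integral_det.
have di i : d 0 i \in vring v.
  have [N [a [b [c [N0 cE]]]]] := cone_exponents (fS B ^~ uB) i.
  apply: (vring_pow N0).
  have -> : d 0 i ^+ N = (\prod_(m : seq_sub (msupp (lin_sub B f)))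
      (\prod_j d 0 j ^+ ssval m j) ^+ c m) * D ^+ a * D^-1 ^+ b.
    rewrite exprVn; apply: (canRL (mulfK _)); first by rewrite expf_neq0.
    have -> : d 0 i ^+ N = \prod_j d 0 j ^+ ((i == j) * N).
      rewrite (bigD1 i)//= eqxx mul1n big1 ?mulr1// => j /negPf ij.
      by rewrite eq_sym ij expr0.
    under [X in _ = X * _]eq_bigr do rewrite -prodrXl.
    rewrite exchange_big/= -!prodrXl -!big_split/=; apply: eq_bigr => j _.
    under [X in _ = X * _]eq_bigr do rewrite -exprM mulnC.
    by rewrite prodrXr -!exprD cE.
  rewrite !rpredM ?rpredX// rpred_prod// => m _; rewrite rpredX// dO//.
  exact: valP.
rewrite gE; apply: integral_mulmx => //; apply: integral_mulmx => //.
by move=> i j; rewrite mxE rpredMn.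
Qed.

End Properness.

Section FunctionRing.
Variables (T : pointedType) (K : comNzRingType).

Definition fct_eval (t : T) (x : T -> K) : K := x t.

Lemma fct_eval_zmod_morphism t : zmod_morphism (fct_eval t).
Proof. by []. Qed.

Lemma fct_eval_monoid_morphism t : monoid_morphism (fct_eval t).
Proof. by []. Qed.

HB.instance Definition _ t := GRing.isZmodMorphism.Build (T -> K) K
  (fct_eval t) (fct_eval_zmod_morphism t).
HB.instance Definition _ t := GRing.isMonoidMorphism.Build (T -> K) K
  (fct_eval t) (fct_eval_monoid_morphism t).

Lemma cst_zmod_morphism : zmod_morphism (@cst T K).
Proof. by []. Qed.

Lemma cst_monoid_morphism : monoid_morphism (@cst T K).
Proof. by []. Qed.

HB.instance Definition _ := GRing.isZmodMorphism.Build K (T -> K)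
  (@cst T K) cst_zmod_morphism.
HB.instance Definition _ := GRing.isMonoidMorphism.Build K (T -> K)
  (@cst T K) cst_monoid_morphism.

Lemma fct_eval_matrix m n (g : T -> 'M[K]_(m, n)) t :
  map_mx (fct_eval t) (\matrix_(i, j) (fun t => g t i j)) = g t.
Proof. by apply/matrixP => i j; rewrite !mxE. Qed.

End FunctionRing.

Lemma numerically_stable_neq0 (K : fieldType) n (f : {mpoly K[n.+2]}) :
  numerically_stable f -> f != 0.
Proof.
move=> /(_ 1%:M (fun i => (i == 0)%:R - (i == 1)%:R)); rewrite unitmx1 sumrB.
have sum1 (j : 'I_n.+2) : \sum_(i < n.+2) (i == j)%:R = 1 :> int.
  by rewrite (bigD1 j)//= eqxx big1 ?addr0// => i /negPf->.
rewrite !sum1 subrr lin_sub1 => /(_ isT erefl)[|m mf _]; first by exists 0.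
by apply: contraTneq mf => ->; rewrite msupp0.
Qed.

(* Orbits and stabilizers are treated uniformly: a family [g t] of matrices is a
   single matrix over the ring of functions of [t], and then over a field with a
   place. *)
Lemma orbit_place (K : closedFieldType) (T : pointedType) n N (f : {mpoly K[n]})
    (g : T -> 'M[K]_n) (z : T -> 'I_N -> K) (a : 'I_N -> K) :
  (forall F : {mpoly K[N]}, (forall t, F.@[z t] = 0) -> F.@[a] = 0) ->
  (forall t, \det (g t) = 1) ->
  exists (E : fieldType) (v : place E K) (h : {rmorphism (T -> K) -> E})
    (G : 'M[E]_n) (F : {mpoly E[n]}),
    [/\ forall i, specializes v (h (z^~ i)) (a i),
        \det G = 1, mspecializes v F f,
        forall m, (lin_sub G F)@_m = h (fun t => (lin_sub (g t) f)@_m)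
      & forall i j, G i j = h (fun t => g t i j)] /\
     forall c, specializes v (h (cst c)) c.
Proof.
move=> za g1; have [E [h [v [hc hz]]]] := zariski_place za.
pose gA : 'M[T -> K]_n := \matrix_(i, j) (fun t => g t i j).
pose fA := map_mpoly (@cst T K) f.
exists E, v, h, (map_mx h gA), (map_mpoly h fA); split=> //; split=> //.
- rewrite det_map_mx (_ : \det gA = 1) ?rmorph1//; apply/funext => t.
  by rewrite -[LHS]/(fct_eval t _) -det_map_mx fct_eval_matrix g1.
- by move=> m; rewrite !mcoeff_map_mpoly; apply: hc.
- move=> m; rewrite -map_lin_sub mcoeff_map_mpoly; congr (h _); apply/funext => t.
  rewrite -[LHS]/(fct_eval t _) -mcoeff_map_mpoly map_lin_sub fct_eval_matrix.
  congr ((lin_sub _ _)@__); apply/mpolyP => k.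
  by rewrite 2!mcoeff_map_mpoly.
- by move=> i j; rewrite !mxE.
Qed.

(** On the affine line every infinite set is Zariski dense, so it has 0 as a limit point. *)
Lemma mpoly1_infinite_zero (K : fieldType) (A : set K) (F : {mpoly K[1]}) :
  infinite_set A -> (forall x, A x -> F.@[fun=> x] = 0) -> F.@[fun=> 0] = 0.
Proof.
move=> Ainf FA; pose p : {poly K} := mmap polyC (fun=> 'X) F.
have pE x : p.[x] = F.@[fun=> x].
  rewrite /p /mmap horner_sum mevalE; apply: eq_bigr => m _.
  rewrite hornerM hornerC /mmap1 horner_prod; congr (_ * _).
  by apply: eq_bigr => i _; rewrite hornerXn.
have [p0|p0] := eqVneq p 0; first by rewrite -pE p0 horner0.
have [B BA sB] := infinite_set_fset (size p) Ainf.
have /(_ _ (finmap.fset_uniq B)) := max_poly_roots p0 (rs := finmap.enum_fset B).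
rewrite ltnNge sB => /(_ _)/negP[]//; apply/allP => x xB.
by rewrite rootE pE FA//; apply: BA.
Qed.

(** If an entry took infinitely many values on the stabilizer, the inverses of these values would
    have the Zariski limit 0. At the corresponding place the inverse of the entry has residue 0, so
    the entry is not integral, although [integral_of_bounded_orbit] applies because the orbit map is
    constant there. *)
Lemma numerically_stable_finite_stabilizer (K : closedFieldType) n (f : {mpoly K[n]}) :
  numerically_stable f -> finite_set [set g : 'M[K]_n | \det g = 1 /\ lin_sub g f = f]%classic.
Proof.
move=> fS; set S := (X in finite_set X).
have entries i j : finite_set [set g i j | g in S]%classic.
  apply: contrapT => Ainf.
  pose T0 := {g : 'M[K]_n | `[< S g >] && (g i j != 0)}.
  have [t0] : exists t : T0, True.
    have [x [[g Sg gx] x0]] : ([set g i j | g in S] `\ 0 !=set0)%classic.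
      exact/infinite_setN0/infinite_setD.
    have gS : `[< S g >] && (g i j != 0) by rewrite asboolT//= gx; apply/eqP.
    by exists (exist _ g gS).
  pose isP := isPointed.Build T0 t0.
  pose T : pointedType := HB.pack T0 isP.
  pose g (t : T) : 'M[K]_n := val t.
  have gS t : S (g t) by have /andP[/asboolP] := valP t.
  have g0 t : g t i j != 0 by have /andP[] := valP t.
  have [F F0|t|E [v [h [G [F [[hz G1 Ff GF GE] hc]]]]]] :=
    @orbit_place K T n 1 f g (fun t _ => (g t i j)^-1) (fun=> 0).
  - apply: (@mpoly1_infinite_zero _ [set (g t i j)^-1 | t in [set: T]]%classic).
      move=> fin; apply: Ainf.
      apply: (@sub_finite_set _ _ ([set x^-1 | x in [set (g t i j)^-1 | t in [set: T]]] `|` [set 0])%classic).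
        move=> _ [k Sk <-]; have [->|k0] := eqVneq (k i j) 0; [by right | left].
        have kT : `[< S k >] && (k i j != 0) by rewrite asboolT.
        exists (k i j)^-1; rewrite ?invrK//.
        by exists (exist _ k kT : T).
      by rewrite finite_setU; split; [apply: finite_image | apply: finite_set1].
    by move=> _ [t _ <-].
  - by have [] := gS t.
  have GO : integral_mx v G.
    apply: (integral_of_bounded_orbit fS Ff G1) => m; rewrite GF.
    rewrite (_ : (fun _ => _) = cst f@_m); first by have [] := hc f@_m.
    by apply/funext => t; have [_ ->] := gS t.
  have := specializesM (conj (GO i j) erefl) (hz 0).
  rewrite mulr0 GE -rmorphM (_ : _ * _ = 1).
    rewrite rmorph1 => /(specializes_uniq (specializes1 v))/eqP.
    by rewrite oner_eq0.
  by apply/funext => t; rewrite -[LHS]/(g t i j / g t i j) mulfV.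
pose A := (\bigcup_(x in [set: 'I_n * 'I_n])  [set g x.1 x.2 | g in S])%classic.
have : finite_set A by apply: bigcup_finite => //; apply: finite_finset.
move=> /finite_seqP[L AL].
apply: (@sub_finite_set _ _
  [set \matrix_(i, j) ssval (phi (i, j)) | phi in [set: {ffun 'I_n * 'I_n -> seq_sub L}]]%classic).
  move=> g Sg; have gL x : g x.1 x.2 \in L.
    by have : A (g x.1 x.2) by [exists x => //; exists g]; rewrite AL.
  exists [ffun x => SeqSub (gL x)] => //.
  by apply/matrixP => i j; rewrite mxE ffunE.
exact/finite_image/finite_finset.
Qed.

(** A point of the closure of the orbit is the specialization of [lin_sub G F] at a place. By
    properness [G] is integral, and its residue is a matrix of determinant 1 that carries [f] to the
    given point. *)
Lemma numerically_stable_stable_quartic (K : closedFieldType) (f : {mpoly K[4]}) :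
  f \is 4.-homog -> numerically_stable f -> stable_quartic f.
Proof.
move=> f4 fS; split=> //; first exact: numerically_stable_neq0.
  set O := (X in zariski_closed X).
  exists [set F | forall a, O a -> F.@[fun k => a (enum_val k)] = 0]%classic.
  apply/seteqP; split=> [a Oa F|a Fa]; first exact.
  pose T0 := {g : 'M[K]_4 | \det g == 1}.
  have t0P : \det (1%:M : 'M[K]_4) == 1 by rewrite det1.
  pose isP := isPointed.Build T0 (exist _ 1%:M t0P).
  pose T : pointedType := HB.pack T0 isP.
  pose g (t : T) : 'M[K]_4 := val t.
  have g1 t : \det (g t) = 1 by apply/eqP/(valP t).
  have za (F : {mpoly K[#|{: quartic_monomial}|]}) :
      (forall t, F.@[fun k => form_coeffs (form_act (g t) f) (enum_val k)] = 0) ->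
      F.@[fun k => a (enum_val k)] = 0.
    move=> F0; apply: Fa => _ [k k1 <-].
    have kT : \det k == 1 by apply/eqP.
    exact: (F0 (exist _ k kT)).
  have [E [v [h [G [F [[hz G1 Ff GF GE] hc]]]]]] := orbit_place f za g1.
  pose b := \sum_(m : quartic_monomial) a m *: 'X_[val (val m)].
  have bE (m : quartic_monomial) : b@_(val (val m)) = a m.
    rewrite raddf_sum (bigD1 m)//= mcoeffZ mcoeffX eqxx mulr1 big1 ?addr0// => k km.
    rewrite mcoeffZ mcoeffX; case: eqP => [/val_inj/val_inj kE|_]; last by rewrite mulr0.
    by rewrite kE eqxx in km.
  have b4 : b \is 4.-homog.
    by apply: rpred_sum => m _; rewrite rpredZ// dhomogX; apply: (valP m).
  have Gb : mspecializes v (lin_sub G F) b.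
    move=> m; rewrite GF; have [m4|m4] := eqVneq (mdeg m) 4%N.
      have m5 : (mdeg m < 5)%N by rewrite m4.
      have mq : mdeg (BMultinom m5) == 4%N by rewrite /= m4.
      have := hz (enum_rank (exist _ (BMultinom m5) mq : quartic_monomial)).
      by rewrite enum_rankK -bE.
    rewrite (dhomog_nemf_coeff b4)//.
    rewrite (_ : (fun _ => _) = cst 0); first exact: hc.
    by apply/funext => t; rewrite (@dhomog_nemf_coeff _ _ mdeg 4)//; apply: lin_sub_homog.
  have GO : integral_mx v G.
    apply: (integral_of_bounded_orbit fS Ff G1) => m.
    by have [] := Gb m.
  pose k : 'M[K]_4 := map_mx (residue v) G.
  have Gk i j : specializes v (G i j) (k i j) by rewrite mxE; split; first exact: GO.
  exists k => /=.
    have := specializes_det Gk; rewrite G1 => h1.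
    exact: specializes_uniq h1 (specializes1 v).
  have kb := mspecializes_uniq (mspecializes_lin_sub Gk Ff) Gb.
  apply/funext => m; rewrite /form_coeffs -[form_act k f]/(lin_sub k f) kb.
  exact: bE.
exact: numerically_stable_finite_stabilizer.
Qed.

(** * Weights and openness of numerical stability *)

Section Weights.
Variables (R : comNzRingType) (n : nat) (w : 'I_n -> int).
Implicit Types (c : int) (p q : {mpoly R[n]}).

Definition mweight (m : 'X_{1..n}) : int := \sum_i w i *+ m i.

Lemma mweightD m1 m2 : mweight (m1 + m2)%MM = mweight m1 + mweight m2.
Proof.
by rewrite /mweight -big_split/=; apply: eq_bigr => i _; rewrite mnmDE mulrnDr.
Qed.

Definition weight_ge c p := forall m, p@_m != 0 -> c <= mweight m.

Lemma weight_geD c p q : weight_ge c p -> weight_ge c q -> weight_ge c (p + q).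
Proof.
move=> pc qc m; rewrite mcoeffD; have [->|/pc//] := eqVneq p@_m 0.
by rewrite add0r => /qc.
Qed.

Lemma weight_geZ c a p : weight_ge c p -> weight_ge c (a *: p).
Proof.
move=> pc m; rewrite mcoeffZ => ap; apply: pc.
by apply: contraNneq ap => ->; rewrite mulr0.
Qed.

Lemma weight_ge0 c : weight_ge c 0.
Proof. by move=> m; rewrite mcoeff0 eqxx. Qed.

Lemma weight_ge_sum (I : Type) (r : seq I) (P : pred I) (f : I -> {mpoly R[n]}) c :
  (forall i, P i -> weight_ge c (f i)) -> weight_ge c (\sum_(i <- r | P i) f i).
Proof.
move=> fc; elim/big_rec: _ => [|i p Pi pc]; first exact: weight_ge0.
exact: weight_geD (fc i Pi) pc.
Qed.

Lemma weight_geM c d p q :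
  weight_ge c p -> weight_ge d q -> weight_ge (c + d) (p * q).
Proof.
move=> pc qd m; apply: contraNT; rewrite -ltNge => wm.
rewrite mcoeffM big1// => -[m1 m2] /= /eqP mE.
have [->|/pc w1] := eqVneq p@_m1 0; first by rewrite mul0r.
have [->|/qd w2] := eqVneq q@_m2 0; first by rewrite mulr0.
have := mweightD m1 m2; rewrite -mE => mwE.
by move: wm; rewrite mwE ltNge lerD.
Qed.

Lemma weight_ge1 : weight_ge 0 1.
Proof.
move=> m; rewrite mcoeff1; have [->|] := eqVneq m 0%MM; last by rewrite eqxx.
by rewrite /mweight big1// => i _; rewrite mnm0E mulr0n.
Qed.

Lemma weight_geXU i : weight_ge (w i) 'X_i.
Proof.
move=> m; rewrite mcoeffX; have [<-|] := eqVneq U_(i)%MM m; last by rewrite eqxx.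
by rewrite /mweight (bigD1 i)//= mnm1E eqxx big1 ?addr0// => j /negPf ij;
  rewrite mnm1E eq_sym ij mulr0n.
Qed.

Lemma weight_geW c d p : c <= d -> weight_ge d p -> weight_ge c p.
Proof. by move=> cd pd m /pd; apply: le_trans. Qed.

(** The condition on [C] describes the parabolic subgroup of [w]: each variable is replaced by a
    combination of variables of at least the same weight. *)
Lemma weight_ge_lin_sub (C : 'M[R]_n) c p : (forall i j, C i j != 0 -> w j <= w i) ->
  weight_ge c p -> weight_ge c (lin_sub C p).
Proof.
move=> Cw pc; rewrite lin_subE; rewrite big_seq; apply: weight_ge_sum => m mp.
apply: weight_geZ; rewrite mcoeff_msupp in mp.
apply: (weight_geW (pc _ mp)); rewrite lin_subX /mweight.
elim/big_rec2: _ => [|i q d _ qd]; first exact: weight_ge1.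
apply: weight_geM => //; elim: (m i) => [|k IHk]; first exact: weight_ge1.
rewrite exprS mulrS; apply: weight_geM => //; apply: weight_ge_sum => j _.
have [->|/Cw wij] := eqVneq (C j i) 0; first by rewrite scale0r; apply: weight_ge0.
by apply/weight_geZ/(weight_geW wij)/weight_geXU.
Qed.

End Weights.

Lemma sort_perm_exists n (w : 'I_n -> int) :
  exists s : 'S_n, forall i j : 'I_n, (i <= j)%N -> w (s j) <= w (s i).
Proof.
pose r (i j : 'I_n) := w j <= w i.
pose t := sort r (enum 'I_n).
have tn : size t = n by rewrite size_sort size_enum_ord.
have tu : uniq t by rewrite sort_uniq enum_uniq.
have f_inj : injective (fun i : 'I_n => nth i t i).
  move=> i j; rewrite (set_nth_default j) ?tn// => /eqP.
  by rewrite nth_uniq ?tn// => /eqP/val_inj.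
exists (perm f_inj) => i j ij; rewrite !permE (set_nth_default j) ?tn//.
have r_tr : transitive r by move=> x y z xy yz; apply: le_trans yz xy.
have r_refl : reflexive r by move=> x; apply: lexx.
have st : sorted r t by apply: sort_sorted => x y; apply: le_total.
by apply: (sorted_leq_nth r_tr r_refl j st); rewrite ?inE ?tn.
Qed.

Section Openness.
Variables (K : closedFieldType).

(** The Iwasawa decomposition of the inverse of [G] after sorting the basis by weight, transposed to
    bring the integral factor to the left; the triangular factor lies in the parabolic of [w]. Thus
    a destabilizing matrix can be replaced by an integral one without losing its property. *)
Lemma weighted_iwasawa (E : fieldType) (v : place E K) n (w : 'I_n -> int) (G : 'M[E]_n) :
  G \in unitmx -> exists k C : 'M[E]_n, [/\ integral_unitmx v k,
    forall i j, C i j != 0 -> w j <= w i & C *m G = k].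
Proof.
move=> uG; have [s ws] := sort_perm_exists w.
have [b [k [kO bt GE]]] := iwasawa_decomposition v (col_perm s (invmx G))^T.
have kTO : integral_unitmx v k^T.
  have [uk kI kV] := kO; split; rewrite ?unitmx_tr//.
    by move=> i j; rewrite mxE.
  by rewrite -trmx_inv => i j; rewrite mxE.
exists (invmx (k^T *m perm_mx s)), (perm_mx s^-1 *m b^T *m perm_mx s); split.
- by apply/integral_unitmxV/integral_unitmxM => //; apply: integral_perm_mx.
- move=> i j.
  have -> : perm_mx s^-1 *m b^T *m perm_mx s = row_perm s^-1 (col_perm s^-1 b^T).
    by rewrite row_permE col_permE invgK mulmxA.
  rewrite !mxE => bij; rewrite -(permKV s i) -(permKV s j); apply: ws.
  by rewrite leqNgt; apply: contra_neqN bij => /bt.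
have uH : k^T *m perm_mx s \in unitmx.
  by rewrite unitmx_mul unitmx_perm andbT; have [] := kTO.
rewrite -[LHS](mulKmx uH) -[RHS]mulmx1; congr (_ *m _).
have := congr1 trmx GE; rewrite trmxK trmx_mul col_permE => GE'.
rewrite !mulmxA -(mulmxA k^T) -perm_mxM mulgV perm_mx1 mulmx1 -GE'.
by rewrite -(mulmxA (invmx G)) -perm_mxM mulVg perm_mx1 mulmx1 mulVmx.
Qed.

Lemma residue_unitmx (E : fieldType) (v : place E K) n (k : 'M[E]_n) :
  integral_unitmx v k -> map_mx (residue v) k \in unitmx.
Proof.
move=> [uk kO kV].
have h1 : specializes v (\det k) (\det (map_mx (residue v) k)).
  by apply: specializes_det => i j; rewrite mxE; split; first exact: kO.
have h2 : specializes v (\det (invmx k)) (\det (map_mx (residue v) (invmx k))).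
  by apply: specializes_det => i j; rewrite mxE; split; first exact: kV.
have := specializesM h2 h1; rewrite det_inv mulVf -?unitfE -?unitmxE//.
move=> /(specializes_uniq (specializes1 v)) h; rewrite unitmxE unitfE.
by apply/eqP => k0; move/eqP: h; rewrite k0 mulr0 oner_eq0.
Qed.

Variables (n : nat) (I : finType) (mon : I -> 'X_{1..n}).

Definition form_of (R : comNzRingType) (lam : I -> R) : {mpoly R[n]} :=
  \sum_i lam i *: 'X_[mon i].

Definition destabilized (w : 'I_n -> int) : set (I -> K) :=
  [set lam | exists2 k : 'M[K]_n, k \in unitmx &
     weight_ge w 0 (lin_sub k (form_of lam))]%classic.

(** This is completeness of the flag variety of [w], in valuative form. Pairs of a form and a
    destabilizing matrix specialize once the matrix is made integral with integral inverse by
    [weighted_iwasawa]; its residue is then invertible and destabilizes the limit. *)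
Lemma destabilized_closed w (a : I -> K) :
  (forall F : {mpoly K[#|I|]},
    (forall lam, destabilized w lam -> F.@[fun k => lam (enum_val k)] = 0) ->
    F.@[fun k => a (enum_val k)] = 0) ->
  destabilized w a.
Proof.
move=> Fa.
pose T0 := {x : (I -> K) * 'M[K]_n |
  `[< x.2 \in unitmx /\ weight_ge w 0 (lin_sub x.2 (form_of x.1)) >]}.
have [t0 _] : exists t : T0, True.
  have t0P : `[< (1%:M : 'M[K]_n) \in unitmx /\
      weight_ge w 0 (lin_sub 1%:M (form_of (fun=> 0 : K))) >].
    apply/asboolP; rewrite unitmx1; split=> //.
    by rewrite /form_of; under eq_bigr do rewrite scale0r; rewrite big1// raddf0; apply: weight_ge0.
  by exists (exist _ (fun=> 0, 1%:M) t0P).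
pose isP := isPointed.Build T0 t0.
pose T : pointedType := HB.pack T0 isP.
pose lam (t : T) : I -> K := (val t).1.
pose g (t : T) : 'M[K]_n := (val t).2.
have gu t : g t \in unitmx by have /asboolP[] := valP t.
have gw t : weight_ge w 0 (lin_sub (g t) (form_of (lam t))) by have /asboolP[] := valP t.
have za (F : {mpoly K[#|I|]}) : (forall t, F.@[fun k => lam t (enum_val k)] = 0) ->
    F.@[fun k => a (enum_val k)] = 0.
  move=> F0; apply: Fa => l [k ku kw].
  have kT : `[< (l, k).2 \in unitmx /\ weight_ge w 0 (lin_sub (l, k).2 (form_of (l, k).1)) >].
    by apply/asboolP.
  exact: (F0 (exist _ (l, k) kT)).
have [E [h [v [hc hz]]]] := @zariski_place K T _ (fun t k => lam t (enum_val k)) _ za.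
pose gA : 'M[T -> K]_n := \matrix_(i, j) (fun t => g t i j).
pose fA := form_of (fun i t => lam t i).
pose F := map_mpoly h fA.
have map_form (R S : comNzRingType) (f : {rmorphism R -> S}) l :
    map_mpoly f (form_of l) = form_of (f \o l).
  rewrite /form_of raddf_sum; apply: eq_bigr => i _.
  by rewrite /= map_mpolyZ map_mpolyX.
have Ff : mspecializes v F (form_of a).
  rewrite /F map_form; apply: mspecializes_sum => i _.
  apply: mspecializesZ; last exact: mspecializesX.
  by have := hz (enum_rank i); rewrite enum_rankK.
have gAu : map_mx h gA \in unitmx.
  rewrite unitmxE unitfE det_map_mx; apply/eqP => h0.
  pose d (t : T) := (\det (g t))^-1.
  have : h (\det gA * d) = 1.
    rewrite -(rmorph1 h); congr (h _); apply/funext => t.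
    rewrite -[LHS]/(fct_eval t (\det gA) * d t) -det_map_mx fct_eval_matrix mulfV//.
    by rewrite -unitfE -unitmxE.
  by rewrite rmorphM h0 mul0r => /esym/eqP; rewrite oner_eq0.
have GF : weight_ge w 0 (lin_sub (map_mx h gA) F).
  move=> m; apply: contraNT => wm; rewrite -map_lin_sub mcoeff_map_mpoly.
  rewrite (_ : _@_m = 0) ?raddf0//; apply/funext => t.
  rewrite -[LHS]/(fct_eval t _) -mcoeff_map_mpoly map_lin_sub fct_eval_matrix.
  by rewrite map_form; apply: contraNeq wm => /gw.
have [k [C [kO Cw CG]]] := weighted_iwasawa v w gAu.
have kF : weight_ge w 0 (lin_sub k F).
  by rewrite -CG lin_subM; apply: weight_ge_lin_sub.
exists (map_mx (residue v) k); first exact: residue_unitmx.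
have /mspecializes_lin_sub/(_ Ff) kf i j :
    specializes v (k i j) (map_mx (residue v) k i j).
  by rewrite mxE; split=> //; have [_ kI _] := kO; apply: kI.
move=> m m0; apply: kF; apply: contraNneq m0 => m0.
by have [_ <-] := kf m; rewrite m0 residue0.
Qed.

(** A weight enters only through the set of monomials of degree [d] on which it is nonnegative. So
    finitely many weights suffice, and the unstable locus is a finite union of the closed sets
    [destabilized]. *)
Lemma numerically_stable_open d : (forall i, mdeg (mon i) = d) ->
  zariski_open [set lam : I -> K | numerically_stable (form_of lam)]%classic.
Proof.
move=> mond.
pose nonneg (w : 'I_n -> int) := [set m : 'X_{1..n < d.+1} | 0 <= mweight w (val m)].
pose adm (w : 'I_n -> int) := \sum_i w i = 0 /\ exists i, w i != 0.
(* A set [s] that comes from no admissible weight gets the default 0, which is not admissible;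
   [adm (rep s)] therefore singles out the relevant sets. *)
pose rep (s : {set 'X_{1..n < d.+1}}) := xget (fun=> 0) [set w | adm w /\ nonneg w = s]%classic.
have form_homog (R : comNzRingType) (lam : I -> R) : form_of lam \is d.-homog.
  by apply: rpred_sum => i _; rewrite rpredZ// dhomogX/= mond.
have unstableP lam : ~ numerically_stable (form_of lam) ->
    exists2 s, adm (rep s) & destabilized (rep s) lam.
  move=> /existsNP[k /existsNP[w /not_implyP[ku /not_implyP[w0 /not_implyP[wi wN]]]]].
  have [repa repE] : adm (rep (nonneg w)) /\ nonneg (rep (nonneg w)) = nonneg w.
    by apply: (@xgetPex _ (fun=> 0) [set x | adm x /\ nonneg x = nonneg w]%classic); exists w.
  exists (nonneg w) => //; exists k => // m m0.
  have md : mdeg m = d.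
    by apply: (dhomogP _ _ _ (lin_sub_homog k (form_homog _ lam))); rewrite mcoeff_msupp.
  have md' : (mdeg m < d.+1)%N by rewrite md.
  have : BMultinom md' \in nonneg (rep (nonneg w)).
    rewrite repE inE /= leNgt; apply/negP => wm; apply: wN; exists m => //.
    by rewrite mcoeff_msupp.
  by rewrite inE.
have stableN s lam : adm (rep s) -> destabilized (rep s) lam ->
    ~ numerically_stable (form_of lam).
  move=> [s0 si] [k ku kw] /(_ k _ ku s0 si)[m]; rewrite mcoeff_msupp => /kw.
  by rewrite leNgt => /negP.
exists [set F | forall lam, ~ numerically_stable (form_of lam) ->
  F.@[fun k => lam (enum_val k)] = 0]%classic.
apply/seteqP; split=> [a aN F|a Fa /= aS]; first exact.
have sepE s : adm (rep s) -> exists F : {mpoly K[#|I|]},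
    (forall lam, destabilized (rep s) lam -> F.@[fun k => lam (enum_val k)] = 0) /\
    F.@[fun k => a (enum_val k)] != 0.
  move=> sa; apply: contrapT => /forallNP NF; apply: (stableN s a sa) aS.
  apply: destabilized_closed => F F0; apply: contrapT => /eqP aF.
  by apply: (NF F).
have sepE' s : exists F : {mpoly K[#|I|]}, (adm (rep s) ->
    (forall lam, destabilized (rep s) lam -> F.@[fun k => lam (enum_val k)] = 0)) /\
    F.@[fun k => a (enum_val k)] != 0.
  have [/sepE[F [F1 F2]]|Ns] := pselect (adm (rep s)); first by exists F.
  by exists 1; split=> //; rewrite meval1 oner_neq0.
have [sep sepP] := choice sepE'.
have := Fa (\prod_s sep s); rewrite rmorph_prod/= => /(_ _)/eqP.
rewrite prodf_seq_eq0 => /(_ _)/hasP[|s _ /= s0]; last by have [_] := sepP s; rewrite s0.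
move=> lam /unstableP[s sa sd]; rewrite rmorph_prod/= (bigD1 s)//=.
by have [h _] := sepP s; rewrite (h sa _ sd) mul0r.
Qed.

End Openness.

(** * Forms nonsingular in the torus *)

Lemma injective_nonroot (R : idomainType) (P : {poly R}) (u : nat -> R) :
  injective u -> P != 0 -> exists t, ~~ root P (u t).
Proof.
move=> u_inj P0; apply: contrapT => /forallNP Pr.
have /(_ P0) := @max_poly_roots R P [seq u i | i <- iota 0 (size P)].
rewrite size_map size_iota ltnn => /(_ _ _)/negP[]//.
  by apply/allP => _ /mapP[i _ ->]; apply: contrapT => /negP/(Pr i)[].
by rewrite map_inj_uniq ?iota_uniq.
Qed.

Lemma natural_nonroot (R : numFieldType) (P : {poly R}) : P != 0 -> exists t : nat, ~~ root P t%:R.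
Proof. by apply: injective_nonroot => i j /eqP; rewrite eqr_nat => /eqP. Qed.

(** A rational dependency is cleared of denominators and split into its positive and negative parts.
    In the independent case [N] is a common denominator of a right inverse, so independence persists
    over every field in which [N] is nonzero. *)
Lemma independence_dichotomy k n (m : 'I_k -> 'X_{1..n}) :
  (exists a b : 'I_k -> nat, (exists x, a x != b x) /\
     forall j, (\sum_x a x * m x j = \sum_x b x * m x j)%N) \/
  (exists2 N : nat, (0 < N)%N & forall (L : fieldType) (u : 'I_k -> L),
     N%:R != 0 :> L -> (forall j, \sum_x u x * (m x j)%:R = 0) -> forall x, u x = 0).
Proof.
pose A : 'M[rat]_(k, n) := \matrix_(x, j) (m x j)%:R.
have [fA|nfA] := boolP (row_free A); [right | left].
  have [N N0 [z zE]] := common_denominator (fun y : 'I_n * 'I_k => pinvmx A y.1 y.2).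
  exists N => // L u NL u0 y.
  have zA x : \sum_j (m x j)%:Z * z (j, y) = N%:Z * (x == y)%:R.
    apply: (@intr_inj rat); rewrite rmorphM rmorph_sum/= rmorph_nat -pmulrn.
    have /matrixP/(_ x y) := mulmxVp fA; rewrite !mxE => <-.
    rewrite mulr_sumr; apply: eq_bigr => j _; rewrite mxE rmorphM/= -zE/= -!pmulrn.
    by rewrite mulrA mulrC.
  have : \sum_j (\sum_x u x * (m x j)%:R) * (z (j, y))%:~R = 0.
    by rewrite big1// => j _; rewrite u0 mul0r.
  under eq_bigr do rewrite mulr_suml; rewrite exchange_big/=.
  rewrite (eq_bigr (fun x => u x * ((N%:Z * (x == y)%:R)%:~R))); last first.
    move=> x _; rewrite -zA rmorph_sum/= mulr_sumr; apply: eq_bigr => j _.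
    by rewrite rmorphM/= -pmulrn mulrA.
  rewrite (bigD1 y)//= eqxx big1 => [|x /negPf ->]; last by rewrite mulr0 mulr0z mulr0.
  by rewrite addr0 mulr1 -pmulrn => /eqP; rewrite mulf_eq0 (negPf NL) orbF => /eqP.
have [v vA v0] : exists2 v : 'rV[rat]_k, v *m A = 0 & v != 0.
  exists (nz_row (kermx A)); last by rewrite nz_row_eq0 kermx_eq0.
  by apply/sub_kermxP/nz_row_sub.
have [N N0 [z zE]] := common_denominator (fun x => v 0 x).
have zA j : \sum_x z x * (m x j)%:Z = 0.
  apply: (@intr_inj rat); rewrite rmorph_sum/=.
  have /rowP/(_ j) := vA; rewrite !mxE => /(congr1 ( *%R N%:R)); rewrite mulr0 mulr_sumr => vAj.
  rewrite rmorph0 -[RHS]vAj.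
  by apply: eq_bigr => x _; rewrite mxE rmorphM/= -zE -pmulrn mulrA (mulrC N%:R).
pose a x := if 0 <= z x then `|z x|%N else 0%N.
pose b x := if 0 <= z x then 0%N else `|z x|%N.
have abz x : (a x)%:Z - (b x)%:Z = z x by rewrite /a /b; case: ifP; lia.
exists a, b; split.
  have /rV0Pn[x vx] := v0.
  exists x; apply: contraNneq vx => abx; have := zE x; rewrite -abz abx subrr => /eqP.
  by rewrite mulf_eq0 pnatr_eq0 (gtn_eqF N0) orbF.
move=> j; apply/eqP; rewrite -(eqr_nat int) -subr_eq0 !natr_sum -sumrB -[X in _ == X](zA j).
by apply/eqP; apply: eq_bigr => x _; rewrite -abz !natrM mulrBl !natz.
Qed.

Section TorusSmooth.
Variables (n : nat) (I : finType) (mon : I -> 'X_{1..n}).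

(* No face polynomial of the form, and indeed no subsum, is singular in the torus. *)
Definition torus_smooth (K : fieldType) (lam : I -> K) :=
  forall (F : {set I}) (x : 'I_n -> K), F != finset.set0 -> (forall j, x j != 0) ->
    exists j, \sum_(i in F) lam i * \prod_l x l ^+ mon i l * (mon i j)%:R != 0.

(** Points of the moment curve: an integral relation among the heights is a polynomial condition on
    [t], so it fails for almost all [t]. The heights become the exponents of the prime in the
    coefficients. *)
Definition height (t : nat) (i : I) : nat := t ^ enum_rank i.

Definition height_relation t (M : {set I}) :=
  exists a b : 'I_#|M| -> nat,
    (forall j, \sum_x a x * mon (enum_val x) j = \sum_x b x * mon (enum_val x) j)%N /\
    (\sum_x a x * height t (enum_val x) < \sum_x b x * height t (enum_val x))%N.

Lemma generic_heights : exists t N : nat, (0 < N)%N /\ forall M,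
  height_relation t M \/
  forall (L : fieldType) (u : 'I_#|M| -> L),
     N%:R != 0 :> L -> (forall j, \sum_x u x * (mon (enum_val x) j)%:R = 0) ->
     forall x, u x = 0.
Proof.
have PM (M : {set I}) : exists PN : {poly rat} * nat, [/\ PN.1 != 0, (0 < PN.2)%N &
    forall t, ~~ root PN.1 t%:R -> height_relation t M \/
      forall (L : fieldType) (u : 'I_#|M| -> L),
     PN.2%:R != 0 :> L -> (forall j, \sum_x u x * (mon (enum_val x) j)%:R = 0) ->
     forall x, u x = 0].
  have [[a [b [[x abx] rel]]]|[N N0 ind]] := independence_dichotomy (fun x : 'I_#|M| => mon (enum_val x)).
    pose P : {poly rat} := \sum_x ((a x)%:R - (b x)%:R)%:P * 'X^(enum_rank (enum_val x)).
    exists (P, 1%N); split=> //=.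
      apply/eqP => /polyP/(_ (enum_rank (enum_val x))); rewrite coef0 coef_sum.
      rewrite (bigD1 x)//= coefCM coefXn eqxx mulr1 big1 ?addr0.
        by move/eqP; rewrite subr_eq0 eqr_nat (negPf abx).
      move=> y yx; rewrite coefCM coefXn; case: eqP => [|_]; last by rewrite mulr0.
      by move=> /val_inj/enum_rank_inj/enum_val_inj xy; rewrite xy eqxx in yx.
    move=> t Pt; left.
    have ht : (\sum_x a x * height t (enum_val x) != \sum_x b x * height t (enum_val x))%N.
      apply: contraNneq Pt => ht; rewrite rootE /P horner_sum.
      rewrite (eq_bigr (fun x => (a x * height t (enum_val x))%:R - (b x * height t (enum_val x))%:R)).
        by rewrite sumrB -!natr_sum ht subrr.
      by move=> y _; rewrite hornerM hornerC hornerXn !natrM natrX mulrBl.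
    by have [h|h] := ltnP (\sum_x a x * height t (enum_val x)) (\sum_x b x * height t (enum_val x));
      [exists a, b | exists b, a; split; rewrite // ltn_neqAle eq_sym ht].
  exists (1, N); split=> //=; first exact: oner_neq0.
  by move=> t _; right => L u; apply: ind.
have [PN PNP] := choice PM.
have [|t tP] := @natural_nonroot rat (\prod_M (PN M).1).
  by apply/prodf_neq0 => M _; have [] := PNP M.
exists t, (\prod_M (PN M).2)%N; split.
  by rewrite prodn_gt0// => M; have [] := PNP M.
move=> M; have [_ _ /(_ t)] := PNP M; case.
- by move: tP; rewrite /root horner_prod => /prodf_neq0/(_ M isT).
- by left.
- move=> ind; right=> L u NL; apply: ind; apply: contraNneq NL => NL.
  by rewrite (bigD1 M)//= natrM NL mul0r.
Qed.

Lemma p_adic_place (K : fieldType) p : [pchar K] =i pred0 -> prime p ->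
  exists (L : fieldType) (v : place K L), p \in [pchar L].
Proof.
move=> K0 pp; have [L [FL _]] := countable_algebraic_closure 'F_p.
pose G : set (K * L) := [set y | exists z : int, y = (z%:~R, z%:~R)]%classic.
have gG : specialization_graph G.
  split.
  - by exists 1.
  - by move=> _ _ _ _ [y [-> ->]] [z [-> ->]]; exists (y - z); rewrite !rmorphB.
  - by move=> _ _ _ _ [y [-> ->]] [z [-> ->]]; exists (y * z); rewrite !rmorphM.
  - move=> _ [z [/esym/eqP + ->]].
    suff -> : (z%:~R == 0 :> K) = (z == 0) by move=> /eqP->.
    case: z => i; rewrite ?NegzE ?rmorphN ?oppr_eq0/= -pmulrn; move/pcharf0P: K0 => -> //.
have [v vG] := place_extension gG.
exists L, v; apply: (rmorph_pchar FL); exact: pchar_Fp.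
Qed.

(** Suppose that a subsum is singular at a torus point. Dividing its terms by the one of least
    valuation at a place above [p] and reducing gives a linear relation with nonzero coefficients
    among the exponents of the surviving set [M]. So [M] is dependent modulo [p], and its exponents
    satisfy a relation [a], [b] violated by the heights. The two products of the surviving terms
    then differ by a positive power of [p], although both are units. *)
Lemma torus_smooth_exists (K : fieldType) d : [pchar K] =i pred0 -> (0 < d)%N ->
  (forall i, mdeg (mon i) = d) -> exists lam : I -> K, torus_smooth lam.
Proof.
move=> K0 d0 mond; have [t [N [N0 tN]]] := generic_heights.
have [p pN pp] := prime_above N.
have [L [v pL]] := p_adic_place K0 pp.
have pK0 : p%:R != 0 :> K by move/pcharf0P: K0 => ->; rewrite -lt0n prime_gt0.
have NL : N%:R != 0 :> L.
  by rewrite -(dvdn_pcharf pL) gtnNdvd.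
exists (fun i => p%:R ^+ height t i) => F x F0 x0.
apply: contrapT => /forallNP sing.
pose u i := p%:R ^+ height t i * \prod_l x l ^+ mon i l : K.
have u0 i : u i != 0.
  rewrite mulf_neq0 ?expf_neq0//; apply/prodf_neq0 => l _.
  by rewrite expf_neq0.
have singu j : \sum_(i in F) u i * (mon i j)%:R = 0.
  by apply: contrapT => /eqP/(sing j).
have /set0Pn[i1 i1F] := F0.
(* Terms outside [F] are set to 0, which forces the term of least valuation into [F]. *)
have [i0 [q [qO qE]]] := vring_min v i1 (fun i => if i \in F then u i else 0).
have i0F : i0 \in F.
  by have := qE i1; rewrite i1F; case: ifP => // _ /eqP; rewrite mulr0 (negPf (u0 i1)).
have qu i : i \in F -> u i = q i * u i0 by have := qE i; rewrite i0F => + iF; rewrite iF.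
have singq j : \sum_(i in F) q i * (mon i j)%:R = 0.
  apply: (mulIf (u0 i0)); rewrite mul0r mulr_suml -[RHS](singu j).
  by apply: eq_bigr => i /qu ->; rewrite mulrAC.
pose M := [set i in F | residue v (q i) != 0].
have i0M : i0 \in M.
  rewrite inE i0F (_ : q i0 = 1) ?residue1 ?oner_neq0//.
  by apply: (mulIf (u0 i0)); rewrite mul1r -qu.
have natO k : (k%:R : K) \in vring v by rewrite rpred_nat.
have resn k : residue v k%:R = k%:R.
  elim: k => [|k IHk]; first exact: residue0.
  by rewrite -addn1 !natrD residueD ?natO// IHk residue1.
have singM j : \sum_(y < #|M|) residue v (q (enum_val y)) * (mon (enum_val y) j)%:R = 0.
  rewrite -(big_enum_val (fun i => residue v (q i) * (mon i j)%:R)).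
  rewrite -[RHS](residue0 v) -(singq j) residue_sum; last by move=> i _; rewrite rpredM.
  rewrite [RHS](bigID (fun i => residue v (q i) != 0))/= [X in _ = _ + X]big1 ?addr0.
    by apply: eq_big => i; [rewrite inE | move=> _; rewrite residueM// resn].
  by move=> i /andP[_]; rewrite negbK => /eqP qi0; rewrite residueM// qi0 mul0r.
have [[a [b [rel hab]]]|ind] := tN M; last first.
  have := ind L _ NL singM (enum_rank_in i0M i0); rewrite enum_rankK_in//.
  by move: i0M; rewrite inE => /andP[_ /eqP].
have sumE (c : 'I_#|M| -> nat) : (\sum_j \sum_y c y * mon (enum_val y) j = (\sum_y c y) * d)%N.
  rewrite exchange_big big_distrl/=; apply: eq_bigr => y _.
  by rewrite -big_distrr/= -mdegE mond.
(* As all monomials have the same positive degree, a relation of exponents has equal total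
   multiplicities on both sides; this cancels the normalizing powers of [u i0]. *)
have ab : (\sum_y a y = \sum_y b y)%N.
  apply/eqP; rewrite -(eqn_pmul2r d0) -!sumE; apply/eqP.
  by apply: eq_bigr => j _; apply: rel.
have prodE (c : 'I_#|M| -> nat) : (\prod_y q (enum_val y) ^+ c y) * u i0 ^+ (\sum_y c y) =
    p%:R ^+ (\sum_y c y * height t (enum_val y)) * \prod_l x l ^+ (\sum_y c y * mon (enum_val y) l).
  rewrite -prodrXr -big_split/= -prodrXr.
  under [X in _ = _ * X]eq_bigr do rewrite -prodrXr.
  rewrite [X in _ = _ * X]exchange_big -big_split/=; apply: eq_bigr => y _.
  have yF : enum_val y \in F by have := enum_valP y; rewrite inE => /andP[].
  rewrite -exprMn -qu// /u exprMn -prodrXl -exprM mulnC; congr (_ * _).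
  by apply: eq_bigr => l _; rewrite -exprM mulnC.
have e0 : u i0 ^+ (\sum_y a y) != 0 by rewrite expf_neq0.
have X0 : \prod_l x l ^+ (\sum_y a y * mon (enum_val y) l) != 0.
  by apply/prodf_neq0 => l _; rewrite expf_neq0.
pose ha := (\sum_y a y * height t (enum_val y))%N.
pose hb := (\sum_y b y * height t (enum_val y))%N.
(* The relation cancels the torus coordinates as well, and only the excess of the heights
   remains. *)
have key : \prod_y q (enum_val y) ^+ b y = (\prod_y q (enum_val y) ^+ a y) * p%:R ^+ (hb - ha).
  apply: (mulIf e0); rewrite [RHS]mulrAC (prodE a) ab (prodE b) -/ha -/hb.
  rewrite mulrAC -exprD subnKC ?(ltnW hab)//; congr (_ * _).
  by apply: eq_bigr => l _; rewrite rel.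
have resq c : residue v (\prod_y q (enum_val y) ^+ c y) = \prod_(y < #|M|) residue v (q (enum_val y)) ^+ c y.
  rewrite residue_prod => [|y _]; last by rewrite rpredX.
  by apply: eq_bigr => y _; rewrite residueX.
have : residue v (\prod_(y < #|M|) q (enum_val y) ^+ b y) = 0.
  rewrite key residueM ?rpredX ?rpred_prod// => [|y _]; last by rewrite rpredX.
  by rewrite residueX// resn (pcharf0 pL) expr0n subn_eq0 leqNgt hab mulr0.
apply/eqP; rewrite resq; apply/prodf_neq0 => y _; rewrite expf_neq0//.
by have := enum_valP y; rewrite inE => /andP[].
Qed.

End TorusSmooth.

Lemma lin_subZ (R : comNzRingType) n (g : 'M[R]_n) c p :
  lin_sub g (c *: p) = c *: lin_sub g p.
Proof. exact: linearZ. Qed.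

Lemma lin_sub_sum (R : comNzRingType) n (g : 'M[R]_n) (I : Type) (r : seq I)
    (P : pred I) (F : I -> {mpoly R[n]}) :
  lin_sub g (\sum_(i <- r | P i) F i) = \sum_(i <- r | P i) lin_sub g (F i).
Proof. exact: linear_sum. Qed.

Lemma digits_inj B n (f g : nat -> nat) :
  (forall i, f i < B)%N -> (forall i, g i < B)%N ->
  (\sum_(i < n) f i * B ^ i = \sum_(i < n) g i * B ^ i)%N ->
  forall i, (i < n)%N -> f i = g i.
Proof.
elim: n f g => // n IHn f g fB gB.
rewrite !big_ord_recl /= !expn0 !muln1.
have shift (h : nat -> nat) :
    (\sum_(i < n) h (bump 0 i) * B ^ bump 0 i = (\sum_(i < n) h i.+1 * B ^ i) * B)%N.
  by rewrite big_distrl/=; apply: eq_bigr => i _; rewrite /bump /= add1n expnSr mulnA.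
rewrite !shift => fg.
have B0 : (0 < B)%N by apply: leq_ltn_trans (fB 0%N).
have fg0 : f 0%N = g 0%N.
  have := congr1 (modn^~ B) fg; rewrite addnC modnMDl modn_small//.
  by rewrite addnC modnMDl modn_small.
move: fg; rewrite fg0 => /addnI/eqP; rewrite eqn_pmul2r// => /eqP fgS.
by case=> [|i] //; rewrite ltnS; apply: (IHn (f \o succn) (g \o succn)) => // i'; rewrite /=.
Qed.

(** Kronecker substitution: with a base [B] exceeding all exponents, replacing [X_i] by [X^(B^i)]
    keeps distinct monomials distinct, which reduces the claim to one variable. *)
Lemma mpoly_nonzero_point (K : numFieldType) n (F : {mpoly K[n]}) :
  F != 0 -> exists y, F.@[y] != 0.
Proof.
move=> F0; pose B := (msize F).+1.
pose P : {poly K} := mmap polyC (fun i : 'I_n => 'X^(B ^ i)) F.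
pose e (m : 'X_{1..n}) := (\sum_(i < n) m i * B ^ i)%N.
have PE : P = \sum_(m <- msupp F) (F@_m)%:P * 'X^(e m).
  rewrite /P /mmap; apply: eq_bigr => m _; congr (_ * _).
  rewrite /mmap1 /e -prodrXr; apply: eq_bigr => i _.
  by rewrite -exprM mulnC.
have e_inj : {in msupp F &, injective e}.
  move=> m m' mF mF' em; apply/mnmP => i.
  have small (m1 : 'X_{1..n}) : m1 \in msupp F -> forall l, (odflt 0 (omap m1 (insub l)) < B)%N.
    move=> m1F l; case: insubP => //= l' _ _; rewrite ltnS.
    by rewrite (leq_trans _ (ltnW (msize_mdeg_lt m1F)))// mdegE (bigD1 l')//= leq_addr.
  have sE (m1 : 'X_{1..n}) : e m1 = (\sum_(l < n) odflt 0 (omap m1 (insub (nat_of_ord l))) * B ^ l)%N.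
    by apply: eq_bigr => l _; rewrite valK.
  have /(_ n) dig := digits_inj (small m mF) (small m' mF').
  have := dig _ i (ltn_ord i); rewrite valK; apply.
  exact: etrans (esym (sE m)) (etrans em (sE m')).
have P0 : P != 0.
  have [m mF] : exists m, m \in msupp F.
    by move: F0; rewrite -msupp_eq0; case: (msupp F) => // m s _; exists m; rewrite mem_head.
  apply/eqP => /polyP/(_ (e m)); rewrite PE coef_sum coef0 (bigD1_seq m)//= ?msupp_uniq//.
  rewrite coefCM coefXn eqxx mulr1 big1_seq ?addr0.
    by apply/eqP; rewrite -mcoeff_msupp.
  move=> m' /andP[m'm m'F]; rewrite coefCM coefXn; case: eqP => [/e_inj em|_]; last by rewrite mulr0.
  by rewrite em ?eqxx in m'm.
have [t] := natural_nonroot P0; rewrite rootE => Pt.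
exists (fun i => t%:R ^+ (B ^ i)); apply: contraNneq Pt => Ft.
rewrite -Ft PE horner_sum mevalE; apply/eqP; apply: eq_bigr => m _.
rewrite hornerM hornerC hornerXn; congr (_ * _).
by rewrite /e -prodrXr; apply: eq_bigr => i _; rewrite -exprM mulnC.
Qed.

Lemma mderiv_lin_sub (R : comNzRingType) n (k : 'M[R]_n) (f : {mpoly R[n]}) j :
  mderiv j (lin_sub k f) = \sum_i k j i *: lin_sub k (mderiv i f).
Proof.
pose P f := mderiv j (lin_sub k f) = \sum_i k j i *: lin_sub k (mderiv i f).
have PM p q : P p -> P q -> P (p * q).
  rewrite /P => Pp Pq; rewrite rmorphM mderivM Pp Pq mulr_suml mulr_sumr -big_split/=.
  apply: eq_bigr => i _; rewrite mderivM rmorphD !rmorphM/= scalerDr.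
  by rewrite scalerAl scalerAr.
have P1 : P 1.
  by rewrite /P rmorph1 mderivC big1// => i _; rewrite mderivC raddf0 scaler0.
have subUU (l : 'I_n) : (U_(l) - U_(l) = 0 :> 'X_{1..n})%MM.
  by rewrite -{1}[U_(l)%MM]add0m addmK.
have PX i : P 'X_i.
  rewrite /P lin_subXU raddf_sum/= (bigD1 j)//= mderivZ mderivX mnm1E eqxx.
  rewrite subUU mpolyX0 scale1r [X in _ + X]big1 ?addr0.
    rewrite (bigD1 i)//= mderivX mnm1E eqxx subUU mpolyX0 scale1r rmorph1 big1 ?addr0//.
    by move=> l li; rewrite mderivX mnm1E eq_sym (negPf li) scale0r raddf0 scaler0.
  by move=> l lj; rewrite mderivZ mderivX mnm1E (negPf lj) scale0r scaler0.
have PXm m : P 'X_[m].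
  rewrite mpolyXE_id; elim/big_ind: _ => // i _.
  elim: (m i) => [|e IHe]; rewrite ?expr0 ?exprS; first exact: P1.
  exact: PM.
rewrite -/(P f) [f]mpolyE; elim/big_ind: _ => [|p q Pp Pq|m _].
- by rewrite /P rmorph0 mderiv0 big1// => i _; rewrite mderiv0 rmorph0 scaler0.
- rewrite /P rmorphD mderivD Pp Pq -big_split/=; apply: eq_bigr => i _.
  by rewrite mderivD rmorphD scalerDr.
rewrite /P lin_subZ mderivZ PXm scaler_sumr; apply: eq_bigr => i _.
by rewrite mderivZ lin_subZ !scalerA mulrC.
Qed.

Lemma lin_sub_mderiv (R : comUnitRingType) n (k : 'M[R]_n) (f : {mpoly R[n]}) i :
  k \in unitmx ->
  lin_sub k (mderiv i f) = \sum_j invmx k i j *: mderiv j (lin_sub k f).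
Proof.
move=> ku; under eq_bigr do rewrite mderiv_lin_sub scaler_sumr.
rewrite exchange_big/=.
rewrite (eq_bigr (fun l => (invmx k *m k) i l *: lin_sub k (mderiv l f))); last first.
  by move=> l _; rewrite mxE scaler_suml; apply: eq_bigr => j _; rewrite scalerA.
rewrite mulVmx// (bigD1 i)//= mxE eqxx scale1r big1 ?addr0// => l /negPf li.
by rewrite mxE eq_sym li scale0r.
Qed.

Lemma weight_ge_mderiv (R : comNzRingType) n (w : 'I_n -> int) c (p : {mpoly R[n]}) j :
  weight_ge w c p -> weight_ge w (c - w j) (mderiv j p).
Proof.
move=> pc m; rewrite mcoeff_deriv => pm.
have /pc : p@_(m + U_(j)) != 0 by apply: contraNneq pm => ->; rewrite mul0rn.
rewrite mweightD lerBlDr; congr (_ <= _ + _).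
by rewrite /mweight (bigD1 j)//= mnm1E eqxx big1 ?addr0// => i /negPf ij;
  rewrite mnm1E eq_sym ij mulr0n.
Qed.

Section Curve.
Variables (K : numFieldType) (n : nat) (u : 'I_n -> nat) (y : 'I_n -> K).

Definition curve (p : {mpoly K[n]}) : {poly K} :=
  mmap polyC (fun j => (y j)%:P * 'X^(u j)) p.

HB.instance Definition _ := GRing.RMorphism.copy curve
  (mmap polyC (fun j => (y j)%:P * 'X^(u j))).

Lemma curveXU j : curve 'X_j = (y j)%:P * 'X^(u j).
Proof. by rewrite /curve mmapX mmap1U. Qed.

Lemma curveC c : curve c%:MP = c%:P.
Proof. by rewrite /curve mmapC. Qed.

Lemma curve_order (c : nat) p :
  weight_ge (fun j => (u j)%:Z) c%:Z p -> exists r, curve p = 'X^c * r.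
Proof.
move=> pc; rewrite [p]mpolyE big_seq rmorph_sum/=.
elim/big_ind: _ => [|q1 q2 [r1 ->] [r2 ->]|m].
- by exists 0; rewrite mulr0.
- by exists (r1 + r2); rewrite mulrDr.
rewrite mcoeff_msupp => /pc.
have -> : mweight (fun j => (u j)%:Z) m = (\sum_j u j * m j)%N.
  rewrite /mweight -[RHS]natz natr_sum; apply: eq_bigr => j _.
  by rewrite natrM !natz -mulr_natr natz.
rewrite lez_nat => cm; rewrite -mul_mpolyC rmorphM/= curveC mpolyXE_id rmorph_prod/=.
exists ((p@_m)%:P * (\prod_j (y j)%:P ^+ m j) * 'X^((\sum_j u j * m j) - c)).
rewrite mulrCA -exprD subnKC// -mulrA; congr (_ * _); rewrite -prodrXr -big_split/=.
by apply: eq_bigr => j _; rewrite rmorphXn/= curveXU exprMn -exprM.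
Qed.

End Curve.

Section Mobility.
Variables (K : numFieldType) (n : nat) (I : finType) (mon : I -> 'X_{1..n.+1}).
Variables (lam : I -> K) (i1 : I).
Hypothesis smooth_lam : torus_smooth mon lam.
Hypothesis mon_interior : forall a : 'I_n.+1 -> nat,
  (forall i, \sum_j a j <= \sum_j a j * mon i j)%N -> exists c, forall j, a j = c.
Local Notation f := (form_of mon lam).

(* Along the curve [t |-> (t ^ u_j y_j) k] the coordinate [x_i] has order [a_i];
   torus smoothness bounds the order of some [x_i d_i f] from above by the minimal
   [a]-weight of [f], and the chain rule bounds it from below. *)
Lemma heavy_weights_concentrated (k : 'M[K]_n.+1) (u : 'I_n.+1 -> nat) :
  k \in unitmx -> (exists j, u j = 0%N) ->
  weight_ge (fun j => (u j)%:Z) (\sum_j u j)%N%:Z (lin_sub k f) ->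
  (forall i, exists2 j, u j = 0%N & k j i != 0) /\
  exists j, forall l, l != j -> u l = 0%N.
Proof.
move=> ku [j0 uj0] kfs.
have colN0 i : exists j, k j i != 0.
  apply: contrapT => /forallNP k0; move: ku; rewrite unitmxE (expand_det_col _ i).
  by rewrite big1 ?unitr0// => j _; have /negP/negPn/eqP -> := k0 j; rewrite mul0r.
have aE i : exists j, k j i != 0 /\ forall l, k l i != 0 -> (u j <= u l)%N.
  have [j kj] := colN0 i; exists [arg min_(l < j | k l i != 0) u l].
  by case: arg_minnP => // l kl ul; split.
have [am amP] := choice aE.
(* [a i] bounds from below the order of the coordinate [x_i] along the curve, and [ell i] is its
   part of that order; [y] is chosen off the zeros of all the [ell i], so that the order is exactly
   [a i] with leading coefficient [x i]. *)
pose a i := u (am i).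
have a_le l i : k l i != 0 -> (a i <= u l)%N by have [_] := amP i; apply.
pose ell i : {mpoly K[n.+1]} := \sum_(j | u j == a i) k j i *: 'X_j.
have ell0 i : ell i != 0.
  have [ki _] := amP i; apply: contraNneq ki => /(congr1 (mcoeff U_(am i))).
  rewrite mcoeff0 raddf_sum (bigD1 (am i))//= mcoeffZ mcoeffX eqxx mulr1.
  rewrite big1 ?addr0 => [->//|j /andP[_ /negPf ji]].
  by rewrite mcoeffZ mcoeffX eq_mnm1 ji mulr0.
have [y yell] : exists y, forall i, (ell i).@[y] != 0.
  have [|y] := @mpoly_nonzero_point K _ (\prod_i ell i); first exact/prodf_neq0.
  by rewrite rmorph_prod => /prodf_neq0 h; exists y => i; apply: h.
pose x i := (ell i).@[y].
pose aw (m : 'X_{1..n.+1}) := (\sum_j a j * m j)%N.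
have [i2 i2min] : exists i2, forall i, (aw (mon i2) <= aw (mon i))%N.
  exists [arg min_(i < i1) aw (mon i)].
  by case: arg_minnP => // i _ imin l; apply: imin.
pose mu := aw (mon i2).
pose F := [set i | aw (mon i) == mu].
have F0 : F != finset.set0 by apply/set0Pn; exists i2; rewrite inE.
have [j1 smooth_j1] := smooth_lam F0 yell.
pose D i := lin_sub k (mderiv i f).
have DE i : D i = \sum_j invmx k i j *: mderiv j (lin_sub k f) by apply: lin_sub_mderiv.
pose xi i : {poly K} :=
  \sum_j (if k j i == 0 then 0 else (k j i * y j)%:P * 'X^(u j - a i)).
have xE i : curve u y (\sum_j k j i *: 'X_j) = 'X^(a i) * xi i.
  rewrite rmorph_sum mulr_sumr; apply: eq_bigr => j _ /=.
  rewrite -mul_mpolyC rmorphM/= curveC curveXU; case: eqVneq => [->|kj].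
    by rewrite mul0r mulr0.
  by rewrite [RHS]mulrCA -exprD subnKC ?a_le// polyCM mulrA.
have xi0 i : (xi i).[0] = x i.
  rewrite /x /ell horner_sum raddf_sum/= [RHS]big_mkcond/=; apply: eq_bigr => j _.
  case: eqVneq => [->|kj]; first by rewrite horner0 scale0r meval0 if_same.
  rewrite hornerM hornerC hornerXn expr0n subn_eq0 mevalZ mevalXU.
  have -> : (u j <= a i)%N = (u j == a i) by rewrite eqn_leq a_le ?andbT.
  by case: ifP; rewrite ?mulr1 ?mulr0.
(* Along the curve [x_j1 d_j1 f] equals [X^mu * S], and the constant term of [S] is the
   corresponding expression for the subsum over [F], the monomials of least [a]-weight, at the torus
   point [x]; the choice of [j1] makes it nonzero. *)
pose S : {poly K} := \sum_i (lam i * (mon i j1)%:R)%:P * 'X^(aw (mon i) - mu) *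
  \prod_l xi l ^+ mon i l.
have Xderiv (m : 'X_{1..n.+1}) : 'X_j1 * mderiv j1 'X_[m] = (m j1)%:R *: 'X_[K, m].
  rewrite mderivX -scalerAr; have [->|mj] := eqVneq (m j1) 0%N; first by rewrite !scale0r.
  rewrite -mpolyXD addmC submK//; apply/mnm_lepP => l; rewrite mnm1E.
  by case: eqP => [<-|//]; rewrite lt0n.
have SE : curve u y (lin_sub k 'X_j1) * curve u y (D j1) = 'X^mu * S.
  have XfE : 'X_j1 * mderiv j1 f = \sum_i (lam i * (mon i j1)%:R) *: 'X_[mon i].
    rewrite raddf_sum mulr_sumr; apply: eq_bigr => i _.
    by rewrite /= mderivZ -scalerAr Xderiv scalerA.
  have -> : curve u y (lin_sub k 'X_j1) * curve u y (D j1) =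
      curve u y (lin_sub k ('X_j1 * mderiv j1 f)) by rewrite !rmorphM.
  rewrite XfE lin_sub_sum rmorph_sum mulr_sumr.
  apply: eq_bigr => i _; rewrite lin_subZ -mul_mpolyC rmorphM /= curveC.
  rewrite -!mulrA mulrCA; congr (_ * _).
  rewrite mulrA -exprD subnKC ?i2min// lin_subX rmorph_prod/= /aw -prodrXr -big_split/=.
  by apply: eq_bigr => l _; rewrite rmorphXn/= xE exprMn -exprM.
have S0 : S.[0] != 0.
  apply: contraNneq smooth_j1 => S0; rewrite -[X in _ == X]S0 /S horner_sum [X in X == _]big_mkcond/=.
  apply/eqP; apply: eq_bigr => i _; rewrite !hornerM hornerC hornerXn horner_prod expr0n subn_eq0.
  have -> : (aw (mon i) <= mu)%N = (i \in F) by rewrite inE eqn_leq i2min andbT.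
  case: ifP => _; last by rewrite mulr0 mul0r.
  rewrite mulr1 mulrAC; congr (_ * _ * _); apply: eq_bigr => l _.
  by rewrite horner_exp xi0.
(* By the chain rule the derivative [D j1] combines the derivatives in the new coordinates, each of
   weight at least the sum of the [u l] minus [u j]. If none of those occurring satisfied the bound,
   [x_j1 D_j1] would vanish to order greater than [mu]. *)
have [j [kVj muj]] : exists j, invmx k j1 j != 0 /\ (a j1 + (\sum_l u l - u j) <= mu)%N.
  apply: contrapT => /forallNP Nj.
  have Dw : weight_ge (fun j => (u j)%:Z) (mu.+1 - a j1)%N%:Z (D j1).
    rewrite DE; apply: weight_ge_sum => j _.
    have [->|kj] := eqVneq (invmx k j1 j) 0; first by rewrite scale0r; apply: weight_ge0.
    apply/weight_geZ/weight_geW/weight_ge_mderiv/kfs.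
    have uj : (u j <= \sum_l u l)%N by rewrite (bigD1 j)//= leq_addr.
    rewrite subzn// lez_nat leqNgt; apply/negP => h; apply: (Nj j); split=> //.
    by lia.
  have [r rE] := curve_order y Dw.
  move: SE; rewrite rE lin_subXU xE => SE.
  have : 'X^mu * ('X * 'X^(a j1 + (mu.+1 - a j1) - mu.+1) * xi j1 * r) = 'X^mu * S.
    rewrite -SE !mulrA -exprSr -exprD subnKC; last by lia.
    by rewrite exprD [X in X * r]mulrAC.
  move=> /(mulfI _) SX; move: S0; rewrite -SX ?expf_neq0 ?polyX_eq0//.
  by rewrite !hornerM hornerX !mul0r eqxx.
(* A nonzero entry of the inverse is a nonzero cofactor, and a nonzero term of its expansion matches
   the rows other than [j] with the columns other than [j1] through nonzero entries of [k]; there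
   [a_le] applies. *)
have cof : (\sum_(i | i != j1) a i <= \sum_(l | l != j) u l)%N.
  have : cofactor k j j1 != 0.
    apply: contraNneq kVj => kj; rewrite /invmx ku !mxE kj mulr0 //.
  rewrite mulf_eq0 negb_or => /andP[_].
  rewrite /determinant => d0.
  have [s] : exists s : 'S_n, \prod_i row' j (col' j1 k) i (s i) != 0.
    apply: contrapT => /forallNP s0; case/eqP: d0; rewrite big1// => s _.
    by have /negP/negPn/eqP -> := s0 s; rewrite mulr0.
  move=> /prodf_neq0 ks.
  have liftE (g : 'I_n.+1 -> nat) l : (\sum_(i | i != l) g i = \sum_(i < n) g (lift l i))%N.
    have : (\sum_i g i = \sum_i g i)%N by [].
    by rewrite [X in X = _ -> _](bigD1 l)//= [X in _ = X -> _](bigD1_ord l)//= => /eqP; rewrite eqn_add2l => /eqP.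
  rewrite !liftE [X in (X <= _)%N](reindex_inj (@perm_inj _ s))/=.
  apply: leq_sum => l _; apply: a_le; have := ks l isT; by rewrite !mxE.
have aS : (\sum_j a j <= mu)%N.
  apply: leq_trans muj; rewrite (bigD1 j1)//= leq_add2l (leq_trans cof)//.
  by rewrite [X in (_ <= X - _)%N](bigD1 j)//= addKn.
have [|c ac] := mon_interior (a := a); first by move=> i; apply: leq_trans (i2min i).
(* All [a i] coincide, and one of them is 0 because row [j0] of [k] is not zero while [u j0 = 0]. *)
have c0 : c = 0%N.
  have [i ki] : exists i, k j0 i != 0.
    apply: contrapT => /forallNP k0; move: ku; rewrite unitmxE (expand_det_row _ j0).
    by rewrite big1 ?unitr0// => i _; have /negP/negPn/eqP -> := k0 i; rewrite mul0r.
  by have := a_le _ _ ki; rewrite uj0 leqn0 ac => /eqP.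
split=> [i|].
  by exists (am i); [have := ac i; rewrite c0 | have [] := amP i].
exists j => l lj; have mu0 : mu = 0%N.
  by rewrite /mu /aw big1// => i _; rewrite ac c0.
move: muj; rewrite mu0 leqn0 addn_eq0 => /andP[_]; rewrite (bigD1 j)//= addKn.
by rewrite sum_nat_eq0 => /forallP/(_ l); rewrite lj => /eqP.
Qed.

End Mobility.

Lemma meval_eq0_mpoly (K : numFieldType) n (p : {mpoly K[n]}) :
  (forall y, p.@[y] = 0) -> p = 0.
Proof.
move=> p0; apply/eqP; apply: contrapT => /negP/mpoly_nonzero_point[y].
by rewrite p0 eqxx.
Qed.

Section Restriction.
Variables (K : numFieldType) (n : nat) (A : {set 'I_n}).

Definition mrestrict (p : {mpoly K[n]}) : {mpoly K[n]} :=
  \sum_(m <- msupp p | [forall j in A, m j == 0%N]) p@_m *: 'X_[m].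

Lemma meval_mrestrict p (y : 'I_n -> K) :
  (mrestrict p).@[y] = p.@[fun j => if j \in A then 0 else y j].
Proof.
rewrite [in RHS](mpolyE p) /mrestrict !raddf_sum big_mkcond/=; apply: eq_bigr => m _.
rewrite !mevalZ !mevalX; case: ifP => [/forall_inP mA|/negbT/forall_inPn[j jA mj]].
  congr (_ * _); apply: eq_bigr => j _; case: ifP => // jA.
  by rewrite (eqP (mA j jA)) !expr0.
rewrite [X in _ * X](_ : _ = 0) ?mulr0// (bigD1 j)//= jA expr0n (negPf mj).
by rewrite mul0r.
Qed.

Lemma mcoeff_vanishing p (m : 'X_{1..n}) : (forall j, j \in A -> m j = 0%N) ->
  (forall y : 'I_n -> K, (forall j, j \in A -> y j = 0) -> p.@[y] = 0) -> p@_m = 0.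
Proof.
move=> mA pA; have /(congr1 (mcoeff m)) : mrestrict p = 0.
  by apply: meval_eq0_mpoly => y; rewrite meval_mrestrict pA// => j ->.
rewrite mcoeff0 /mrestrict raddf_sum/=.
have [mp|mp] := boolP (m \in msupp p); last by rewrite (memN_msupp_eq0 mp).
have mA' : [forall j in A, m j == 0%N] by apply/forall_inP => j /mA ->.
rewrite -big_filter (bigD1_seq m) ?mem_filter ?mA' ?filter_uniq ?msupp_uniq//=.
rewrite mcoeffZ mcoeffX eqxx mulr1 big1 ?addr0// => k km.
by rewrite mcoeffZ mcoeffX (negPf km) mulr0.
Qed.

End Restriction.

(** On the line, [F] becomes a polynomial of degree exactly [d + 1] with leading coefficient [F(q)];
    [top] tracks degree bound and leading coefficient through products. *)
Lemma line_root (K : numClosedFieldType) n d (F : {mpoly K[n]}) (p q : 'I_n -> K) :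
  F \is d.+1.-homog -> F.@[q] != 0 -> exists t, F.@[fun j => p j + t * q j] = 0.
Proof.
move=> Fd Fq.
pose top (c : K) e (P : {poly K}) := (size P <= e.+1)%N /\ P`_e = c.
have topM c1 c2 e1 e2 P1 P2 : top c1 e1 P1 -> top c2 e2 P2 ->
    top (c1 * c2) (e1 + e2)%N (P1 * P2).
  move=> [s1 <-] [s2 <-]; split.
    by rewrite (leq_trans (size_polyMleq _ _))//; move: s1 s2; lia.
  have h : (e1 < (e1 + e2).+1)%N by rewrite ltnS leq_addr.
  rewrite coefM (bigD1 (Ordinal h))//=.
  rewrite addKn big1 ?addr0// => i ie1.
  have [lt|gt|eq] := ltngtP i e1.
  - by rewrite [P2`_ _]nth_default ?mulr0// (leq_trans s2)//; lia.
  - by rewrite [P1`_ _]nth_default ?mul0r// (leq_trans s1).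
  - by move: ie1; rewrite -val_eqE/= eq eqxx.
pose line j : {poly K} := (p j)%:P + (q j)%:P * 'X.
have top_line j : top (q j) 1%N (line j).
  split; last by rewrite coefD coefC coefMX coefC add0r.
  rewrite (leq_trans (size_polyD _ _))// geq_max (leq_trans (size_polyC_leq1 _))//=.
  by rewrite (leq_trans (size_polyMleq _ _))// size_polyX; have := size_polyC_leq1 (q j); lia.
have topXn c e P k : top c e P -> top (c ^+ k) (e * k)%N (P ^+ k).
  move=> cP; elim: k => [|k IHk]; last by rewrite !exprS mulnS; apply: topM.
  by rewrite !expr0 muln0; split; [rewrite size_poly1 | rewrite coef1].
pose P : {poly K} := \sum_(m <- msupp F) (F@_m)%:P * \prod_j line j ^+ m j.
have PE t : P.[t] = F.@[fun j => p j + t * q j].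
  rewrite /P horner_sum mevalE; apply: eq_bigr => m _.
  rewrite hornerM hornerC horner_prod; congr (_ * _); apply: eq_bigr => j _.
  by rewrite horner_exp hornerD hornerMX !hornerC mulrC.
have [sP cP] : top F.@[q] d.+1 P.
  rewrite /P mevalE !big_seq; elim/big_rec2: _ => [|m c Q mF [sQ <-]].
    by split; [rewrite size_poly0 | rewrite coef0].
  have [sm cm] : top (F@_m * \prod_i q i ^+ m i) d.+1 ((F@_m)%:P * \prod_j line j ^+ m j).
    rewrite -[d.+1]add0n; apply: (topM F@_m); first by split; [exact: size_polyC_leq1 | rewrite coefC].
    have <- : (\sum_(j < n) m j)%N = d.+1.
      by rewrite -mdegE; move/dhomogP: Fd => /(_ _ mF).
    elim/big_rec3: _ => [|j Q1 e c1 _ IH]; first by split; [rewrite size_poly1 | rewrite coef1].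
    by have := topXn _ _ _ (m j) (top_line j); rewrite mul1n => h; apply: topM h IH.
  split; last by rewrite coefD cm.
  by rewrite (leq_trans (size_polyD _ _))// geq_max sm.
have /closed_rootP[t /rootP Pt] : size P != 1%N.
  apply: contraNneq Fq => P1; rewrite -cP nth_default// P1//.
by exists t; rewrite -PE.
Qed.

(** * Numerical stability of forms nonsingular in the torus *)

Section Stability.
Variables (K : numClosedFieldType) (n : nat) (I : finType) (mon : I -> 'X_{1..n.+1}).
Variables (lam : I -> K) (i1 : I).
Hypothesis n_gt1 : (1 < n)%N.
Hypothesis mon_deg : forall i, mdeg (mon i) = n.+1.
Hypothesis smooth_lam : torus_smooth mon lam.
Hypothesis mon_interior : forall a : 'I_n.+1 -> nat,
  (forall i, \sum_j a j <= \sum_j a j * mon i j)%N -> exists c, forall j, a j = c.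
Local Notation f := (form_of mon lam).

Lemma form_of_homog : f \is n.+1.-homog.
Proof. by apply: rpred_sum => i _; rewrite rpredZ// dhomogX/= mon_deg. Qed.

Lemma meval_mderiv_form i (x : 'I_n.+1 -> K) :
  x i * (mderiv i f).@[x] = \sum_l lam l * \prod_j x j ^+ mon l j * (mon l i)%:R.
Proof.
have -> : mderiv i f = \sum_l lam l *: mderiv i 'X_[mon l].
  by rewrite raddf_sum; apply: eq_bigr => l _; rewrite /= mderivZ.
rewrite raddf_sum mulr_sumr; apply: eq_bigr => l _ /=.
rewrite mevalZ mderivX mevalZ mevalX.
have [->|ml] := eqVneq (mon l i) 0%N; first by rewrite mul0r !mulr0.
have -> : \prod_j x j ^+ mon l j = x i * \prod_j x j ^+ (mon l - U_(i))%MM j.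
  rewrite (bigD1 i)//= [in RHS](bigD1 i)//= mulrA -exprS mnmBE mnm1E eqxx subn1.
  rewrite prednK ?lt0n//; congr (_ * _); apply: eq_bigr => j /negPf ji.
  by rewrite mnmBE mnm1E eq_sym ji subn0.
ring.
Qed.

(* A form divisible by a coordinate [y_j1] whose residual [Q] is not singular in
   the torus would have [Q] vanish along [y_j1 = x_i = 0]; the form would then be
   in the square of the ideal [(y_j1, x_i)]. *)
Lemma no_plane_component (k : 'M[K]_n.+1) (j1 : 'I_n.+1) (Q : {mpoly K[n.+1]}) :
  k \in unitmx -> lin_sub k f = 'X_j1 * Q -> Q \is n.-homog ->
  (forall i, exists2 l, l != j1 & k l i != 0) -> False.
Proof.
move=> ku kfE Qn kN0.
pose xh i : {mpoly K[n.+1]} := mrestrict [set j1] (\sum_j k j i *: 'X_j).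
pose Qh := mrestrict [set j1] Q.
pose z (y : 'I_n.+1 -> K) j := if j \in [set j1] then 0 else y j.
have zj1 y : z y j1 = 0 by rewrite /z inE eqxx.
have xhE i y : (xh i).@[y] = \sum_j k j i * z y j.
  rewrite /xh meval_mrestrict raddf_sum/=; apply: eq_bigr => j _.
  by rewrite mevalZ mevalXU.
have QhE y : Qh.@[y] = Q.@[z y] by rewrite /Qh meval_mrestrict.
have xh0 i : xh i != 0.
  have [l lj1 kl] := kN0 i; apply: contraNneq kl => xi0.
  have := xhE i (fun j => (j == l)%:R); rewrite xi0 meval0 (bigD1 l)//= big1.
    by rewrite addr0 /z inE (negPf lj1) eqxx mulr1 => <-.
  by move=> j /negPf jl; rewrite /z jl if_same mulr0.
(* On the plane [y_j1 = 0] all derivatives of [X_j1 * Q] vanish wherever [Q] does, so [f] is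
   singular there and such a point cannot lie in the torus. *)
have claim y : Qh.@[y] = 0 -> exists i, (xh i).@[y] = 0.
  move=> Qy; apply: contrapT => /forallNP x0.
  pose x i := \sum_j k j i * z y j.
  have xN0 i : x i != 0 by rewrite /x -xhE; apply/eqP/x0.
  have T0 : [set: I] != finset.set0 by apply/set0Pn; exists i1; rewrite inE.
  case: (smooth_lam T0 xN0) => i.
  rewrite (eq_bigl xpredT) => [|l]; last by rewrite inE.
  rewrite -meval_mderiv_form => /eqP[]; rewrite -meval_lin_sub lin_sub_mderiv// kfE.
  rewrite raddf_sum big1 ?mulr0// => j _ /=; rewrite mevalZ mderivM mevalD !mevalM.
  by rewrite mevalXU zj1 mul0r addr0 -QhE Qy mulr0 mulr0.
have Qh_homog : Qh \is n.-homog.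
  rewrite /Qh /mrestrict big_seq_cond; apply: rpred_sum => m /andP[mQ _].
  by rewrite rpredZ// dhomogX/=; apply/eqP; move/dhomogP: Qn => /(_ _ mQ).
have [i iP] : exists i, forall p, (xh i).@[p] = 0 -> Qh.@[p] = 0.
  have [Qh0|Qh0] := eqVneq Qh 0; first by exists ord0 => p _; rewrite Qh0 meval0.
  have [|q] := @mpoly_nonzero_point K _ (Qh * \prod_i xh i).
    by rewrite mulf_neq0//; apply/prodf_neq0.
  rewrite mevalM mulf_eq0 negb_or rmorph_prod => /andP[Qq /prodf_neq0 xq].
  (* [G i] is [Qh] composed with the projection along [q] onto the hyperplane [xh i = 0]. Every line
     in direction [q] meets the zeros of [Qh], and does so on one of these hyperplanes; hence the
     product of the [G i] vanishes identically, and so does one factor. *)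
  pose G i : {mpoly K[n.+1]} :=
    Qh \mPo [tuple 'X_j - (q j / (xh i).@[q]) *: xh i | j < n.+1].
  have GE i p : (G i).@[p] = Qh.@[fun j => p j - (xh i).@[p] / (xh i).@[q] * q j].
    rewrite /G comp_mpoly_meval; apply: meval_eq => j.
    rewrite tnth_mktuple mevalB mevalXU mevalZ; congr (_ - _).
    by rewrite mulrC -!mulrA (mulrC (q j)).
  have : \prod_i G i = 0.
    apply: meval_eq0_mpoly => p; rewrite rmorph_prod.
    have [|t Qt] := @line_root _ _ n.-1 Qh p q _ Qq.
      by rewrite prednK// ltnW.
    have [i xi] := claim _ Qt.
    have xq0 : (xh i).@[q] != 0 := xq i isT.
    apply/eqP/prodf_eq0; exists i => //; apply/eqP; rewrite -[LHS]/((G i).@[p]) GE.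
    have xiE : (xh i).@[fun j => p j + t * q j] = (xh i).@[p] + t * (xh i).@[q].
      rewrite !xhE mulr_sumr -big_split/=; apply: eq_bigr => j _.
      by rewrite /z; case: ifP => _; rewrite ?mulr0 ?addr0//; ring.
    have tE : t = - ((xh i).@[p] / (xh i).@[q]).
      apply: (mulIf xq0); rewrite mulNr divfK//; apply/eqP.
      by rewrite -subr_eq0 opprK addrC -xiE xi.
    rewrite -[RHS]Qt; apply: meval_eq => j.
    by rewrite tE mulNr.
  move=> /eqP; rewrite prodf_seq_eq0 => /hasP[i _ /= /eqP Gi].
  exists i => p xp; have := GE i p; rewrite Gi meval0 xp mul0r => pE; rewrite [RHS]pE.
  by apply: meval_eq => j; rewrite mul0r subr0.
have [l lj1 kl] := kN0 i.
(* [T], with inverse [S], fixes [X_j1] and sends the linear form given by column [i] of [k] to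
   [X_l]. *)
pose T : 'M[K]_n.+1 := \matrix_(a, b)
  (if b == l then (if a == l then (k l i)^-1 else - (k a i / k l i)) else (a == b)%:R).
pose S : 'M[K]_n.+1 := \matrix_(a, b) (if b == l then k a i else (a == b)%:R).
have ST : S *m T = 1%:M.
  apply/matrixP => a b; rewrite !mxE (bigD1 l)//= !mxE eqxx.
  have [->|bl] := eqVneq b l.
    under eq_bigr => c cl do rewrite !mxE eqxx (negPf cl).
    have [->|al] := eqVneq a l.
      rewrite mulfV// big1 ?addr0// => c cl.
      by rewrite eq_sym (negPf cl) mul0r.
    rewrite (bigD1 a)//= eqxx mul1r big1 ?addr0 ?subrr// => c /andP[_ ca].
    by rewrite eq_sym (negPf ca) mul0r.
  under eq_bigr => c cl do rewrite !mxE (negPf bl) (negPf cl).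
  rewrite mulr0 add0r (bigD1 b)//= eqxx mulr1 big1 ?addr0//.
  by move=> c /andP[_ cb]; rewrite (negPf cb) mulr0.
have [_ uT] := mulmx1_unit ST.
pose Q' := lin_sub T Q.
have TE : lin_sub (T *m k) f = 'X_j1 * Q'.
  rewrite lin_subM kfE rmorphM; congr (_ * _); rewrite /= lin_subXU (bigD1 j1)//=.
  rewrite mxE eq_sym (negPf lj1) eqxx scale1r big1 ?addr0// => j /negPf jj1.
  by rewrite mxE eq_sym (negPf lj1) jj1 scale0r.
have Q'0 (y : 'I_n.+1 -> K) : y j1 = 0 -> y l = 0 -> Q'.@[y] = 0.
  move=> yj1 yl; rewrite /Q' meval_lin_sub; set y' := (fun i => _).
  have y'j1 : y' j1 = 0.
    rewrite /y' big1// => j _; rewrite mxE eq_sym (negPf lj1).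
    by case: eqP => [->|]; rewrite ?yj1 ?mulr0 ?mul0r.
  have zy' : z y' =1 y'.
    by move=> j; rewrite /z inE; case: eqP => // ->; rewrite y'j1.
  rewrite -(meval_eq _ zy') -QhE; apply: iP; rewrite xhE.
  under eq_bigr do rewrite zy' mulrC.
  rewrite (eq_bigr (fun b => \sum_a y a * (T a b * k b i))); last first.
    move=> b _; rewrite /y' mulr_suml; apply: eq_bigr => a _.
    by rewrite (mulrC (T a b)) mulrA.
  rewrite exchange_big/=.
  have TS : T *m S = 1%:M by apply: mulmx1C.
  rewrite (eq_bigr (fun a => y a * (T *m S) a l)); last first.
    move=> a _; rewrite mxE mulr_sumr; apply: eq_bigr => b _.
    by rewrite [S _ _]mxE eqxx.
  rewrite TS (bigD1 l)//= yl mul0r add0r big1// => a al.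
  by rewrite mxE (negPf al) mulr0.
(* In the new coordinates both factors of [X_j1 * Q'] have positive weight for the indicator [u'] of
   [j1] and [l], so the total reaches 2, the sum of the weights. But [heavy_weights_concentrated]
   allows only one nonzero weight. *)
pose u' (j : 'I_n.+1) : nat := (j \in [set j1; l]).
have u'S : (\sum_j u' j = 2)%N.
  rewrite /u' (bigD1 j1)//= (bigD1 l)//= !inE !eqxx orbT big1 ?addn0//.
  by move=> j /andP[j_1 j_l]; rewrite !inE (negPf j_1) (negPf j_l).
have w2 : weight_ge (fun j => (u' j)%:Z) (\sum_j u' j)%N%:Z (lin_sub (T *m k) f).
  rewrite u'S TE (_ : 2%N%:Z = 1 + 1 :> int)//; apply: weight_geM.
    have u'1 : (u' j1)%:Z = 1 by rewrite /u' !inE eqxx.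
    rewrite -[X in weight_ge _ X _]u'1.
    exact: (@weight_geXU K _ (fun j => (u' j)%:Z) j1).
  move=> m; apply: contraNT; rewrite -ltNge => mw.
  apply/eqP; apply: (@mcoeff_vanishing _ _ [set j1; l]) => [j|y y0]; last first.
    by apply: Q'0; apply: y0; rewrite !inE eqxx ?orbT.
  move=> jA; apply/eqP; rewrite -leqn0 -ltnS -ltz_nat; apply: le_lt_trans mw.
  rewrite /mweight (bigD1 j)//= /u' jA -[X in X <= _]addr0 lerD//.
    by rewrite -mulr_natr mul1r natz.
  by apply: sumr_ge0 => a _; rewrite -mulr_natr natz.
have uTk : T *m k \in unitmx by rewrite unitmx_mul uT.
have [j0 j0P] : exists j0, j0 \notin [set j1; l].
  apply: contrapT => /forallNP all.
  have : (#|[set: 'I_n.+1]| <= #|[set j1; l]|)%N.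
    by apply: subset_leq_card; apply/fintype.subsetP => j _; apply/negPn/negP/all.
  by rewrite cardsT card_ord cards2; case: eqP => _; move: n_gt1; lia.
have [|_ [j jP]] := heavy_weights_concentrated i1 smooth_lam mon_interior uTk _ w2.
  by exists j0; rewrite /u' (negPf j0P).
have [jj1|jj1] := eqVneq j j1.
  by have := jP l; rewrite jj1 /u' !inE eqxx orbT => /(_ lj1).
by have := jP j1; rewrite eq_sym jj1 /u' !inE eqxx => /(_ isT).
Qed.

(** Subtracting its minimum turns [w] into a nonnegative weight [u] with a zero. As the degree
    [n + 1] is also the number of variables and [w] has sum 0, nonnegativity of [w] on the form
    means that its [u]-weight is at least the sum of the [u j]. By [heavy_weights_concentrated] only
    one [u j1] is positive, and then [X_j1] divides the form, against [no_plane_component]. *)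
Lemma torus_smooth_numerically_stable : numerically_stable f.
Proof.
move=> k w ku w0 [i0 wi0]; apply: contrapT => wN.
have fn := lin_sub_homog k form_of_homog.
have w_ge m : m \in msupp (lin_sub k f) -> 0 <= mweight w m.
  by move=> mf; rewrite leNgt; apply/negP => wm; apply: wN; exists m.
pose jm := [arg min_(j < ord0) w j]%O.
have jmP j : w jm <= w j by rewrite /jm; case: arg_minP => // i _; apply.
pose u j := absz (w j - w jm).
have uE j : (u j)%:Z = w j - w jm by rewrite /u gez0_abs// subr_ge0.
have ujm : u jm = 0%N by rewrite /u subrr.
have uw m : m \in msupp (lin_sub k f) -> (\sum_j u j)%N%:Z <= mweight (fun j => (u j)%:Z) m.
  move=> mf; have md : mdeg m = n.+1 by move/dhomogP: fn => /(_ _ mf).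
  have -> : (\sum_j u j)%N%:Z = - (w jm *+ n.+1).
    rewrite -[LHS]natz natr_sum; under eq_bigr do rewrite natz uE.
    by rewrite sumrB w0 sub0r sumr_const card_ord.
  have -> : mweight (fun j => (u j)%:Z) m = mweight w m - w jm *+ n.+1.
    rewrite /mweight; under eq_bigr do rewrite uE mulrnBl.
    by rewrite sumrB sumrMnr -mdegE md.
  by rewrite -[X in X <= _]add0r lerD2r w_ge.
have kw : weight_ge (fun j => (u j)%:Z) (\sum_j u j)%N%:Z (lin_sub k f).
  by move=> m m0; apply: uw; rewrite mcoeff_msupp.
have ex0 : exists j, u j = 0%N by exists jm.
have [kN0 [j1 j1P]] := heavy_weights_concentrated i1 smooth_lam mon_interior ku ex0 kw.
have uj1 : (0 < u j1)%N.
  rewrite lt0n; apply/eqP => uj1.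
  have wc j : w j = w jm.
    apply/eqP; rewrite -subr_eq0 -uE; have [->|/j1P ->//] := eqVneq j j1.
    by rewrite uj1.
  move: w0; under eq_bigr do rewrite wc; rewrite sumr_const card_ord => /eqP.
  by rewrite mulrn_eq0/= -(wc i0) (negPf wi0).
have mj1 m : m \in msupp (lin_sub k f) -> (0 < m j1)%N.
  move=> /uw; rewrite (bigD1 j1)//= big1 ?addn0; last by move=> j /j1P.
  rewrite /mweight (bigD1 j1)//= big1 ?addr0; last by move=> j /j1P ->; rewrite mul0rn.
  by rewrite lt0n; apply: contraTneq => ->; rewrite mulr0n -ltNge ltz_nat.
pose Q := \sum_(m <- msupp (lin_sub k f)) (lin_sub k f)@_m *: 'X_[m - U_(j1)].
apply: (@no_plane_component k j1 Q ku).
- rewrite [LHS](mpolyE (lin_sub k f)) mulr_sumr !big_seq; apply: eq_bigr => m mf.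
  rewrite -scalerAr -mpolyXD addmC submK//; apply/mnm_lepP => j; rewrite mnm1E.
  by case: eqP => // <-; apply: mj1.
- rewrite /Q big_seq; apply: rpred_sum => m mf; rewrite rpredZ// dhomogX/=.
  have md : mdeg m = n.+1 by move/dhomogP: fn => /(_ _ mf).
  have := mdegD (m - U_(j1)) U_(j1); rewrite submK ?md ?mdeg1 ?addn1.
    by move=> /eqP; rewrite eqSS eq_sym.
  apply/mnm_lepP => j; rewrite mnm1E.
  by case: eqP => // <-; apply: mj1.
- move=> i; have [l ul kl] := kN0 i; exists l => //.
  by apply: contraTneq uj1 => <-; rewrite ul.
Qed.

End Stability.

(** * Regular subdivisions *)

Lemma sum_option (V : nmodType) (I : finType) (F : option I -> V) :
  \sum_o F o = F None + \sum_i F (Some i).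
Proof.
rewrite (bigD1 None)//= (reindex_omap Some id)/=; last by case.
by congr (_ + _); apply: eq_bigl => i; rewrite eqxx.
Qed.

Section FiniteHulls.
Local Open Scope classical_set_scope.
Variables (R : realType) (n : nat).
Implicit Types (x y : 'rV[R]_n) (w : 'cV[R]_(n + 1)).

(** Affine functions are column vectors with the constant term last, so that Farkas' lemma applies
    directly to the homogenized points [row_mx x 1]. *)
Definition affine_eval w x : R := (row_mx x 1%:M *m w) 0 0.

Lemma affine_evalE w x :
  affine_eval w x = (x *m usubmx w) 0 0 + w (rshift n 0) 0.
Proof.
by rewrite /affine_eval -{1}[w]vsubmxK mul_row_col mul1mx mxE [dsubmx w _ _]mxE.
Qed.

Lemma affine_evalD w1 w2 x :
  affine_eval (w1 + w2) x = affine_eval w1 x + affine_eval w2 x.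
Proof. by rewrite /affine_eval mulmxDr mxE. Qed.

Lemma affine_evalZ a w x : affine_eval (a *: w) x = a * affine_eval w x.
Proof. by rewrite /affine_eval -scalemxAr mxE. Qed.

Lemma affine_evalN w x : affine_eval (- w) x = - affine_eval w x.
Proof. by rewrite -scaleN1r affine_evalZ mulN1r. Qed.

Lemma affine_eval_conv (I : finType) (t : I -> R) (pt : I -> 'rV[R]_n) w :
  \sum_i t i = 1 ->
  affine_eval w (\sum_i t i *: pt i) = \sum_i t i * affine_eval w (pt i).
Proof.
move=> t1; rewrite affine_evalE mulmx_suml summxE.
under [RHS]eq_bigr do rewrite affine_evalE mulrDr.
rewrite big_split/= -mulr_suml t1 mul1r; congr (_ + _); apply: eq_bigr => i _.
by rewrite -scalemxAl mxE.
Qed.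

Lemma affine_eval_col (a : 'cV[R]_n) (b : 'cV[R]_1) x :
  affine_eval (col_mx a b) x = (x *m a) 0 0 + b 0 0.
Proof. by rewrite /affine_eval mul_row_col mul1mx mxE. Qed.

Lemma affine_eval_const (b : R) x : affine_eval (col_mx 0 b%:M) x = b.
Proof. by rewrite affine_eval_col mulmx0 !mxE eqxx mulr1n add0r. Qed.

Lemma affine_eval_ext (I : finType) (t : I -> R) (pt : I -> 'rV[R]_n) x :
  (forall w, affine_eval w x = \sum_i t i * affine_eval w (pt i)) ->
  \sum_i t i = 1 /\ x = \sum_i t i *: pt i.
Proof.
move=> xE; split.
  have := xE (col_mx 0 1%:M); rewrite affine_eval_const => ->.
  by apply: eq_bigr => i _; rewrite affine_eval_const mulr1.
apply/rowP => j; have := xE (col_mx (delta_mx j 0) 0).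
rewrite affine_eval_col -colE !mxE addr0 => ->; rewrite summxE; apply: eq_bigr => i _.
by rewrite affine_eval_col -colE !mxE addr0.
Qed.

Section Hull.
Variables (I : finType) (pt : I -> 'rV[R]_n).
Implicit Types (T : {set I}).

(** Weights are indexed by all of [I] and vanish off [T], so hulls of different subsets are compared
    termwise. *)
Definition hull (T : {set I}) : set 'rV[R]_n :=
  [set y | exists t : I -> R, [/\ forall i, 0 <= t i, forall i, i \notin T -> t i = 0,
    \sum_i t i = 1 & y = \sum_i t i *: pt i]].

Lemma hull_pt T i : i \in T -> hull T (pt i).
Proof.
move=> iT; exists (fun j => (j == i)%:R); split.
- by move=> j; rewrite ler0n.
- by move=> j; apply: contraNeq; rewrite pnatr_eq0 eqb0 negbK => /eqP->.
- by rewrite (bigD1 i)//= eqxx big1 ?addr0// => j /negPf->.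
- by rewrite (bigD1 i)//= eqxx scale1r big1 ?addr0// => j /negPf->; rewrite scale0r.
Qed.

Lemma hullS (T T' : {set I}) : T \subset T' -> hull T `<=` hull T'.
Proof.
move=> /fintype.subsetP TT y [t [t0 tT t1 yE]]; exists t; split=> // i iT'.
by apply: tT; apply: contraNN iT'; apply: TT.
Qed.

Lemma hull_convex T x y a : hull T x -> hull T y -> 0 <= a <= 1 ->
  hull T (a *: x + (1 - a) *: y).
Proof.
move=> [t [t0 tT t1 ->]] [s [s0 sT s1 ->]] /andP[a0 a1].
exists (fun i => a * t i + (1 - a) * s i); split.
- by move=> i; rewrite addr_ge0 ?mulr_ge0 ?subr_ge0.
- by move=> i iT; rewrite tT// sT// !mulr0 addr0.
- by rewrite big_split/= -!mulr_sumr t1 s1 !mulr1 addrC subrK.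
- rewrite !scaler_sumr -big_split/=; apply: eq_bigr => i _.
  by rewrite !scalerA -scalerDl.
Qed.

Lemma conv_hull_finite T : conv_hull [set pt i | i in [set` T]] = hull T.
Proof.
apply/seteqP; split=> y.
  move=> [k [x [t [xT t0 t1 ->]]]].
  have xT' j : {i | i \in T & pt i = x j}.
    by apply/cid2; have [i iT] := xT j; exists i.
  pose f j := s2val (xT' j).
  have fT j : f j \in T by rewrite /f; case: (xT' j).
  have fE j : pt (f j) = x j by rewrite /f; case: (xT' j).
  exists (fun i => \sum_(j | f j == i) t j); split.
  - by move=> i; apply: sumr_ge0.
  - by move=> i iT; rewrite big1// => j /eqP ji; rewrite -ji fT in iT.
  - by rewrite -t1 [RHS](partition_big f predT).
  - rewrite (partition_big f predT)//=; apply: eq_bigr => i _.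
    by rewrite scaler_suml; apply: eq_bigr => j /eqP <-; rewrite fE.
move=> [t [t0 tT t1 ->]].
have [i0 i0T] : exists i0, i0 \in T.
  apply: contrapT => /forallNP NT; have /eqP := t1.
  by rewrite big1 ?(eq_sym _ 1) ?oner_eq0// => i _; apply: tT; apply/negP/NT.
exists #|I|, (fun j => if enum_val j \in T then pt (enum_val j) else pt i0),
  (fun j => t (enum_val j)); split=> //.
- by move=> j; case: ifP => jT; [exists (enum_val j) | exists i0].
- by rewrite -(big_enum_val t) -[RHS]t1; apply: eq_bigl => i; rewrite inE.
- rewrite -[RHS](big_enum_val (fun i => t i *: (if i \in T then pt i else pt i0))).
  apply: eq_big => [i|i _]; first by rewrite inE.
  by case: ifP => // /negbT iT; rewrite tT// !scale0r.
Qed.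

Lemma affine_eval_hull_ge T w b y :
  (forall i, i \in T -> b <= affine_eval w (pt i)) -> hull T y -> b <= affine_eval w y.
Proof.
move=> wT [t [t0 tT t1 ->]]; rewrite affine_eval_conv// -[b]mul1r -t1 mulr_suml.
apply: ler_sum => i _; have [/wT bi|/tT ->] := boolP (i \in T); first by rewrite ler_wpM2l.
by rewrite !mul0r.
Qed.

Lemma affine_eval_hull_eq T w b y :
  (forall i, i \in T -> affine_eval w (pt i) = b) -> hull T y -> affine_eval w y = b.
Proof.
move=> wT [t [t0 tT t1 ->]]; rewrite affine_eval_conv// -[b]mul1r -t1 mulr_suml.
by apply: eq_bigr => i _; have [/wT ->|/tT ->] := boolP (i \in T); rewrite ?mul0r.
Qed.

End Hull.
End FiniteHulls.

Section RegularSubdivision.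
Local Open Scope classical_set_scope.
Variables (R : realType) (n : nat) (I : finType) (pt : I -> 'rV[R]_n).
Variables (D : {set I}) (h : I -> R).
Implicit Types (w : 'cV[R]_(n + 1)).

(** Lower faces described dually: an affine function below all heights supports the lifted points
    from below, and the points where it is [tight] span the corresponding cell. *)
Definition feasible w := forall i, i \in D -> affine_eval w (pt i) <= h i.

Definition tight w : {set I} := [set i in D | affine_eval w (pt i) == h i].

Lemma tightP w i : reflect (i \in D /\ affine_eval w (pt i) = h i) (i \in tight w).
Proof. by rewrite inE; apply: (iffP andP) => -[? /eqP]. Qed.

Lemma feasible_hull_le w w' x :
  feasible w' -> hull pt (tight w) x -> affine_eval w' x <= affine_eval w x.
Proof.
move=> w'f [t [t0 tT t1 ->]]; rewrite !affine_eval_conv//; apply: ler_sum => i _.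
have [/tightP[iD ->]|/tT ->] := boolP (i \in tight w); last by rewrite !mul0r.
by rewrite ler_wpM2l// w'f.
Qed.

Lemma tight_subset w w' : feasible w -> feasible w' ->
  hull pt (tight w) `<=` hull pt (tight w') -> tight w \subset tight w'.
Proof.
move=> wf w'f ww; apply/fintype.subsetP => i iw; have [iD wi] := tightP _ _ iw.
apply/tightP; split=> //; apply/eqP; rewrite eq_le w'f//= -wi.
by apply: feasible_hull_le => //; apply: ww; apply: hull_pt.
Qed.

Definition tight_max w := feasible w /\
  forall w', feasible w' -> tight w \subset tight w' -> tight w' = tight w.

Lemma tight_max_exists w : feasible w ->
  exists2 w', tight_max w' & tight w \subset tight w'.
Proof.
move=> wf; pose P k := `[< exists w', [/\ feasible w', tight w \subset tight w' & #|tight w'| = k] >].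
have exP : exists k, P k by exists #|tight w|; apply/asboolP; exists w.
have ubP k : P k -> (k <= #|I|)%N.
  by move=> /asboolP[w' [_ _ <-]]; apply: max_card.
case: (ex_maxnP exP ubP) => k /asboolP[w' [w'f ww' kE]] kmax.
exists w' => //; split=> // w'' w''f w'w''; apply/eqP; rewrite eq_sym eqEcard w'w''/= kE.
by apply: kmax; apply/asboolP; exists w''; split=> //; apply: fintype.subset_trans w'w''.
Qed.

Definition affinely_spanning (T : {set I}) :=
  forall v : 'cV[R]_(n + 1), (forall i, i \in T -> affine_eval v (pt i) = 0) -> v = 0.

(** If an affine [v] vanishes on the tight points and is positive at some point of [D], then [w] can
    be tilted in direction [v] until a further point becomes tight; the least [ratio] says how
    far. *)
Lemma tight_max_spanning w :
  affinely_spanning D -> tight_max w -> affinely_spanning (tight w).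
Proof.
move=> Dspan [wf wmax].
suff pos v : (forall i, i \in tight w -> affine_eval v (pt i) = 0) ->
    forall i, i \in D -> affine_eval v (pt i) <= 0.
  move=> v v0; apply: Dspan => i iD; apply/eqP; rewrite eq_le pos//=.
  rewrite -oppr_le0 -affine_evalN pos// => j jw.
  by rewrite affine_evalN v0// oppr0.
move=> v0 i0 i0D; rewrite leNgt; apply/negP => vi0.
pose ratio i := (h i - affine_eval w (pt i)) / affine_eval v (pt i).
pose Pv i := (i \in D) && (0 < affine_eval v (pt i)).
have Pi0 : Pv i0 by rewrite /Pv i0D.
pose i1 := [arg min_(i < i0 | Pv i) ratio i]%O.
have [/andP[i1D vi1] i1min] : Pv i1 /\ forall i, Pv i -> ratio i1 <= ratio i.
  by rewrite /i1; case: arg_minP.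
have r0 : 0 <= ratio i1 by rewrite divr_ge0 ?(ltW vi1)// subr_ge0 wf.
pose w' := w + ratio i1 *: v.
have w'E x : affine_eval w' x = affine_eval w x + ratio i1 * affine_eval v x.
  by rewrite affine_evalD affine_evalZ.
have w'f : feasible w'.
  move=> i iD; rewrite w'E -lerBrDl; have [vi|vi] := leP (affine_eval v (pt i)) 0.
    by apply: le_trans (_ : 0 <= _); rewrite ?mulr_ge0_le0// subr_ge0 wf.
  by rewrite -ler_pdivlMr// i1min// /Pv iD.
have ww' : tight w \subset tight w'.
  apply/fintype.subsetP => i iw; have [iD wi] := tightP _ _ iw.
  by apply/tightP; rewrite w'E v0// mulr0 addr0.
have : i1 \in tight w'.
  by apply/tightP; split=> //; rewrite w'E /ratio divfK ?gt_eqF// addrC subrK.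
by rewrite (wmax _ w'f ww') => /v0 v10; rewrite v10 ltxx in vi1.
Qed.

Lemma small_step (J : finType) (s v : J -> R) :
  (forall j, 0 < s j \/ 0 <= s j /\ 0 <= v j) ->
  exists2 e : R, 0 < e & forall j, 0 <= s j + e * v j.
Proof.
move=> sv.
have [e e0 eP] : exists2 e : R, 0 < e & forall j, j \in enum J -> 0 <= s j + e * v j; last first.
  by exists e => // j; apply: eP; rewrite mem_enum.
have step j (e : R) : 0 < e -> exists2 e', 0 < e' <= e & forall e'', 0 <= e'' <= e' -> 0 <= s j + e'' * v j.
  move=> e0; have [vj|vj] := leP 0 (v j).
    exists e => [|e'' /andP[? _]]; first by rewrite e0 lexx.
    by rewrite addr_ge0 ?mulr_ge0//; have [/ltW|[]] := sv j.
  have sj : 0 < s j by have [//|[_]] := sv j; rewrite leNgt vj.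
  exists (Num.min e (s j / - v j)).
    by rewrite lt_min e0 divr_gt0 ?oppr_gt0//= ge_min lexx.
  move=> e'' /andP[e''0]; rewrite le_min => /andP[_].
  rewrite ler_pdivlMr ?oppr_gt0// mulrN => h'; rewrite -lerBlDr sub0r.
  exact: h'.
have : exists2 e : R, 0 < e & forall e'', 0 <= e'' <= e -> forall j, j \in enum J -> 0 <= s j + e'' * v j.
  elim: (enum J) => [|j r [e e0 eP]]; first by exists 1.
  have [e' /andP[e'0 e'e] e'P] := step j e e0.
  exists e' => // e'' /andP[e''0 e''e'] l; rewrite inE => /orP[/eqP->|lr].
    by apply: e'P; rewrite e''0.
  by apply: eP lr; rewrite e''0 (le_trans e''e').
by move=> [e e0 eP]; exists e => //; apply: eP; rewrite lexx ltW.
Qed.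

Lemma hull_farkas (T : {set I}) y :
  hull pt T y \/ exists2 v : 'cV[R]_(n + 1), forall i, i \in T -> 0 <= affine_eval v (pt i) &
    affine_eval v y < 0.
Proof.
pose A i : 'rV[R]_(n + 1) := if i \in T then row_mx (pt i) 1%:M else 0.
have [[t t0 tE]|[v vA vy]] := farkas A (row_mx y 1%:M); [left | right].
  pose s i := if i \in T then t i else 0.
  have [|s1 yE] := @affine_eval_ext _ _ I s pt y.
    move=> w; rewrite /affine_eval tE mulmx_suml summxE; apply: eq_bigr => i _.
    rewrite -scalemxAl mxE /A /s; case: ifP => // _.
    by rewrite mul0mx mxE mulr0 mul0r.
  exists s; split=> // i; rewrite /s; [by case: ifP | by move=> /negPf ->].
by exists v => // i iT; have := vA i; rewrite /A iT.
Qed.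

(** Linear programming duality, by Farkas' lemma with one more coordinate for the heights. The last
    entry [b] of the separating functional is positive, and dividing by it gives the dual
    solution. *)
Lemma duality_gap_certificate (theta : R) y :
  (forall t : I -> R, (forall i, 0 <= t i) -> (forall i, i \notin D -> t i = 0) ->
     \sum_i t i = 1 -> y = \sum_i t i *: pt i -> theta <= \sum_i t i * h i) ->
  exists2 w, feasible w & theta <= affine_eval w y.
Proof.
move=> thetaP.
pose A (o : option I) : 'rV[R]_(n + 1 + 1) :=
  match o with
  | Some i => if i \in D then row_mx (- row_mx (pt i) 1%:M) (h i)%:M else 0
  | None => row_mx (row_mx y 1%:M) (- theta)%:M
  end.
have evS i w (b : R) : (row_mx (- row_mx (pt i) 1%:M) (h i)%:M *m col_mx w b%:M) 0 0 =
    h i * b - affine_eval w (pt i).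
  by rewrite mul_row_col mulNmx -scalar_mxM [LHS]mxE [X in X + _]mxE [X in _ + X]mxE eqxx mulr1n addrC.
have evN w (b : R) : (row_mx (row_mx y 1%:M) (- theta)%:M *m col_mx w b%:M) 0 0 =
    affine_eval w y - theta * b.
  by rewrite mul_row_col -scalar_mxM [LHS]mxE [X in _ + X]mxE eqxx mulr1n mulNr.
have [[t t0 tE]|[W WA Wb]] := farkas A (row_mx 0 (-1)%:M).
  exfalso.
  pose s i := if i \in D then t (Some i) else 0.
  have s0 i : 0 <= s i by rewrite /s; case: ifP.
  have sE w b : - b = t None * (affine_eval w y - theta * b) +
      \sum_i s i * (h i * b - affine_eval w (pt i)).
    have := congr1 (fun M => (M *m col_mx w b%:M) 0 0) tE.
    rewrite mul_row_col mul0mx add0r -scalar_mxM mxE eqxx mulr1n mulN1r => ->.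
    rewrite mulmx_suml summxE sum_option/= -scalemxAl mxE evN; congr (_ + _).
    apply: eq_bigr => i _; rewrite -scalemxAl mxE /s; case: ifP => _; first by rewrite evS.
    by rewrite mul0mx mxE mulr0 mul0r.
  have sh : -1 = - (t None * theta) + \sum_i s i * h i.
    have := sE 0 1; rewrite /affine_eval mulmx0 mxE sub0r mulr1 mulrN => ->.
    by congr (_ + _); apply: eq_bigr => i _; rewrite mulmx0 mxE subr0 mulr1.
  have sw w : t None * affine_eval w y = \sum_i s i * affine_eval w (pt i).
    have := sE w 0; rewrite oppr0 mulr0 subr0 => /esym/eqP.
    under eq_bigr do rewrite mulr0 sub0r mulrN.
    by rewrite sumrN subr_eq0 => /eqP.
  have tS : t None = \sum_i s i.
    have := sw (col_mx 0 1%:M); rewrite affine_eval_const mulr1 => ->.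
    by apply: eq_bigr => i _; rewrite affine_eval_const mulr1.
  have [tN|tN] := eqVneq (t None) 0.
    move/eqP: sh; rewrite tN mul0r oppr0 add0r big1; first by rewrite oppr_eq0 oner_eq0.
    move=> i _; have /eqP : \sum_i s i = 0 by rewrite -tS.
    by rewrite psumr_eq0// => /allP/(_ i); rewrite mem_index_enum => /(_ isT)/eqP ->; rewrite mul0r.
  have tN0 : 0 < t None by rewrite lt_def tN t0.
  have [|r1 yE] := @affine_eval_ext _ _ I (fun i => s i / t None) pt y.
    move=> w; apply: (mulfI tN); rewrite sw mulr_sumr; apply: eq_bigr => i _.
    by rewrite mulrA; congr (_ * _); rewrite mulrC divfK.
  have := thetaP (fun i => s i / t None); rewrite r1 => /(_ _ _ erefl yE).
  have -> : \sum_i s i / t None * h i = theta - (t None)^-1.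
    apply: (mulfI tN); rewrite mulrBr divff// mulr_sumr.
    have -> : t None * theta - 1 = \sum_i s i * h i.
      by move: sh; lra.
    by apply: eq_bigr => i _; rewrite mulrA; congr (_ * _); rewrite mulrC divfK.
  rewrite lerBrDl gerDr invr_le0 leNgt tN0 => /(_ _ _)/negP[]// i.
    by rewrite divr_ge0 // ltW.
  by rewrite /s => /negPf ->; rewrite mul0r.
pose w := usubmx W; pose b := W (rshift (n + 1) 0) 0.
have WE : W = col_mx w b%:M.
  rewrite -[LHS]vsubmxK; congr col_mx; apply/matrixP => i j.
  by rewrite !ord1 !mxE eqxx mulr1n.
have b0 : 0 < b.
  move: Wb; rewrite WE mul_row_col mul0mx add0r -scalar_mxM mxE eqxx mulr1n mulN1r.
  by rewrite oppr_lt0.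
exists (b^-1 *: w).
  move=> i iD; have := WA (Some i); rewrite /A iD WE evS subr_ge0 affine_evalZ.
  by rewrite [b^-1 * _]mulrC ler_pdivrMr.
have := WA None; rewrite /A WE evN subr_ge0 affine_evalZ.
by rewrite [b^-1 * _]mulrC ler_pdivlMr.
Qed.

Lemma feasible_exists : exists w, feasible w.
Proof.
exists (col_mx 0 (- \sum_i `|h i|)%:M) => i _.
rewrite affine_eval_const (bigD1 i)//= opprD.
rewrite -[X in _ <= X]addr0 lerD//; first by rewrite lerNl -normrN ler_norm.
by rewrite oppr_le0 sumr_ge0.
Qed.

(** Take [w] whose value at [y] is the infimum of the heights of all representations of [y]. If [y]
    were outside the hull of its tight points, a separating [v] would give a feasible [w - e *: v]
    with a larger value at [y]. *)
Lemma tight_max_cover y : hull pt D y ->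
  exists2 w, tight_max w & hull pt (tight w) y.
Proof.
move=> yD.
pose G : set R := [set g | exists t : I -> R, [/\ forall i, 0 <= t i,
  forall i, i \notin D -> t i = 0, \sum_i t i = 1, y = \sum_i t i *: pt i
  & g = \sum_i t i * h i]].
have Gweak w g : feasible w -> G g -> affine_eval w y <= g.
  move=> wf [t [t0 tD t1 -> ->]]; rewrite affine_eval_conv//; apply: ler_sum => i _.
  by have [iD|/tD ->] := boolP (i \in D); rewrite ?mul0r// ler_wpM2l// wf.
have [w0 w0f] := feasible_exists.
have Ginf : has_inf G.
  split; last by exists (affine_eval w0 y) => g; apply: Gweak.
  by have [t [t0 tD t1 yE]] := yD; exists (\sum_i t i * h i); exists t.
have [w wf wy] : exists2 w, feasible w & inf G <= affine_eval w y.
  apply: duality_gap_certificate => t t0 tD t1 yE.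
  by apply: ge_inf; [have [] := Ginf | exists t].
have [w' w'max ww'] := tight_max_exists wf.
exists w' => //; apply: (hullS ww').
have [//|[v vT vy]] := hull_farkas (tight w) y; exfalso.
have [|e e0 eP] := @small_step I (fun i => if i \in D then h i - affine_eval w (pt i) else 0)
    (fun i => if i \in D then affine_eval v (pt i) else 0).
  move=> i; case: ifP => iD; last by right.
  have [iw|iw] := boolP (i \in tight w); [right | left].
    by rewrite subr_ge0 wf// vT.
  by rewrite subr_gt0 lt_neqAle wf// andbT; apply: contraNneq iw => iw; apply/tightP.
have w2f : feasible (w - e *: v).
  move=> i iD; have := eP i; rewrite iD affine_evalD affine_evalN affine_evalZ.
  by rewrite addrAC subr_ge0 lerBlDr addrC.
have : affine_eval (w - e *: v) y <= inf G.
  by apply: lb_le_inf; [have [] := Ginf | move=> g; apply: Gweak].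
rewrite affine_evalD affine_evalN affine_evalZ => /le_trans/(_ wy).
by rewrite gerDl oppr_le0 pmulr_rge0// leNgt vy.
Qed.

End RegularSubdivision.

Section CellsOfSubdivision.
Local Open Scope classical_set_scope.
Variables (R : realType) (c : quartic_monomial -> \bar R).
Local Notation pt := (@lpoint R).

Definition support_set : {set quartic_monomial} := [set m | c m \is a fin_num].
Local Notation D := support_set.
Local Notation h := (fun m => fine (c m)).

Lemma support_setE :
  [set m | c m \is a fin_num] = [set` support_set] :> set quartic_monomial.
Proof. by apply/seteqP; split=> m /=; rewrite inE. Qed.

Lemma trop_newton_hull : trop_newton c = hull pt D.
Proof. by rewrite /trop_newton support_setE conv_hull_finite. Qed.

Definition lifted_pt (m : quartic_monomial) : 'rV[R]_(3 + 1) :=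
  row_mx (pt m) (h m)%:M.

Lemma lifted_hullE : lifted_hull c = hull lifted_pt D.
Proof. by rewrite /lifted_hull support_setE conv_hull_finite. Qed.

Lemma dotE n (a x : 'rV[R]_n) : dot a x = (x *m a^T) 0 0.
Proof. by rewrite /dot mxE; apply: eq_bigr => j _; rewrite mxE mulrC. Qed.

Lemma dot_row_mx (a : 'rV[R]_(3 + 1)) (x : 'rV[R]_3) (s : R) :
  dot a (row_mx x s%:M) = dot (lsubmx a) x + a 0 ord_max * s.
Proof.
rewrite /dot big_split_ord/=; congr (_ + _).
  by apply: eq_bigr => j _; rewrite row_mxEl mxE.
rewrite big_ord1 row_mxEr mxE eqxx mulr1n; congr (a 0 _ * _).
by apply/val_inj.
Qed.

Lemma lifted_face_hull (a : 'rV[R]_(3 + 1)) (b : R) F :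
  supported_face (lifted_hull c) a b F ->
  F = hull lifted_pt [set m in D | dot a (lifted_pt m) == b].
Proof.
rewrite lifted_hullE => -[ab ->]; apply/seteqP; split=> y.
  move=> [[t [t0 tD t1 yE]] /= ay]; exists t; split=> // m; rewrite inE negb_and => /orP[/tD//|am].
  have [mD|/tD//] := boolP (m \in D).
  have terms : \sum_m t m * (dot a (lifted_pt m) - b) = 0.
    under eq_bigr do rewrite mulrBr.
    rewrite sumrB -mulr_suml t1 mul1r -ay yE dotE mulmx_suml summxE; apply/eqP.
    rewrite subr_eq0; apply/eqP; apply: eq_bigr => i _.
    by rewrite -scalemxAl mxE -dotE.
  move/eqP: terms; rewrite psumr_eq0 => [/allP/(_ m)|i _].
    rewrite mem_index_enum => /(_ isT); rewrite mulf_eq0 subr_eq0 (negPf am) orbF.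
    by move/eqP.
  have [iD|/tD ->] := boolP (i \in D); last by rewrite mul0r.
  by rewrite mulr_ge0// subr_ge0 ab//; apply: hull_pt.
move=> yT; split; first by apply: hullS yT; apply/fintype.subsetP => m; rewrite inE => /andP[].
move: yT => [t [t0 tT t1 ->]] /=; rewrite dotE mulmx_suml summxE -[RHS]mul1r -t1 mulr_suml.
apply: eq_bigr => m _; rewrite -scalemxAl mxE -dotE.
have [|/tT ->] := boolP (m \in [set m in D | dot a (lifted_pt m) == b]).
  by rewrite inE => /andP[_ /eqP ->].
by rewrite !mul0r.
Qed.

Lemma lsubmx_hull (T : {set quartic_monomial}) : lsubmx @` hull lifted_pt T = hull pt T.
Proof.
have E (t : quartic_monomial -> R) :
    lsubmx (\sum_i t i *: lifted_pt i : 'rV[R]_(3 + 1)) = \sum_i t i *: pt i.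
  by rewrite linear_sum; apply: eq_bigr => i _; rewrite linearZ/= row_mxKl.
apply/seteqP; split=> y.
  by move=> [_ [t [t0 tT t1 ->]] <-]; exists t; split.
move=> [t [t0 tT t1 ->]]; exists (\sum_i t i *: lifted_pt i) => //.
by exists t; split.
Qed.

(** A functional with positive last coefficient [l] is, after division by [l], the height minus an
    affine function of the point. *)
Lemma subdivision_cellP S : subdivision_cell c S <->
  exists2 w, feasible pt D h w & S = hull pt (tight pt D h w).
Proof.
split=> [[a [b [F [a0 /[dup] [[ab _]] /lifted_face_hull -> ->]]]]|[w wf ->]].
  pose l := a 0 ord_max.
  pose w : 'cV[R]_(3 + 1) := l^-1 *: col_mx (- (lsubmx a)^T) b%:M.
  have wE m : affine_eval w (pt m) = (b - dot (lsubmx a) (pt m)) / l.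
    rewrite /w affine_evalZ affine_eval_col mulmxN mxE -dotE mxE eqxx mulr1n.
    by rewrite mulrC addrC.
  exists w.
    move=> m mD; rewrite wE ler_pdivrMr// lerBlDl mulrC -dot_row_mx.
    by apply: ab; rewrite lifted_hullE; apply: hull_pt.
  rewrite lsubmx_hull; congr hull; apply/finset.setP => m; rewrite !inE; congr (_ && _).
  rewrite wE /lifted_pt dot_row_mx -/l; apply/eqP/eqP => [<-|].
    by rewrite addrC addKr mulrC mulKf// gt_eqF.
  move=> /(congr1 ( *%R^~ l)); rewrite divfK ?gt_eqF// => E.
  by rewrite mulrC -E addrC subrK.
pose a : 'rV[R]_(3 + 1) := row_mx (- (usubmx w)^T) 1%:M.
pose b := w (rshift 3 0) 0.
have a1 : a 0 ord_max = 1.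
  rewrite /a (_ : ord_max = rshift 3 0); last exact/val_inj.
  by rewrite row_mxEr mxE eqxx.
have aE m : dot a (lifted_pt m) = fine (c m) - affine_eval w (pt m) + b.
  rewrite dot_row_mx a1 mul1r row_mxKl dotE affine_evalE linearN/= trmxK mulmxN mxE.
  by rewrite opprD addrA subrK addrC.
have supp : supported_face (lifted_hull c) a b
    (lifted_hull c `&` [set x | dot a x = b]).
  split=> // x; rewrite lifted_hullE => -[t [t0 tD t1 ->]].
  rewrite dotE mulmx_suml summxE -[b]mul1r -t1 mulr_suml; apply: ler_sum => m _.
  rewrite -scalemxAl mxE -dotE aE; have [mD|/tD ->] := boolP (m \in D); last by rewrite !mul0r.
  by rewrite ler_wpM2l// lerDr subr_ge0 wf.
exists a, b, (lifted_hull c `&` [set x | dot a x = b]); split=> //.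
  by rewrite a1.
rewrite (lifted_face_hull supp) lsubmx_hull; congr hull; apply/finset.setP => m.
rewrite !inE aE; congr (_ && _).
by rewrite -[X in _ = (_ == X)]add0r (inj_eq (addIr b)) subr_eq0 eq_sym.
Qed.

Lemma maximal_cellP S : maximal_cell c S <->
  exists2 w, tight_max pt D h w & S = hull pt (tight pt D h w).
Proof.
split=> [[/subdivision_cellP[w wf ->] Smax]|[w [wf wmax] ->]].
  have [w' w'max ww'] := tight_max_exists wf; exists w' => //.
  apply/esym/Smax; last exact: hullS.
  by apply/subdivision_cellP; exists w' => //; case: w'max.
split; first by apply/subdivision_cellP; exists w.
move=> S' /subdivision_cellP[w' w'f ->] ww'.
by rewrite (wmax w')//; apply: tight_subset.
Qed.

End CellsOfSubdivision.

(** * Lattice points and the interior of a polytope *)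

Section DotProduct.
Variables (R : realType) (n : nat).
Implicit Types (a x y : 'rV[R]_n).

Lemma dotDr a x y : dot a (x + y) = dot a x + dot a y.
Proof. by rewrite -big_split/=; apply: eq_bigr => j _; rewrite mxE mulrDr. Qed.

Lemma dotZr a s x : dot a (s *: x) = s * dot a x.
Proof. by rewrite mulr_sumr; apply: eq_bigr => j _; rewrite mxE mulrCA. Qed.

Lemma dotNr a x : dot a (- x) = - dot a x.
Proof. by rewrite -scaleN1r dotZr mulN1r. Qed.

Lemma dotBr a x y : dot a (x - y) = dot a x - dot a y.
Proof. by rewrite dotDr dotNr. Qed.

Lemma dotC a x : dot a x = dot x a.
Proof. by apply: eq_bigr => j _; rewrite mulrC. Qed.

Lemma dot_sumr (I : finType) (t : I -> R) (u : I -> 'rV[R]_n) a :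
  dot a (\sum_i t i *: u i) = \sum_i t i * dot a (u i).
Proof.
rewrite /dot; under eq_bigr do rewrite summxE mulr_sumr.
rewrite exchange_big/=; apply: eq_bigr => i _; rewrite mulr_sumr.
by apply: eq_bigr => j _; rewrite mxE mulrCA.
Qed.

Lemma dotBl a b x : dot (a - b) x = dot a x - dot b x.
Proof. by rewrite !(dotC _ x) dotBr. Qed.

Lemma dotZl s a x : dot (s *: a) x = s * dot a x.
Proof. by rewrite !(dotC _ x) dotZr. Qed.

Lemma dot0l x : dot 0 x = 0.
Proof. by rewrite /dot big1// => j _; rewrite mxE mul0r. Qed.

Lemma dot_mulmx k a (u : 'rV[R]_k) (M : 'M[R]_(k, n)) :
  dot a (u *m M) = \sum_j u 0 j * dot a (row j M).
Proof. by rewrite mulmx_sum_row dot_sumr. Qed.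

Lemma dot_ge0 a : 0 <= dot a a.
Proof. by apply: sumr_ge0 => j _; rewrite -expr2 sqr_ge0. Qed.

Lemma dot_eq0 a : dot a a = 0 -> a = 0.
Proof.
move=> /eqP; rewrite psumr_eq0 => [/allP a0|j _]; last by rewrite -expr2 sqr_ge0.
apply/rowP => j; rewrite mxE; have := a0 j; rewrite mem_index_enum => /(_ isT).
by rewrite mulf_eq0 orbb => /eqP.
Qed.

Lemma dot_delta a j : dot a (delta_mx 0 j) = a 0 j.
Proof.
by rewrite /dot (bigD1 j)//= mxE !eqxx mulr1 big1 ?addr0// => l lj; rewrite mxE (negPf lj) andbF mulr0.
Qed.

Lemma affine_eval_dot a (b : R) x : affine_eval (col_mx a^T b%:M) x = dot a x + b.
Proof. by rewrite affine_eval_col -dotE mxE eqxx mulr1n. Qed.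

Lemma affine_eval_dotE (w : 'cV[R]_(n + 1)) x :
  affine_eval w x = dot (usubmx w)^T x + w (rshift n 0) 0.
Proof. by rewrite affine_evalE dotE trmxK. Qed.

End DotProduct.

Lemma hull_sub_hull (R : realType) n (I : finType) (pt : I -> 'rV[R]_n) (T T' : {set I}) :
  (forall i, i \in T -> hull pt T' (pt i)) -> (hull pt T `<=` hull pt T')%classic.
Proof.
move=> TT' y yT; have [//|[v vT' vy]] := hull_farkas pt T' y.
have := affine_eval_hull_ge (w := v) (b := 0) _ yT; rewrite leNgt vy => /(_ _)/negP[]// i iT.
by apply: affine_eval_hull_ge (TT' i iT).
Qed.

Section AlgebraicInterior.
Local Open Scope classical_set_scope.
Variables (R : realType) (n : nat).

(** Interior tested along single directions, the form in which it combines with supporting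
    half-spaces; for hulls of finitely many points it implies topological interior. *)
Definition alg_interior (P : set 'rV[R]_n) x :=
  forall d, exists2 e : R, 0 < e & P (x + e *: d).

Lemma alg_interior_mem P x : alg_interior P x -> P x.
Proof. by move=> /(_ 0)[e _]; rewrite scaler0 addr0. Qed.

Lemma interior_alg_interior (P : set 'rV[R]_n) x : interior P x -> alg_interior P x.
Proof.
move=> /nbhs_ballP[r /= r0 rP] d.
have d0 : 0 < 1 + \sum_j `|d 0 j| by rewrite ltr_wpDr// sumr_ge0.
exists (r / (1 + \sum_j `|d 0 j|)); first by rewrite divr_gt0.
apply: rP; split=> // i j; rewrite ord1 -ball_normE /= !mxE opprD addNKr normrN normrM.
rewrite gtr0_norm ?divr_gt0// mulrAC ltr_pdivrMr// ltr_pM2l//.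
by rewrite (bigD1 j)//= addrCA ltrDl ltr_wpDr// sumr_ge0.
Qed.

(** The hull contains a point [x + e s *: d s] for each of the finitely many sign vectors. A
    functional separating some [y] near [x] would already be too small on the sign vector opposite
    to its own signs. *)
Lemma alg_interior_hull_interior (I : finType) (pt : I -> 'rV[R]_n) (T : {set I}) x :
  alg_interior (hull pt T) x -> interior (hull pt T) x.
Proof.
move=> xT.
pose d (s : {ffun 'I_n -> bool}) : 'rV[R]_n := \row_j (-1) ^+ s j.
have [e eP] : {e : {ffun 'I_n -> bool} -> R | forall s, 0 < e s /\ hull pt T (x + e s *: d s)}.
  have E s : {e | 0 < e /\ hull pt T (x + e *: d s)}.
    by apply: cid; have [e] := xT (d s); exists e.
  by exists (fun s => sval (E s)) => s; exact: svalP (E s).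
pose r := \big[Num.min/1]_s e s.
have r0 : 0 < r by apply: lt_bigmin => // s _; have [] := eP s.
apply/nbhs_ballP; exists r => //= y [_ xy].
have [//|[v vT vy]] := hull_farkas pt T y; exfalso.
pose u := (usubmx v)^T; pose s := [ffun j => 0 < u 0 j].
have ud : dot u (d s) = - \sum_j `|u 0 j|.
  rewrite -sumrN; apply: eq_bigr => j _; rewrite [d s 0 j]mxE [s j]ffunE.
  have [u0|u0] := ltP 0 (u 0 j); first by rewrite expr1 mulrN1 gtr0_norm.
  by rewrite expr0 mulr1 ler0_norm// opprK.
have uy : - (r * \sum_j `|u 0 j|) <= dot u (y - x).
  rewrite mulr_sumr -sumrN; apply: ler_sum => j _; rewrite lerNl -mulrN.
  apply: le_trans (ler_norm _) _; rewrite normrM mulrC ler_wpM2r// normrN !mxE distrC.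
  by have := xy 0 j; rewrite -ball_normE => /ltW.
have := affine_eval_hull_ge vT (proj2 (eP s)); rewrite leNgt => /negP; apply.
apply: le_lt_trans vy; rewrite !affine_eval_dotE -/u lerD2r dotDr dotZr ud mulrN.
rewrite -[y](subrK x) [dot _ (y - x + x)]dotDr addrC lerD2r; apply: le_trans uy.
by rewrite lerN2 ler_wpM2r ?sumr_ge0//; apply: bigmin_le.
Qed.

Lemma alg_interior_half_space (P : set 'rV[R]_n) x a :
  alg_interior P x -> (forall y, P y -> dot a x <= dot a y) -> a = 0.
Proof.
move=> Px aP; have [e e0 /aP] := Px (- a).
rewrite dotDr dotZr dotNr lerDl mulrN oppr_ge0 pmulr_rle0// => aa.
by apply: dot_eq0; apply/eqP; rewrite eq_le aa dot_ge0.
Qed.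

Lemma alg_interior_spanning (I : finType) (pt : I -> 'rV[R]_n) (T : {set I}) x :
  alg_interior (hull pt T) x -> affinely_spanning pt T.
Proof.
move=> xT v v0.
have vE y : hull pt T y -> affine_eval v y = 0 by apply: affine_eval_hull_eq.
have vx := vE _ (alg_interior_mem xT).
have u0 : (usubmx v)^T = 0.
  apply: (alg_interior_half_space xT) => y /vE; rewrite -vx !affine_eval_dotE.
  by move=> /addIr ->.
move: vx; rewrite affine_eval_dotE u0 dotC /dot big1 ?add0r => [vx|j _]; last by rewrite mxE mulr0.
rewrite -[v]vsubmxK -[usubmx v]trmxK u0 trmx0.
by apply/colP => i; rewrite !mxE; case: splitP => k _; rewrite mxE// ord1 vx.
Qed.

End AlgebraicInterior.

Section LatticePoints.
Local Open Scope classical_set_scope.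
Variable R : realType.
Local Notation pt := (@lpoint R).

Lemma quartic_monomial_exists (k : nat -> nat) : (\sum_(j < 3) k j <= 4)%N ->
  exists m : quartic_monomial, forall j : 'I_3, val m (widen_ord (leqnSn 3) j) = k j.
Proof.
move=> k4.
pose m : 'X_{1..4} := [multinom if (i < 3)%N then k i else 4 - \sum_(j < 3) k j | i < 4]%N.
have m4 : mdeg m = 4%N.
  rewrite mdegE big_ord_recr/= mnmE/= -[RHS](subnKC k4); congr (_ + _)%N.
  by apply: eq_bigr => j _; rewrite mnmE/= ltn_ord.
have m5 : (mdeg m < 5)%N by rewrite m4.
have m4' : mdeg (BMultinom m5 : 'X_{1..4}) == 4%N by rewrite /= m4.
by exists (exist (fun m : 'X_{1..4 < 5} => mdeg m == 4%N) (BMultinom m5) m4') => j; rewrite /= mnmE/= ltn_ord.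
Qed.

Lemma simplex4_bounds x : @simplex4 R x -> (forall j, 0 <= x 0 j) /\ \sum_j x 0 j <= 4.
Proof.
move=> [k [y [t [yV t0 t1 ->]]]].
have yP i : (forall j, 0 <= y i 0 j) /\ \sum_j y i 0 j <= 4.
  have [->|[j _ <-]] := yV i.
    by split=> [j|]; [rewrite mxE | rewrite big1// => j _; rewrite mxE].
  split=> [l|]; first by rewrite !mxE eqxx mulr_ge0.
  rewrite (bigD1 j)//= !mxE !eqxx mulr1 big1 ?addr0// => l lj.
  by rewrite !mxE eqxx (negPf lj) mulr0.
split=> [j|].
  by rewrite summxE sumr_ge0// => i _; rewrite mxE mulr_ge0//; have [] := yP i.
under eq_bigr do rewrite summxE.
rewrite exchange_big/=.
have -> : 4 = \sum_i t i * 4 :> R by rewrite -mulr_suml t1 mul1r.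
apply: ler_sum => i _; under eq_bigr do rewrite mxE.
by rewrite -mulr_sumr; apply: ler_wpM2l => //; have [] := yP i.
Qed.

Lemma simplex4_lattice_point q : @simplex4 R (int_pt R q) -> exists m, pt m = int_pt R q.
Proof.
move=> /simplex4_bounds[q0 q4].
have qE j : q 0 j = (absz (q 0 j))%:Z.
  by rewrite gez0_abs//; have := q0 j; rewrite mxE ler0z.
have [|m mE] := @quartic_monomial_exists (fun j => absz (q 0 (inord j))).
  rewrite -(ler_nat R) natr_sum; apply: le_trans q4; apply: ler_sum => j _.
  by rewrite inord_val mxE [in leRHS]qE.
by exists m; apply/rowP => j; rewrite !mxE mE inord_val [in RHS]qE.
Qed.

Lemma lpointE m : pt m = int_pt R (\row_j (val m (widen_ord (leqnSn 3) j))%:Z).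
Proof. by apply/rowP => j; rewrite !mxE. Qed.

(** An interior lattice point of the simplex has coordinates at least 1 and coordinate sum at most
    3. *)
Lemma center_of_alg_interior (P : set 'rV[R]_3) q : P `<=` @simplex4 R ->
  alg_interior P (int_pt R q) -> q = const_mx 1.
Proof.
move=> Psub Pq.
have q1 j : 1 <= q 0 j.
  have [e e0 /Psub/simplex4_bounds[/(_ j)]] := Pq (- delta_mx 0 j).
  rewrite !mxE !eqxx/= mulrN1 subr_ge0 => /(lt_le_trans e0); rewrite ltr0z.
  by lia.
have [e e0 /Psub/simplex4_bounds[_]] := Pq (const_mx 1).
under eq_bigr do rewrite !mxE mulr1.
rewrite big_split/= sumr_const card_ord => q4.
have {}q4 : (\sum_j q 0 j)%:~R < 4%:~R :> R.
  by rewrite rmorph_sum/=; apply: lt_le_trans q4; rewrite ltrDl mulrn_wgt0.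
move: q4; rewrite ltr_int !big_ord_recl big_ord0 => q4.
have q1' := (q1 ord0, q1 (lift ord0 ord0), q1 (lift ord0 (lift ord0 ord0))).
have q3 : q 0 ord0 = 1 /\ q 0 (lift ord0 ord0) = 1 /\ q 0 (lift ord0 (lift ord0 ord0)) = 1.
  by move: q1' q4 => [[]]; lia.
apply/rowP => j; rewrite mxE; have [q30 [q31 q32]] := q3.
by case: j => [[|[|[|]]]]// jlt; [rewrite -q30 | rewrite -q31 | rewrite -q32]; congr (q 0 _); apply/val_inj.
Qed.

Lemma int_pt_center : int_pt R (const_mx 1) = const_mx 1.
Proof. by apply/rowP => j; rewrite !mxE. Qed.

Lemma lpoint_inj : injective pt.
Proof.
move=> m1 m2 /rowP mE; apply/val_inj/val_inj/mnmP => i.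
have E (j : 'I_3) : val m1 (widen_ord (leqnSn 3) j) = val m2 (widen_ord (leqnSn 3) j).
  by have /eqP := mE j; rewrite !mxE eqr_nat => /eqP.
have : mdeg (val (val m1)) = mdeg (val (val m2)).
  by rewrite (eqP (valP m1)) (eqP (valP m2)).
rewrite !mdegE !(big_ord_recr 3)/= (eq_bigr _ (fun j _ => E j)) => /addnI E3.
have [i3|i3] := ltnP i 3; first by have := E (Ordinal i3); congr (_ = _); congr (_ _); apply/val_inj.
by have -> : i = ord_max by apply/val_inj => /=; move: (ltn_ord i); lia.
Qed.

Lemma lattice_polytope_hull (P : set 'rV[R]_3) :
  lattice_polytope P -> P `<=` @simplex4 R ->
  P = hull pt [set m | `[< P (pt m) >]].
Proof.
move=> [s PE] Psub; pose S : {set quartic_monomial} :=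
  [set m | `[< exists2 v, v \in s & pt m = int_pt R v >]]%SET.
have PS : P = hull pt S.
  rewrite -conv_hull_finite PE; congr conv_hull; apply/seteqP; split=> x.
    move=> [v vs <-]; have Pv : P (int_pt R v).
      rewrite PE; exists 1%N, (fun=> int_pt R v), (fun=> 1); split=> //.
      - by move=> _; exists v.
      - by rewrite big_ord1.
      - by rewrite big_ord1 scale1r.
    have [m mE] := simplex4_lattice_point (Psub _ Pv); exists m => //=.
    by rewrite inE; apply/asboolP; exists v.
  by move=> [m /=]; rewrite inE => /asboolP[v vs ->] <-; exists v.
apply/seteqP; split; last first.
  rewrite {2}PS; apply: hull_sub_hull => m.
  by rewrite inE => /asboolP; rewrite {1}PS.
rewrite {1}PS; apply: hullS; apply/fintype.subsetP => m mS.
by rewrite inE; apply/asboolP; rewrite PS; apply: hull_pt.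
Qed.

(** On exponents of degree 4 the weight [a] is, up to a constant, the linear functional [b] in the
    first three coordinates. The hypothesis makes [b] minimal on [P] at the interior point
    [(1,1,1)], so [b = 0] and all weights equal the last one. *)
Lemma alg_interior_weights (P : set 'rV[R]_3) (a : 'I_4 -> nat) :
  lattice_polytope P -> P `<=` @simplex4 R -> alg_interior P (const_mx 1) ->
  (forall m, P (pt m) -> (\sum_j a j <= \sum_j a j * val m j)%N) ->
  exists c, forall j, a j = c.
Proof.
move=> Plat Psub Pint aP; exists (a ord_max).
pose b : 'rV[R]_3 := \row_j ((a (widen_ord (leqnSn 3) j))%:R - (a ord_max)%:R).
have bE m : dot b (pt m) = (\sum_j a j * val m j)%:R - (a ord_max * 4)%:R.
  have m4 : mdeg (val (val m)) = 4%N by apply/eqP/(valP m).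
  rewrite -[in X in (_ * X)%N]m4 mdegE /dot !(big_ord_recr 3)/= mulnDr !natrD opprD addrACA.
  rewrite subrr addr0 natrM !natr_sum mulr_sumr -sumrB.
  by apply: eq_bigr => j _; rewrite !mxE mulrBl natrM.
have b0 : b = 0.
  apply: (alg_interior_half_space Pint) => y.
  rewrite (lattice_polytope_hull Plat Psub) => -[t [t0 tT t1 ->]].
  rewrite dot_sumr -[leLHS]mul1r -[X in X * _]t1 mulr_suml; apply: ler_sum => m _.
  have [|/tT ->] := boolP (m \in [set m | `[< P (pt m) >]]%SET); last by rewrite !mul0r.
  rewrite inE => /asboolP/aP am; rewrite ler_wpM2l// bE.
  have -> : dot b (const_mx 1) = (\sum_j a j)%:R - (a ord_max * 4)%:R.
    rewrite /dot (big_ord_recr 3)/= natrD natr_sum natrM.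
    under eq_bigr => j _ do rewrite !mxE mulr1.
    by rewrite sumrB sumr_const card_ord -mulr_natr; ring.
  by rewrite lerD2r ler_nat.
move=> j; have [j3|j3] := ltnP j 3.
  have /eqP := congr1 (fun M : 'rV_3 => M 0 (Ordinal j3)) b0.
  rewrite !mxE subr_eq0 eqr_nat => /eqP <-; congr (a _); exact/val_inj.
by congr (a _); apply/val_inj => /=; move: (ltn_ord j); lia.
Qed.

End LatticePoints.

(** * Bounded regions and interior lattice points *)

Section BoundedRegion.
Local Open Scope classical_set_scope.
Variables (R : realType) (c : quartic_monomial -> \bar R).
Local Notation pt := (@lpoint R).
Hypothesis c_Noo : forall m, c m != -oo%E.

Definition strict_min x m0 := forall m, m != m0 -> (trop_term c x m0 < trop_term c x m)%E.

Lemma strict_min_not_surface x m0 : strict_min x m0 -> ~ trop_surface c x.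
Proof.
move=> x0 [m1 [m2 [m12 m1min m2min]]].
have [m1E|/x0] := eqVneq m1 m0; last by rewrite ltNge m1min.
by have := x0 m2; rewrite -m1E eq_sym => /(_ m12); rewrite ltNge m2min.
Qed.

Lemma cPoo m : m \notin support_set c -> c m = +oo%E.
Proof. by rewrite inE; move: (c_Noo m); case: (c m). Qed.

Lemma trop_termE x m : m \in support_set c ->
  trop_term c x m = (fine (c m) + dot (pt m) x)%:E.
Proof. by rewrite inE /trop_term EFinD => /fineK ->. Qed.

Lemma not_surface_strict_min x : ~ trop_surface c x ->
  exists2 m0, m0 \in support_set c & strict_min x m0.
Proof.
move=> xN.
(* Two distinct monomials exist, so a strict minimum cannot have the value infinity. *)
have [ma maE] := @quartic_monomial_exists (fun=> 0%N) ltac:(by rewrite sum_nat_const card_ord).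
have [mb mbE] := @quartic_monomial_exists (fun=> 1%N) ltac:(by rewrite sum_nat_const card_ord).
have mab : ma != mb.
  by apply/eqP => E; have := maE ord0; rewrite E mbE.
have [m0 m0min] : exists m0, forall m, (trop_term c x m0 <= trop_term c x m)%E.
  by case: (arg_minP (fun m => trop_term c x m) (erefl true : predT ma)) => m0 _ m0P; exists m0 => m; apply: m0P.
have m0x : strict_min x m0.
  move=> m mm0; rewrite ltNge; apply/negP => mm; apply: xN; exists m, m0; split=> // m'.
  exact: le_trans mm _.
exists m0 => //; apply/negPn/negP => /cPoo cm0.
have oo m : m != m0 -> False by move=> /m0x; rewrite /trop_term cm0 ltNge leey.
by have [E|/oo//] := eqVneq ma m0; apply: (oo mb); rewrite -E eq_sym.
Qed.

Lemma strict_min_ray x m0 a s : m0 \in support_set c -> strict_min x m0 ->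
  (forall m, m \in support_set c -> 0 <= dot a (pt m - pt m0)) -> 0 <= s ->
  strict_min (x + s *: a) m0.
Proof.
move=> m0D x0 aD s0 m mm0; rewrite [ltLHS]trop_termE//.
have [mD|/cPoo cm] := boolP (m \in support_set c); last by rewrite /trop_term cm ltey.
have := x0 _ mm0; rewrite !trop_termE// !lte_fin !dotDr !dotZr.
have := mulr_ge0 s0 (aD m mD); rewrite dotBr !(dotC a) mulrBr; lra.
Qed.

(** If some direction [d] is not a nonnegative combination of the [pt m - pt m0], Farkas gives a
    nonzero [a] that is nonnegative on all of them; the whole ray from [x] in direction [a] then
    stays in the region of [m0]. *)
Lemma strict_min_bounded_interior x m0 : m0 \in support_set c -> strict_min x m0 ->
  bounded_set (connected_component (~` trop_surface c) x) ->
  alg_interior (trop_newton c) (pt m0).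
Proof.
move=> m0D x0 xb d; rewrite trop_newton_hull.
pose A m := if m \in support_set c then pt m - pt m0 else 0.
have [[t t0 tE]|[v vA vd]] := farkas A d.
  pose T := 1 + \sum_m t m.
  have T0 : 0 < T by rewrite ltr_wpDr ?sumr_ge0.
  pose r m := if m \in support_set c then t m else 0.
  have rT : \sum_m r m <= \sum_m t m by apply: ler_sum => m _; rewrite /r; case: ifP.
  exists T^-1; first by rewrite invr_gt0.
  exists (fun m => r m / T + (m == m0)%:R * (1 - (\sum_m r m) / T)); split.
  - move=> m; rewrite addr_ge0//.
      by rewrite divr_ge0 ?(ltW T0)// /r; case: ifP.
    by rewrite mulr_ge0// subr_ge0 ler_pdivrMr// mul1r (le_trans rT)// lerDr.
  - move=> m mD; rewrite /r (negPf mD) mul0r add0r; have [E|_] := eqVneq m m0; last by rewrite mul0r.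
    by rewrite E m0D in mD.
  - rewrite big_split/= -mulr_suml [X in _ + X](bigD1 m0)//= eqxx mul1r.
    rewrite [X in _ + (_ + X)]big1 ?addr0 ?subrKC//.
    by move=> m /negPf ->; rewrite mul0r.
  rewrite (eq_bigr _ (fun m _ => scalerDl _ _ _)) big_split/=.
  rewrite [X in _ = _ + X](bigD1 m0)//= eqxx mul1r [X in _ = _ + (_ + X)]big1 ?addr0; last first.
    by move=> m /negPf ->; rewrite mul0r scale0r.
  rewrite scalerBl scale1r addrCA; congr (_ + _).
  rewrite tE scaler_sumr mulr_suml scaler_suml -sumrB; apply: eq_bigr => m _.
  by rewrite /A /r; case: ifP => _; rewrite ?mul0r ?scale0r ?subr0 ?scaler0// -scalerBr scalerA mulrC.
exfalso; pose a := v^T.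
have aD m : m \in support_set c -> 0 <= dot a (pt m - pt m0).
  by move=> mD; have := vA m; rewrite /A mD dotE trmxK.
have a0 : a != 0.
  apply: contraTneq vd => /(congr1 trmx); rewrite trmxK trmx0 => ->.
  by rewrite mulmx0 mxE ltxx.
have [j aj] : exists j, a 0 j != 0.
  apply: contrapT => /forallNP aN; case/eqP: a0; apply/rowP => j; rewrite [RHS]mxE.
  by apply/eqP/negPn/negP/aN.
have ray s : 0 <= s -> connected_component (~` trop_surface c) x (x + s *: a).
  move=> s0; apply: (@connected_component_max _ _ ((fun u : R => x + u *: a) @` `[0, s])).
  - by exists 0; rewrite ?scale0r ?addr0//= in_itv/= lexx.
  - move=> y [u /=]; rewrite in_itv/= => /andP[u0 _] <-{y}.
    by apply: (@strict_min_not_surface _ m0); apply: strict_min_ray.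
  - apply: connected_continuous_connected; first exact: segment_connected.
    apply: continuous_subspaceT => u.
    by apply: cvgD; [exact: cvg_cst | apply: cvgZr_tmp; exact: cvg_id].
  - by exists s; rewrite //= in_itv/= s0 lexx.
have [M M0 xM] := ex_strict_bound_gt0 xb.
(* Far enough on the ray for coordinate [j] to have absolute value at least the strict bound [M]. *)
pose s := (M + `|x 0 j|) / `|a 0 j|.
have s0 : 0 <= s by rewrite divr_ge0// addr_ge0// ltW.
have /= := xM _ (ray s s0).
have : `|(x + s *: a) 0 j| <= `|x + s *: a|.
  rewrite [leRHS]/Num.norm/= mx_normrE.
  exact: (le_bigmax _ (fun ij : 'I_1 * 'I_3 => `|(x + s *: a) ij.1 ij.2|) (0, j)).
move=> /le_lt_trans/[apply]; rewrite [(x + _) 0 j]mxE [(_ *: a) 0 j]mxE => sM.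
have : `|s * a 0 j| - `|x 0 j| <= `|x 0 j + s * a 0 j|.
  by rewrite -[X in `|X| - _](addKr (x 0 j)) lerBlDl (le_trans (ler_normD _ _))// normrN.
rewrite normrM (ger0_norm s0) divfK ?normr_eq0// addrK => /le_lt_trans/(_ sM).
by rewrite ltxx.
Qed.

Lemma bounded_region_center :
  trop_newton c `<=` @simplex4 R -> has_bounded_region c ->
  alg_interior (trop_newton c) (const_mx 1) /\
  exists2 m, m \in support_set c & pt m = const_mx 1.
Proof.
move=> csub [x /not_surface_strict_min[m0 m0D x0] xb].
have := strict_min_bounded_interior m0D x0 xb; rewrite lpointE => m0int.
have m0E := center_of_alg_interior csub m0int.
rewrite m0E int_pt_center in m0int; split=> //; exists m0 => //.
by rewrite lpointE m0E int_pt_center.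
Qed.

End BoundedRegion.

(** * Central triangulations and reflexive polytopes *)

Section UnimodularSimplex.
Local Open Scope classical_set_scope.
Variable R : realType.
Local Notation vertex V i := (int_pt R (row i V)).

(** The edge vectors at one vertex form an integral matrix of determinant 1 or -1, which is inverted
    over the integers. *)
Lemma unimodular_affine_interpolation (V : 'M[int]_(4, 3)) (g : 'I_4 -> int) :
  normalized_volume V = 1%N -> exists n : 'rV[int]_3, forall i j,
    \sum_k n 0 k * (V i k - V j k) = g i - g j.
Proof.
rewrite /normalized_volume; set M := \matrix_(i, j) _ => M1.
have Mu : M \in unitmx.
  by rewrite unitmxE; case: (\det M) M1 => [[|[|//]]|[|//]].
pose b : 'cV[int]_3 := \col_i (g (lift ord0 i) - g ord0).
pose n := (invmx M *m b)^T; exists n.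
have n0 i : \sum_k n 0 k * (V i k - V ord0 k) = g i - g ord0.
  have [j ->|->] := unliftP ord0 i; last first.
    by rewrite subrr big1// => k _; rewrite subrr mulr0.
  have /(congr1 (fun A : 'cV_3 => A j 0)) : M *m n^T = b by rewrite trmxK mulKVmx.
  rewrite [in RHS]mxE => <-; rewrite mxE; apply: eq_bigr => k _.
  by rewrite [M j k]mxE [n^T k 0]mxE mulrC.
move=> i j; rewrite (_ : g i - g j = (g i - g ord0) - (g j - g ord0)); last by ring.
by rewrite -!n0 -sumrB; apply: eq_bigr => k _; ring.
Qed.

Lemma dot_int_pt (n u v : 'rV[int]_3) :
  dot (int_pt R n) (int_pt R u - int_pt R v) = (\sum_k n 0 k * (u 0 k - v 0 k))%:~R.
Proof.
by rewrite rmorph_sum; apply: eq_bigr => k _; rewrite !mxE rmorphM rmorphB.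
Qed.

Definition edge_matrix (V : 'M[int]_(4, 3)) i0 : 'M[R]_3 :=
  \matrix_j (vertex V (lift i0 j) - vertex V i0).

Lemma edge_matrix_unit V i0 : normalized_volume V = 1%N -> edge_matrix V i0 \in unitmx.
Proof.
move=> V1; rewrite -row_free_unit -kermx_eq0; apply/eqP/row_matrixP => i.
rewrite row0; have /sub_kermxP := row_sub i (kermx (edge_matrix V i0)).
set u := row i _ => uB; apply/rowP => j; rewrite [RHS]mxE.
have [n nE] := unimodular_affine_interpolation (fun i => (i == lift i0 j)%:R) V1.
have : dot (int_pt R n) (u *m edge_matrix V i0) = u 0 j.
  rewrite mulmx_sum_row dot_sumr (bigD1 j)//= big1 ?addr0 => [|k kj].
    rewrite rowK dot_int_pt; under eq_bigr do rewrite !mxE.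
    by rewrite nE eqxx (negPf (neq_lift _ _)) subr0 mulr1.
  rewrite rowK dot_int_pt; under eq_bigr do rewrite !mxE.
  by rewrite nE (inj_eq lift_inj) (negPf kj) (negPf (neq_lift _ _)) subrr mulr0.
by move=> <-; rewrite uB dotC /dot big1// => k _; rewrite mxE mul0r.
Qed.

(** The affine function with value 0 at vertex [i0] and -1 at the others has an integral linear
    part; it is primitive because it takes the value -1 on a lattice vector. *)
Lemma edge_matrix_normal V i0 : normalized_volume V = 1%N ->
  exists n : 'rV[int]_3, primitive_row n /\
    forall j, dot (int_pt R n) (row j (edge_matrix V i0)) = -1.
Proof.
move=> V1; have [n nE] := unimodular_affine_interpolation (fun i => (i == i0)%:R - 1) V1.
have n1 j : \sum_k n 0 k * (V (lift i0 j) k - V i0 k) = -1.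
  by rewrite nE eqxx eq_sym (negPf (neq_lift _ _)) subrr subr0 sub0r.
exists n; split; last first.
  by move=> j; rewrite rowK dot_int_pt; under eq_bigr do rewrite !mxE; rewrite n1.
rewrite /primitive_row; set g := bigop.body _ _ _; apply/eqP; rewrite -dvdn1.
have gn k : (g%:Z %| n ord0 k)%Z by rewrite dvdzE /g (bigD1 k)//= dvdn_gcdl.
have : (g%:Z %| \sum_k n 0 k * (V (lift i0 ord0) k - V i0 k))%Z.
  by apply: rpred_sum => k _; apply: dvdz_mulr.
by rewrite n1.
Qed.

End UnimodularSimplex.

Section CentralNormals.
Local Open Scope classical_set_scope.
Variables (R : realType) (c : quartic_monomial -> \bar R).
Local Notation pt := (@lpoint R).
Local Notation D := (support_set c).
Local Notation h := (fun m => fine (c m)).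
Local Notation p := (const_mx 1 : 'rV[R]_3).
Hypotheses (c_smooth : trop_smooth c) (c_central : trop_central c).

Lemma central_cell w : tight_max pt D h w -> exists (B : 'M[R]_3) (n : 'rV[int]_3),
  [/\ B \in unitmx, primitive_row n, forall j, dot (int_pt R n) (row j B) = -1 &
    hull pt (tight pt D h w) =
      [set p + t *m B | t in [set t : 'rV[R]_3 | (forall j, 0 <= t 0 j) /\ \sum_j t 0 j <= 1]]].
Proof.
move=> wmax; set S := hull _ _.
have Scell : maximal_cell c S by apply/maximal_cellP; exists w.
have [V [SV V1]] := c_smooth Scell.
have [a [b [ab pab]]] := c_central Scell.
have SE : S = hull (fun i => int_pt R (row i V)) [set: 'I_4]%SET.
  rewrite SV -conv_hull_finite; congr conv_hull; apply/seteqP.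
  by split=> x [i _ <-]; exists i => //=; rewrite inE.
(* As [p] is a supported face of the cell, every vertex of positive weight in a representation of
   [p] lies on that face and hence equals [p]. *)
have [i0 pE] : exists i0, p = int_pt R (row i0 V).
  have : [set p] p by [].
  rewrite pab => -[]; rewrite SE => -[t [t0 _ t1 pE]] /= ap.
  have terms : \sum_i t i * (dot a (int_pt R (row i V)) - b) = 0.
    by under eq_bigr do rewrite mulrBr; rewrite sumrB -mulr_suml t1 mul1r -dot_sumr -pE ap subrr.
  have Vin i : S (int_pt R (row i V)) by rewrite SE; apply: hull_pt; rewrite inE.
  have [i ti] : exists i, t i != 0.
    apply: contrapT => /forallNP tN; have /eqP := t1.
    by rewrite big1 ?(eq_sym _ 1) ?oner_eq0// => i _; apply/eqP/negPn/negP/tN.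
  exists i; suff : [set p] (int_pt R (row i V)) by [].
  rewrite pab; split=> //=; move/eqP: terms; rewrite psumr_eq0 => [/allP/(_ i)|k _].
    by rewrite mem_index_enum => /(_ isT); rewrite mulf_eq0 (negPf ti) subr_eq0 => /eqP.
  by rewrite mulr_ge0// subr_ge0 ab.
have [n [n1 nB]] := edge_matrix_normal R i0 V1.
exists (edge_matrix R V i0), n; split=> //; first exact: edge_matrix_unit.
have rowsE (t : 'I_4 -> R) : \sum_i t i = 1 ->
    \sum_i t i *: int_pt R (row i V) = p + (\row_j t (lift i0 j)) *m edge_matrix R V i0.
  move=> t1; rewrite mulmx_sum_row (bigD1_ord i0)//= -pE.
  under [in RHS]eq_bigr do rewrite rowK mxE -pE scalerBr.
  rewrite sumrB -scaler_suml [in RHS]addrA [in RHS]addrC addrA; congr (_ + _).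
  have -> : t i0 = 1 - \sum_(i < 3) t (lift i0 i) by rewrite -t1 (bigD1_ord i0)//= addrK.
  by rewrite scalerBl scale1r addrC.
rewrite SE; apply/seteqP; split=> x.
  move=> [t [t0 _ t1 ->]]; exists (\row_j t (lift i0 j)); last by rewrite rowsE.
  split=> [j|]; first by rewrite mxE.
  under eq_bigr do rewrite mxE.
  by rewrite -t1 (bigD1_ord i0)//= lerDr.
move=> [t [t0 t1] <-].
pose s i := if unlift i0 i is Some j then t 0 j else 1 - \sum_j t 0 j.
have s1 : \sum_i s i = 1.
  rewrite (bigD1_ord i0)//= {1}/s unlift_none.
  by under eq_bigr do rewrite /s liftK; rewrite subrK.
exists s; split=> //.
- by move=> i; rewrite /s; case: unliftP => [j|] _; rewrite ?subr_ge0.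
- by move=> i; rewrite inE.
- by rewrite rowsE//; congr (_ + _ *m _); apply/rowP => j; rewrite mxE /s liftK.
Qed.

(* If [y] violates the inequality, a point [x] of [P] just beyond the facet of the cell of [w]
   opposite to [p] lies in another cell.  As that cell contains [p] too, the midpoint of [p]
   and [x] is a common point which is interior to the cell of [w]; hence the cells coincide. *)
Lemma central_cell_normal_valid w (B : 'M[R]_3) (a : 'rV[R]_3) y :
  tight_max pt D h w -> B \in unitmx -> (forall j, dot a (row j B) = -1) ->
  hull pt (tight pt D h w) =
      [set p + t *m B | t in [set t : 'rV[R]_3 | (forall j, 0 <= t 0 j) /\ \sum_j t 0 j <= 1]] ->
  hull pt D y -> -1 <= dot a (y - p).
Proof.
move=> wmax Bu aB wB yD; rewrite leNgt; apply/negP => ay.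
have aE (t : 'rV[R]_3) : dot a (t *m B) = - \sum_j t 0 j.
  by rewrite mulmx_sum_row dot_sumr -sumrN; apply: eq_bigr => j _; rewrite aB mulrN1.
have sumE (q t : 'rV[R]_3) e : \sum_j (q + e *: (q - t)) 0 j =
    \sum_j q 0 j + e * (\sum_j q 0 j - \sum_j t 0 j).
  by rewrite -sumrB mulr_sumr -big_split/=; apply: eq_bigr => j _; rewrite !mxE.
have [s sE] : exists s, y = p + s *m B.
  by exists ((y - p) *m invmx B); rewrite mulmxKV// subrKC.
have s1 : 1 < \sum_j s 0 j by move: ay; rewrite {1}sE addrAC subrr add0r aE; lra.
(* [r] lies on the segment from the barycentre of the facet opposite to [p] towards [s]. Its
   coordinates stay positive because [e * (2 + 3 * |s_j|) <= 1], and their sum exceeds 1 because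
   that of [s] does. *)
pose N := 2 + 3 * \sum_j `|s 0 j|; pose e := N^-1.
have N2 : 2 <= N by rewrite lerDl mulr_ge0// sumr_ge0.
have e0 : 0 < e by rewrite invr_gt0; apply: lt_le_trans N2.
have e1 : e <= 2^-1 by rewrite lef_pV2 ?posrE//; apply: lt_le_trans N2.
pose r : 'rV[R]_3 := (1 - e) *: const_mx (3^-1) + e *: s.
have r0 j : 0 < r 0 j.
  rewrite mxE [X in _ + X]mxE [X in X + _]mxE [const_mx _ _ _]mxE; have : e * (2 + 3 * `|s 0 j|) <= 1.
    rewrite -ler_pdivlMl// invrK mulr1 lerD2l ler_pM2l// (bigD1 j)//= lerDl sumr_ge0//.
  have : - `|s 0 j| <= s 0 j by rewrite lerNl -normrN ler_norm.
  move=> h1 h2; have := mulr_ge0 (ltW e0) (_ : 0 <= s 0 j + `|s 0 j|).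
  by rewrite -lerBlDr sub0r => /(_ h1); lra.
have r1 : \sum_j r 0 j = 1 + e * (\sum_j s 0 j - 1).
  under eq_bigr do rewrite !mxE.
  by rewrite big_split/= sumr_const card_ord -mulr_sumr -mulr_natr; field.
pose x := p + r *m B.
have xD : hull pt D x.
  have -> : x = (1 - e) *: (p + const_mx (3^-1) *m B) + (1 - (1 - e)) *: y.
    rewrite /x sE {1}/r mulmxDl !scalerDr -!scalemxAl subKr addrACA; congr (_ + _).
    by rewrite -scalerDl subrK scale1r.
  apply: hull_convex => //; last by apply/andP; split; lra.
  have : hull pt (tight pt D h w) (p + const_mx 3^-1 *m B).
    rewrite wB; exists (const_mx 3^-1) => //; split=> [j|]; first by rewrite mxE.
    by under eq_bigr do rewrite mxE; rewrite sumr_const card_ord -mulr_natr; lra.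
  by apply: hullS; apply/fintype.subsetP => m /tightP[].
have [w' w'max xw'] := tight_max_cover h xD.
have pw' : hull pt (tight pt D h w') p.
  have [a' [b' [_ pab]]] : is_vertex (hull pt (tight pt D h w')) p.
    by apply: c_central; apply/maximal_cellP; exists w'.
  by have : [set p] p by []; rewrite pab => -[].
pose z := p + (2^-1 *: r) *m B.
have zw' : hull pt (tight pt D h w') z.
  have -> : z = 2^-1 *: x + (1 - 2^-1) *: p.
    rewrite /z /x -scalemxAl scalerDr addrAC -scalerDl (_ : 2^-1 + (1 - 2^-1) = 1) ?scale1r//; lra.
  by apply: hull_convex => //; apply/andP; split; lra.
have [wf wm] := wmax; have [w'f _] := w'max.
have zle : affine_eval w z <= affine_eval w' z by apply: feasible_hull_le zw'.
pose v := w - w'.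
have v0 u : hull pt (tight pt D h w) u -> 0 <= affine_eval v u.
  by move=> uw; rewrite affine_evalD affine_evalN subr_ge0; apply: feasible_hull_le uw.
have vz : affine_eval v z <= 0 by rewrite affine_evalD affine_evalN subr_le0.
(* The affine [v] is nonnegative on the cell and nonpositive at [z]. Since the segment from [u] to
   [z] can be prolonged a little inside the cell, [v] vanishes at [u]. *)
have cell u : hull pt (tight pt D h w) u -> affine_eval v u = 0.
  move=> uw; apply/eqP; rewrite eq_le v0// andbT.
  move: uw; rewrite wB => -[t [t0 t1] uE].
  have [|e' e'0 e'P] := @small_step R (option 'I_3)
      (fun o => if o is Some j then (2^-1 *: r) 0 j else 1 - \sum_j (2^-1 *: r) 0 j)
      (fun o => if o is Some j then (2^-1 *: r) 0 j - t 0 j else \sum_j t 0 j - \sum_j (2^-1 *: r) 0 j).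
    move=> [j|]; left; first by rewrite mxE mulr_gt0.
    under eq_bigr do rewrite mxE.
    rewrite -mulr_sumr r1 subr_gt0.
    have : e * (2 + 3 * \sum_j `|s 0 j|) = 1 by rewrite mulVf// gt_eqF// (lt_le_trans _ N2).
    have : \sum_j s 0 j <= \sum_j `|s 0 j| by apply: ler_sum => j _; apply: ler_norm.
    move: e0; set A := \sum_j s 0 j; set A' := \sum_j _; nra.
  have : 0 <= affine_eval v (z + e' *: (z - u)).
    apply: v0; rewrite wB; exists (2^-1 *: r + e' *: (2^-1 *: r - t)).
      split=> [j|]; first by have := e'P (Some j); rewrite !mxE.
      rewrite sumE.
      by have := e'P None; lra.
    have -> : z - u = (2^-1 *: r - t) *m B by rewrite -uE /z opprD addrACA subrr add0r mulmxBl.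
    by rewrite mulmxDl -(scalemxAl e') addrA.
  rewrite !affine_eval_dotE dotDr dotZr dotBr => fz.
  move: vz; rewrite affine_eval_dotE => vz; move: fz vz e'0.
  set A := dot _ z; set B' := dot _ u; set C := v _ _; nra.
have ww' : tight pt D h w \subset tight pt D h w'.
  apply/fintype.subsetP => m mw; have [mD mh] := tightP _ _ _ _ _ mw.
  apply/tightP; split=> //; rewrite -mh; apply/esym/eqP; rewrite -subr_eq0.
  by rewrite -affine_evalN -affine_evalD cell//; apply: hull_pt.
have /esym E := wm _ w'f ww'.
move: xw'; rewrite -E wB => -[t [t0 t1]] /addrI/(congr1 (dot a)).
rewrite !aE r1 => /oppr_inj tE; move: t1; rewrite tE leNgt ltrDl mulr_gt0//.
by rewrite subr_gt0.
Qed.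

End CentralNormals.

Section ReflexiveOfCells.
Local Open Scope classical_set_scope.
Variables (R : realType) (I : finType) (pt : I -> 'rV[R]_3) (D : {set I}).
Local Notation p := (const_mx 1 : 'rV[R]_3).
Local Notation P := (hull pt D).
Local Notation nR n := (int_pt R n).

Lemma unitmx_dot_eq0 (B : 'M[R]_3) e :
  B \in unitmx -> (forall j, dot e (row j B) = 0) -> e = 0.
Proof.
move=> Bu eB; apply: trmx_inj; rewrite trmx0 -[LHS](mulKmx Bu) (_ : B *m e^T = 0) ?mulmx0//.
apply/colP => j; rewrite !mxE -[RHS](eB j); apply: eq_bigr => k _.
by rewrite !mxE mulrC.
Qed.

Lemma affdim3_hyperplane (Q : set 'rV[R]_3) a b :
  affdim_ge Q 3 -> (forall x, Q x -> dot a x = b) -> a = 0.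
Proof.
move=> [x [M [Qx QM Mfree]]] ab; apply: (@unitmx_dot_eq0 M); first by rewrite -row_free_unit.
by move=> j; have := ab _ (QM j); rewrite dotDr ab// => /(canRL (addKr _)) ->; rewrite addNr.
Qed.

Definition central_simplex (n : 'rV[int]_3) (B : 'M[R]_3) :=
  [/\ B \in unitmx, forall j, dot (nR n) (row j B) = -1 &
    forall t : 'rV[R]_3, (forall j, 0 <= t 0 j) -> \sum_j t 0 j <= 1 -> P (p + t *m B)].

Lemma central_simplex_vertex n B j : central_simplex n B -> P (p + row j B).
Proof.
move=> [_ _ BP]; rewrite rowE; apply: BP => [k|].
  by rewrite mxE ler0n.
by rewrite (bigD1 j)//= mxE !eqxx big1 ?addr0// => k kj; rewrite mxE (negPf kj) andbF.
Qed.

Lemma central_simplex_dot n B t : central_simplex n B ->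
  dot (nR n) (t *m B) = - \sum_j t 0 j.
Proof.
move=> [_ nB _]; rewrite dot_mulmx -sumrN.
by apply: eq_bigr => j _; rewrite nB mulrN1.
Qed.

Definition opposite_facet (n : 'rV[int]_3) : set 'rV[R]_3 :=
  P `&` [set x | dot (nR n) x = dot (nR n) p - 1].

Lemma opposite_facet_vertex n B j : central_simplex n B -> opposite_facet n (p + row j B).
Proof.
move=> nB; split; first exact: central_simplex_vertex nB.
by case: nB => _ nB _; rewrite /= dotDr nB.
Qed.

Lemma opposite_facet_inj n B n' :
  central_simplex n B -> opposite_facet n = opposite_facet n' -> n = n'.
Proof.
move=> nB nn'; suff E : nR n' - nR n = 0.
  apply/rowP => j; apply: (@intr_inj R).
  by have /eqP := congr1 (fun M : 'rV_3 => M 0 j) E; rewrite !mxE subr_eq0 => /eqP.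
have [Bu nB1 _] := nB; apply: unitmx_dot_eq0 Bu _ => j.
have := opposite_facet_vertex j nB; rewrite nn' => -[_ /=]; rewrite dotDr => /addrI n'B.
by rewrite dotC dotBr dotC n'B dotC nB1 subrr.
Qed.

Lemma opposite_facet_affdim n B : central_simplex n B -> has_affdim (opposite_facet n) 2.
Proof.
move=> nB; have [Bu nB1 _] := nB; split; last first.
  move=> /affdim3_hyperplane/(_ (fun x => @proj2 _ _)) n0.
  by have /eqP := nB1 ord0; rewrite n0 dot0l eq_sym oppr_eq0 oner_eq0.
exists (p + row ord0 B), (\matrix_(i < 2) (row (lift ord0 i) B - row ord0 B)); split.
- exact: opposite_facet_vertex nB.
- by move=> i; rewrite rowK addrA addrAC addrK; apply: opposite_facet_vertex nB.
rewrite -kermx_eq0; apply/eqP/row_matrixP => i; rewrite row0.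
have /sub_kermxP := row_sub i (kermx (\matrix_(i < 2) (row (lift ord0 i) B - row ord0 B))).
set u := row i _ => uM.
pose u' : 'rV[R]_3 := \row_j if unlift ord0 j is Some k then u 0 k else - \sum_k u 0 k.
have : u' *m B = 0.
  rewrite mulmx_sum_row big_ord_recl -[RHS]uM mulmx_sum_row !mxE unlift_none.
  under [X in _ + X = _]eq_bigr do rewrite mxE liftK.
  under [RHS]eq_bigr do rewrite rowK scalerBr.
  by rewrite sumrB -scaler_suml scaleNr addrC.
move=> /(congr1 (mulmx^~ (invmx B))); rewrite mulmxK// mul0mx => u'0.
apply/rowP => k; have := congr1 (fun M : 'rV_3 => M 0 (lift ord0 k)) u'0.
by rewrite mxE liftK => ->; rewrite !mxE.
Qed.

Variable N : seq 'rV[int]_3.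
Hypotheses (N_uniq : uniq N) (p_int : alg_interior P p) (N_primitive : {in N, forall n, primitive_row n}).
Hypothesis N_valid : forall n y, n \in N -> P y -> -1 <= dot (nR n) (y - p).
Hypothesis N_simplex : forall n, n \in N -> exists B, central_simplex n B.
Hypothesis N_cover : forall y, P y -> exists n B t, [/\ n \in N, central_simplex n B &
  [/\ y = p + t *m B, forall j, 0 <= t 0 j & \sum_j t 0 j <= 1]].

(** A point on the segment from the interior point [p] to [x] lies in some cell, and the inequality
    of that cell alone, scaled back, puts [x] into the same cell. *)
Lemma half_spaces_of_cells x :
  (forall n, n \in N -> dot (nR n) p - 1 <= dot (nR n) x) -> P x.
Proof.
move=> xN; have [e e0 /N_cover[n [B [t [nN nB [tE t0 t1]]]]]] := p_int (x - p).
move/addrI: tE => tE; have -> : x = p + (e^-1 *: t) *m B.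
  by rewrite -scalemxAl -tE scalerA mulVf ?gt_eqF// scale1r subrKC.
have [_ _] := nB; apply=> [j|]; first by rewrite mxE mulr_ge0// invr_ge0 ltW.
under eq_bigr do rewrite mxE.
rewrite -mulr_sumr ler_pdivrMl// mulr1.
have := congr1 (dot (nR n)) tE; rewrite dotZr dotBr (central_simplex_dot _ nB) => E.
have := ler_wpM2l (ltW e0) (xN n nN); rewrite mulrBr mulr1; lra.
Qed.

Lemma affdim_of_cells : affdim_ge P 3.
Proof.
have [n [B [_ [_ nB _]]]] := N_cover (alg_interior_mem p_int).
exists p, B; split; [exact: alg_interior_mem | | by rewrite row_free_unit; case: nB].
by move=> j; apply: central_simplex_vertex nB.
Qed.

(** A point [z] in the relative interior of a triangle in [G] lies in some cell, and on its side
    opposite to [p] because [z] minimizes the functional [a] of [G]. There the normal [n] attains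
    its minimum over [P], hence also at the three corners, and so [n] is proportional to [a]. *)
Lemma opposite_facetP G : is_facet P G -> exists2 n, n \in N & G = opposite_facet n.
Proof.
move=> [[a [b [ab GE]]] [[x0 [M [Gx0 GM Mfree]]] G3]].
have ap : b < dot a p.
  rewrite lt_neqAle ab ?andbT; last exact: alg_interior_mem.
  apply/eqP => bE; have a0 : a = 0.
    by apply: (alg_interior_half_space p_int) => y /ab; rewrite bE.
  apply: G3; rewrite GE (_ : P `&` _ = P); first exact: affdim_of_cells.
  apply/seteqP; split=> [y []//|y Py]; split=> //=.
  by rewrite bE a0 !dot0l.
pose r0 := row ord0 M; pose r1 := row ord_max M.
have GP y : G y -> P y /\ dot a y = b by rewrite GE.
have [Px0 ax0] := GP _ Gx0.
have [Pr0 ar0] := GP _ (GM ord0); have [Pr1 ar1] := GP _ (GM ord_max).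
(* The weights of the three points of [G] are 1/4, 1/4 and 1/2; only their positivity matters. *)
pose z := 2^-1 *: (2^-1 *: x0 + (1 - 2^-1) *: (x0 + r0)) + (1 - 2^-1) *: (x0 + r1).
have Pz : P z by do 2?[apply: hull_convex => //]; apply/andP; split; lra.
have az : dot a z = b by rewrite 2!(dotDr, dotZr) dotDr !dotZr ax0 ar0 ar1; lra.
have [n [B [t [nN nB [tE t0 t1]]]]] := N_cover Pz.
have tE1 : \sum_j t 0 j = 1.
  apply/eqP; rewrite eq_le t1/= -subr_le0 -(pmulr_lle0 _ (_ : 0 < dot a p - b)) ?subr_gt0//.
  have : dot a z = dot a p + \sum_j t 0 j * dot a (row j B).
    by rewrite tE dotDr dot_mulmx.
  have : \sum_j t 0 j * (b - dot a p) <= \sum_j t 0 j * dot a (row j B).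
    apply: ler_sum => j _; rewrite ler_wpM2l// lerBlDl -dotDr ab//.
    exact: central_simplex_vertex nB.
  by rewrite -mulr_suml az; lra.
exists n => //.
have nz : dot (nR n) (z - p) = -1.
  by rewrite tE addrAC subrr add0r (central_simplex_dot _ nB) tE1.
have nG y : P y -> -1 <= dot (nR n) y - dot (nR n) p by move=> /(N_valid nN); rewrite dotBr.
have aM j : dot a (row j M) = 0.
  by have [_] := GP _ (GM j); rewrite dotDr ax0 => /(canRL (addKr _)) ->; rewrite addNr.
have [nx0 nr0 nr1] : [/\ dot (nR n) (x0 - p) = -1, dot (nR n) r0 = 0 & dot (nR n) r1 = 0].
  have := (nG _ Px0, nG _ Pr0, nG _ Pr1); move: nz.
  rewrite !(dotBr, dotDr, dotZr); case=> ? [[? ?] ?]; split; lra.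
have nM j : dot (nR n) (row j M) = 0.
  by case: j => [[|[|]]]// jlt; [rewrite -[RHS]nr0 | rewrite -[RHS]nr1]; congr (dot _ (row _ _)); exact/val_inj.
pose l := dot a p - b.
(* Both sides agree on the rows of [M] and on [x0 - p], which form a basis. *)
have aE : a = l *: nR n.
  apply/eqP; rewrite -subr_eq0; apply/eqP; pose C : 'M[R]_(2 + 1, 3) := col_mx M (x0 - p).
  apply: (@unitmx_dot_eq0 C).
    rewrite -row_free_unit -kermx_eq0; apply/eqP/row_matrixP => i; rewrite row0.
    have /sub_kermxP := row_sub i (kermx C); set u : 'rV_(2 + 1) := row i _.
    have -> : u *m C = lsubmx u *m M + rsubmx u *m (x0 - p).
      by rewrite -{1}[u]hsubmxK; exact: mul_row_col.
    rewrite -{3}[u]hsubmxK => uC.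
    have : dot a (lsubmx u *m M + rsubmx u *m (x0 - p)) = 0.
      by rewrite uC dotC dot0l.
    rewrite dotDr !dot_mulmx big1 ?add0r => [|j _]; last by rewrite aM mulr0.
    rewrite big_ord1 row_id dotBr ax0 => /eqP; rewrite mulf_eq0 subr_eq0 (lt_eqF ap) orbF => /eqP u2.
    have u20 : rsubmx u = 0 by apply/rowP => j; rewrite ord1 u2 mxE.
    by move: uC; rewrite u20 mul0mx addr0 => /eqP; rewrite mulmx_free_eq0// => /eqP ->; rewrite row_mx0.
  move=> j; rewrite dotBl dotZl; have [k ->|k ->] := @split_ordP 2 1 j.
    by have -> : row (lshift 1 k) C = row k M; rewrite ?aM ?nM ?mulr0 ?subrr//; exact: rowKu.
  have -> : row (rshift 2 k) C = x0 - p by rewrite -[RHS](row_id k); exact: rowKd.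
  by rewrite dotBr ax0 nx0 /l; ring.
have l0 : 0 < l by rewrite subr_gt0.
have bE : b = l * (dot (nR n) p - 1) by rewrite mulrBr -dotZl -aE /l mulr1 subKr.
rewrite GE; apply/seteqP; split=> y [Py /= ay]; split=> //=; move: ay.
  by rewrite aE bE dotZl => /(mulfI (lt0r_neq0 l0)).
by rewrite aE bE dotZl => ->.
Qed.

Lemma reflexive_of_cells : lattice_polytope P -> P `<=` @simplex4 R -> reflexive3 P.
Proof.
move=> Plat Psub; split=> //.
  split; first exact: affdim_of_cells.
  by move=> [x [M [_ _]]]; rewrite /row_free => /eqP Mr; have := rank_leq_col M; rewrite Mr.
exists (const_mx 1); split.
  move=> q; split=> [/interior_alg_interior/(center_of_alg_interior Psub)//|->].
  by rewrite int_pt_center; apply: alg_interior_hull_interior.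
pose A : 'M[int]_(size N, 3) := \matrix_i nth 0 N i.
pose b : 'cV[int]_(size N) := A *m (const_mx 1)^T - const_mx 1.
have bE i : (b i 0)%:~R = dot (nR (row i A)) p - 1 :> R.
  rewrite !mxE rmorphB rmorph_sum; congr (_ - _); apply: eq_bigr => j _.
  by rewrite !mxE rmorphM.
have AN i : row i A \in N by rewrite rowK mem_nth.
exists (size N), A, b; split; last by rewrite /b opprB addrC subrK.
have FE i : P `&` [set x | dot (nR (row i A)) x = (b i 0)%:~R] = opposite_facet (row i A).
  by rewrite bE.
split.
- apply/seteqP; split=> x /=.
    by move=> Px i; rewrite bE; have := N_valid (AN i) Px; rewrite dotBr; lra.
  move=> xb; apply: half_spaces_of_cells => n nN.
  have iN : (index n N < size N)%N by rewrite index_mem.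
  by have := xb (Ordinal iN); rewrite bE rowK nth_index.
- by move=> i; apply/N_primitive/AN.
- move=> i; rewrite FE; have [B nB] := N_simplex (AN i); split; last exact: opposite_facet_affdim nB.
  exists (nR (row i A)), (dot (nR (row i A)) p - 1); split=> // x Px.
  by have := N_valid (AN i) Px; rewrite dotBr; lra.
- move=> G /opposite_facetP[n nN GE].
  have iN : (index n N < size N)%N by rewrite index_mem.
  have nE : row (Ordinal iN) A = n by rewrite rowK nth_index.
  exists (Ordinal iN); split=> [|i]; rewrite FE ?nE// GE => /esym E.
  have [B nB] := N_simplex (AN i).
  apply/val_inj => /=; rewrite -(opposite_facet_inj nB E) rowK index_uniq//.
Qed.

End ReflexiveOfCells.

Lemma reflexive_of_central (R : realType) (P : set 'rV[R]_3) :
  lattice_polytope P -> (P `<=` @simplex4 R)%classic ->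
  central_tropical_polytope P -> reflexive3 P.
Proof.
move=> + + [c [c_Noo cP c_smooth c_region c_central]].
move=> /[swap] Psub; have [] := bounded_region_center c_Noo _ c_region; rewrite cP//.
move=> p_int _ Plat; move: Psub p_int Plat; rewrite -cP trop_newton_hull => Psub p_int Plat.
pose pt := @lpoint R; pose D := support_set c; pose h m := fine (c m).
have cells w : tight_max pt D h w -> exists n, exists2 B, primitive_row n &
    central_simplex pt D n B /\ hull pt (tight pt D h w) = [set const_mx 1 + t *m B | t in
      [set t : 'rV[R]_3 | (forall j, 0 <= t 0 j) /\ \sum_j t 0 j <= 1]%classic]%classic.
  move=> wmax; have [B [n [Bu n1 nB wB]]] := central_cell c_smooth c_central wmax.
  exists n, B => //; split=> //; split=> // t t0 t1.
  apply: (@hullS _ _ _ _ (tight pt D h w)); last by rewrite wB; exists t.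
  by apply/fintype.subsetP => m /tightP[].
have Nn T : exists n, (exists2 w, tight_max pt D h w & T = tight pt D h w) ->
    exists2 B, primitive_row n & central_simplex pt D n B /\
    hull pt T = [set const_mx 1 + t *m B | t in
      [set t : 'rV[R]_3 | (forall j, 0 <= t 0 j) /\ \sum_j t 0 j <= 1]%classic]%classic.
  have [[w wmax ->]|NT] := pselect (exists2 w, tight_max pt D h w & T = tight pt D h w).
    by have [n nP] := cells w wmax; exists n.
  by exists 0 => /NT.
have /boolp.choice[normal normalP] := Nn.
(* Several cells may share a facet of [P] and thus a normal; duplicates are removed to obtain one
   inequality per facet. *)
pose N := undup [seq normal T | T <- enum {set quartic_monomial}
  & `[< exists2 w, tight_max pt D h w & T = tight pt D h w >]].
have NP n : n \in N -> exists2 w, tight_max pt D h w & n = normal (tight pt D h w).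
  rewrite mem_undup => /mapP[T]; rewrite mem_filter => /andP[/asboolP[w wmax ->] _ ->].
  by exists w.
apply: (@reflexive_of_cells _ _ pt D N) => //.
- exact: undup_uniq.
- move=> n /NP[w wmax ->]; have [|//] := normalP (tight pt D h w); by exists w.
- move=> n y /NP[w wmax ->] yD; have [|B _ [[Bu nB _] wB]] := normalP (tight pt D h w).
    by exists w.
  exact: (central_cell_normal_valid c_central wmax Bu nB wB yD).
- move=> n /NP[w wmax ->]; have [|B _ [nB _]] := normalP (tight pt D h w); first by exists w.
  by exists B.
move=> y /(tight_max_cover h)[w wmax].
have [|B _ [nB ->] [t [t0 t1] yE]] := normalP (tight pt D h w); first by exists w.
exists (normal (tight pt D h w)), B, t; split=> //.
rewrite mem_undup; apply: map_f; rewrite mem_filter mem_enum andbT.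
by apply/asboolP; exists w.
Qed.

(** * Heights inducing a central unimodular triangulation *)

(** The perturbation is [t^(rank + 1)] with [t = 1 / (k + 2)]. The exponents are positive and
    distinct, so the fixed part [g] cannot cancel a coefficient, and each condition excludes only
    finitely many [t]. *)
Lemma generic_perturbation (R : realFieldType) (I J : finType) (P : pred J)
    (b : J -> I -> R) (g : I -> R) :
  (forall j, P j -> exists i, b j i != 0) ->
  exists2 e : I -> R, forall i, 0 <= e i < 1 &
    forall j, P j -> \sum_i b j i * (g i + e i) != 0.
Proof.
move=> bP.
pose Q j : {poly R} := \sum_i b j i *: ((g i)%:P + 'X^((enum_rank i).+1)).
have Q0 j : P j -> Q j != 0.
  move=> /bP[i bi]; apply: contraNneq bi => /(congr1 (coefp (enum_rank i).+1))/=.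
  rewrite coef0 coef_sum (bigD1 i)//= coefZ coefD coefC coefXn eqxx add0r mulr1 => <-.
  rewrite big1 ?addr0// => k ki.
  rewrite coefZ coefD coefC coefXn eqSS add0r (_ : _ == _ = false) ?mulr0//.
  by apply: contraNF ki => /eqP/val_inj/enum_rank_inj->.
have [||t] := @injective_nonroot R (\prod_(j | P j) Q j) (fun t : nat => (t.+2)%:R^-1).
- by move=> s t /invr_inj/eqP; rewrite eqr_nat => /eqP[].
- by apply/prodf_neq0.
rewrite /root horner_prod => /prodf_neq0 Qt.
exists (fun i => t.+2%:R^-1 ^+ (enum_rank i).+1) => [i|j /Qt].
  by rewrite exprn_ge0 ?invr_ge0// exprn_ilt1 ?invr_ge0// invf_lt1// ltr1n.
rewrite horner_sum; apply: contra => /eqP E; apply/eqP; rewrite -[RHS]E.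
by apply: eq_bigr => i _; rewrite hornerZ hornerD hornerC hornerXn.
Qed.

Lemma int_pt_dist_ge1 (R : realType) (u v : 'rV[int]_3) : u != v ->
  1 <= dot (int_pt R u - int_pt R v) (int_pt R u - int_pt R v).
Proof.
move=> uv; have -> : int_pt R u - int_pt R v = int_pt R (u - v).
  by apply/rowP => j; rewrite !mxE rmorphB.
have E : dot (int_pt R (u - v)) (int_pt R (u - v)) =
    (\sum_k (u - v) 0 k * (u - v) 0 k)%:~R.
  by rewrite rmorph_sum; apply: eq_bigr => k _; rewrite !mxE rmorphM.
have d0 : dot (int_pt R (u - v)) (int_pt R (u - v)) != 0.
  apply: contraNneq uv => /dot_eq0 /rowP d0; apply/eqP/rowP => j.
  by have /eqP := d0 j; rewrite !mxE intr_eq0 subr_eq0 => /eqP.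
have : 0 < dot (int_pt R (u - v)) (int_pt R (u - v)) by rewrite lt_def d0 dot_ge0.
by rewrite E ltr0z -[1]/(1%:~R) ler_int.
Qed.

(** The parallel axis identity of Huygens and Steiner; it measures how far the lifted paraboloid
    lies below its chords. *)
Lemma dot_dist_center (R : realType) n (J : finType) (t : J -> R) (v : J -> 'rV[R]_n) u :
  \sum_j t j = 1 -> u = \sum_j t j *: v j ->
  \sum_j t j * dot (v j) (v j) = dot u u + \sum_j t j * dot (v j - u) (v j - u).
Proof.
move=> t1 uE.
have -> : \sum_j t j * dot (v j - u) (v j - u) =
    \sum_j t j * dot (v j) (v j) - 2 * dot u (\sum_j t j *: v j) + dot u u.
  have -> : dot u u = \sum_j t j * dot u u by rewrite -mulr_suml t1 mul1r.
  rewrite dot_sumr mulr_sumr -sumrB -big_split/=.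
  by apply: eq_bigr => j _; rewrite dotBl !dotBr (dotC (v j) u)/=; ring.
by rewrite -uE; ring.
Qed.

Lemma int_geN1_neqN1 (a : int) : a != -1 -> -1 <= a -> 0 <= a.
Proof. lia. Qed.

Lemma hull_combination (R : realType) n (I J : finType) (pt : I -> 'rV[R]_n) (T : {set I})
    (f : J -> I) (t : J -> R) :
  (forall j, f j \in T) -> (forall j, 0 <= t j) -> \sum_j t j = 1 ->
  hull pt T (\sum_j t j *: pt (f j)).
Proof.
move=> fT t0 t1; have [//|[v vT vy]] := hull_farkas pt T (\sum_j t j *: pt (f j)).
move: vy; rewrite affine_eval_conv// ltNge sumr_ge0// => j _.
by rewrite mulr_ge0// vT.
Qed.

Section CentralHeights.
Local Open Scope classical_set_scope.
Variables (R : realType) (D : {set quartic_monomial}) (k : nat) (n : 'I_k -> 'rV[int]_3).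
Variable mp : quartic_monomial.
Local Notation pt := (@lpoint R).
Local Notation p := (const_mx 1 : 'rV[R]_3).
Local Notation nR i := (int_pt R (n i)).
Hypotheses (mpD : mp \in D) (ptmp : pt mp = p).
Hypothesis half_spaces : forall y, hull pt D y <-> forall i, -1 <= dot (nR i) (y - p).
Hypothesis D_lattice : forall q, hull pt D (int_pt R q) -> exists2 m, m \in D & pt m = int_pt R q.
Hypothesis D_spanning : affinely_spanning pt D.

(* [2 * |v|^2] makes the lattice points of a facet a strictly convex configuration with a
   margin larger than the perturbation [e]; the last term pulls the centre far down. *)
Section Heights.
Variable e : quartic_monomial -> R.
Hypothesis e01 : forall m, 0 <= e m < 1.

Definition base_height m := 2 * dot (pt m) (pt m) + e m.
Definition base_bound := \sum_m (2 * dot (pt m) (pt m) + 1).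
(** The factor is one more than the number of monomials, so that the share [1 - l] of the depth in
    [tight_facet] still exceeds the bound of the base heights. *)
Definition depth : R := #|{: quartic_monomial}|.+1%:R * (base_bound + 1).
Definition central_height m := base_height m + depth * (m != mp)%:R.
Local Notation h := central_height.

Lemma base_height_ge0 m : 0 <= base_height m.
Proof. by have /andP[? _] := e01 m; rewrite addr_ge0// mulr_ge0// dot_ge0. Qed.

Lemma base_height_le m : base_height m <= base_bound.
Proof.
have t0 i : 0 <= 2 * dot (pt i) (pt i) + 1 by rewrite addr_ge0// mulr_ge0// dot_ge0.
rewrite /base_bound (bigD1 m)//= /base_height -addrA lerD2l ler_wpDr ?sumr_ge0//.
by rewrite ltW//; have /andP[] := e01 m.
Qed.

Lemma base_bound_ge0 : 0 <= base_bound.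
Proof. by apply: le_trans (base_height_le mp); apply: base_height_ge0. Qed.

Lemma depth_gt0 : 0 < depth.
Proof. by rewrite mulr_gt0// ltr_wpDl// base_bound_ge0. Qed.

Variable w : 'cV[R]_(3 + 1).
Hypothesis wmax : tight_max pt D h w.
Local Notation T := (tight pt D h w).

Lemma tight_in_D m : m \in T -> m \in D. Proof. by move=> /tightP[]. Qed.

Lemma tight_spanning : affinely_spanning pt T.
Proof. exact: tight_max_spanning. Qed.

Lemma tight_noncentral : exists2 m, m \in T & m != mp.
Proof.
apply: contrapT => noT.
have : col_mx (delta_mx 0 0 : 'rV[R]_3)^T (-1)%:M = 0 :> 'cV_(3 + 1).
  apply: tight_spanning => m mT; have [->|mmp] := eqVneq m mp.
    by rewrite ptmp affine_eval_dot dotC dot_delta mxE subrr.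
  by case: noT; exists m.
by move=> /(congr1 (fun M : 'cV_(3 + 1) => M (rshift 3 0) 0))/eqP; rewrite col_mxEd !mxE oppr_eq0 oner_eq0.
Qed.

(** Otherwise let [z] be the barycentre of the noncentral tight points. On each facet inequality
    some of these points has value at least 0, by integrality, so [z] stays away from the boundary:
    [z = (1 - l) p + l y] with [y] in the polytope. Then [w] is at least [depth] at [z], where only
    noncentral points enter, but at most [base_bound + l * depth], because it is at most
    [base_bound] at [p]. *)
Lemma tight_facet : exists i, forall m, m \in T -> m != mp -> dot (nR i) (pt m - p) = -1.
Proof.
pose S := [set m in T | m != mp]%SET; pose s : R := #|S|%:R.
have [m0 m0T m0p] := tight_noncentral.
have S0 : (0 < #|S|)%N by apply/card_gt0P; exists m0; rewrite inE m0T.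
have s0 : 0 < s by rewrite ltr0n.
have sK : s <= #|{: quartic_monomial}|%:R by rewrite ler_nat max_card.
pose t m := if m \in S then s^-1 else 0.
have tsum (F : quartic_monomial -> R) : \sum_m t m * F m = s^-1 * \sum_(m in S) F m.
  rewrite mulr_sumr [RHS]big_mkcond; apply: eq_bigr => m _.
  by rewrite /t; case: ifP => _; rewrite ?mul0r.
have t1 : \sum_m t m = 1.
  have := tsum (fun=> 1); under eq_bigr do rewrite mulr1.
  by move=> ->; rewrite sumr_const -/s mulVf ?gt_eqF.
pose z := \sum_m t m *: pt m.
have zT : hull pt T z.
  exists t; split=> // m; first by rewrite /t; case: ifP => // _; rewrite invr_ge0 ltW.
  by move=> mT; rewrite /t ifN//; apply: contraNN mT; rewrite inE => /andP[].
apply: contrapT => /forallNP noi.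
pose l : R := #|{: quartic_monomial}|%:R / #|{: quartic_monomial}|.+1%:R.
have l0 : 0 < l by rewrite divr_gt0//; apply: lt_le_trans sK.
have l1 : l < 1 by rewrite ltr_pdivrMr// mul1r ltr_nat.
have lE : 1 - l = #|{: quartic_monomial}|.+1%:R^-1.
  by rewrite /l -natr1; field; rewrite natr1 pnatr_eq0.
pose y := p + l^-1 *: (z - p).
have yD : hull pt D y.
  apply/half_spaces => i; rewrite addrAC subrr add0r dotZr mulrC ler_pdivlMr// mulN1r.
  have zi : dot (nR i) (z - p) = s^-1 * \sum_(m in S) dot (nR i) (pt m - p).
    have -> : z - p = \sum_m t m *: (pt m - p).
      by under eq_bigr do rewrite scalerBr; rewrite sumrB -scaler_suml t1 scale1r.
    by rewrite dot_sumr tsum.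
  have vZ m : m \in S -> exists2 a : int, dot (nR i) (pt m - p) = a%:~R & -1 <= a.
    rewrite inE => /andP[/tight_in_D mD _].
    rewrite lpointE -int_pt_center dot_int_pt; eexists; first by [].
    rewrite -(@ler_int R) -dot_int_pt int_pt_center -lpointE.
    by have /half_spaces := hull_pt pt mD; apply.
  have [m1 m1S m1i] : exists2 m, m \in S & dot (nR i) (pt m - p) != -1.
    apply: contrapT => noS; apply: (noi i) => m mT mmp; apply/eqP/negPn/negP => mi.
    by apply: noS; exists m => //; rewrite inE mT.
  have ge1 m : m \in S -> -1 <= dot (nR i) (pt m - p).
    by move=> /vZ[a ->]; rewrite -(@ler_int R).
  have ge0 : 0 <= dot (nR i) (pt m1 - p).
    have [a aE a1] := vZ _ m1S; move: m1i; rewrite aE ler0z -[-1]/((-1)%:~R) eqr_int.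
    by move=> /int_geN1_neqN1; apply.
  have : 1 - s <= \sum_(m in S) dot (nR i) (pt m - p).
    rewrite (big_setD1 m1 m1S)/= -[leLHS]add0r lerD// /s (cardsD1 m1) m1S natrD opprD addNKr.
    rewrite -sumr_const -sumrN; apply: ler_sum => m; rewrite in_setD1 => /andP[_ mS].
    exact: ge1.
  rewrite zi -(ler_pM2l (_ : 0 < s^-1)) ?invr_gt0// mulrBr mulr1 mulVf ?gt_eqF//.
  have : #|{: quartic_monomial}|.+1%:R^-1 <= s^-1.
    by rewrite lef_pV2 ?posrE// (le_trans sK)// ler_nat.
  by move=> h1 /(le_trans _); apply; rewrite lerBrDl -[1 + - l]/(1 - l) lE.
have wz : affine_eval w z = \sum_m t m * h m.
  rewrite /z affine_eval_conv//; apply: eq_bigr => m _; rewrite /t; case: ifP; rewrite ?mul0r//.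
  by rewrite inE => /andP[/tightP[_ ->]].
have zge : depth <= affine_eval w z.
  rewrite wz -[leLHS]mul1r -t1 mulr_suml; apply: ler_sum => m _; rewrite /t.
  case: ifP; rewrite ?mul0r// inE => /andP[_ mmp].
  by rewrite ler_wpM2l ?invr_ge0 ?(ltW s0)// /central_height mmp mulr1 -lerBlDr subrr base_height_ge0.
have yle : affine_eval w y <= base_bound + depth.
  have [r [r0 rD r1 ->]] := yD; rewrite affine_eval_conv// -[leRHS]mul1r -r1 mulr_suml.
  apply: ler_sum => m _; have [mD|/rD ->] := boolP (m \in D); last by rewrite !mul0r.
  rewrite ler_wpM2l//; apply: le_trans (wmax.1 m mD) _.
  rewrite lerD ?base_height_le// -[leRHS]mulr1 ler_wpM2l ?(ltW depth_gt0)//.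
  by case: (_ != _).
have ple : affine_eval w p <= base_bound.
  rewrite -ptmp; apply: le_trans (wmax.1 mp mpD) _.
  by rewrite /central_height eqxx mulr0 addr0 base_height_le.
have zE : affine_eval w z = (1 - l) * affine_eval w p + l * affine_eval w y.
  rewrite /y !affine_eval_dotE dotDr dotZr dotBr; field.
  by rewrite gt_eqF.
have : (1 - l) * depth <= base_bound.
  have : l * affine_eval w y <= l * (base_bound + depth) by rewrite ler_pM2l.
  have : (1 - l) * affine_eval w p <= (1 - l) * base_bound by rewrite ler_pM2l ?subr_gt0.
  by move: zge; rewrite zE; lra.
by rewrite lE /depth mulKf ?pnatr_eq0//; lra.
Qed.

(** The noncentral tight points lie in one plane, whereas all tight points together span
    affinely. *)
Lemma center_tight : mp \in T.
Proof.
have [i iT] := tight_facet; apply/negPn/negP => mpT.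
have v0 : col_mx (nR i)^T (1 - dot (nR i) p)%:M = 0 :> 'cV_(3 + 1).
  apply: tight_spanning => m mT; rewrite affine_eval_dot.
  have := iT m mT; rewrite dotBr => /(_ _)E.
  by rewrite addrCA E ?subrr//; apply: contraNneq mpT => <-.
have := congr1 (fun v => affine_eval v p) v0; rewrite affine_eval_dot subrKC.
by rewrite /affine_eval mulmx0 mxE => /eqP; rewrite oner_eq0.
Qed.

Lemma central_tight_vertex : is_vertex (hull pt T) p.
Proof.
have [i iT] := tight_facet.
have terms m : m \in T -> m != mp -> dot (- nR i) (pt m) = dot (- nR i) p + 1.
  move=> mT mmp; have := iT m mT mmp; rewrite dotBr -[- nR i]sub0r !dotBl !dot0l; lra.
exists (- nR i), (dot (- nR i) p).
have ge t : (forall m, 0 <= t m) -> (forall m, m \notin T -> t m = 0) -> \sum_m t m = 1 ->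
    dot (- nR i) (\sum_m t m *: pt m) = dot (- nR i) p + \sum_(m | m != mp) t m.
  move=> t0 tT t1; rewrite dot_sumr (bigD1 mp)//= ptmp.
  rewrite (eq_bigr (fun m => t m * dot (- nR i) p + t m)) => [|m mmp]; last first.
    have [mT|/tT ->] := boolP (m \in T); last by rewrite !mul0r addr0.
    by rewrite terms// mulrDr mulr1.
  by rewrite big_split/= addrA -mulr_suml -mulrDl -(bigD1 mp (P := predT))//= t1 mul1r.
split=> [x [t [t0 tT t1 ->]]|]; first by rewrite ge// lerDl sumr_ge0.
apply/seteqP; split=> x /=.
  by move=> ->; split=> //; rewrite -ptmp; apply: hull_pt center_tight.
move=> [[t [t0 tT t1 ->]]]; rewrite ge// => /eqP; rewrite -subr_eq0 addrAC subrr add0r => /eqP/psumr_eq0P tz.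
rewrite (bigD1 mp)//= big1 => [|m mmp]; last by rewrite tz ?scale0r.
rewrite addr0 ptmp; move: t1; rewrite (bigD1 mp)//= big1 => [|m mmp]; last by rewrite tz.
by rewrite addr0 => ->; rewrite scale1r.
Qed.

Definition affine_dependency (T : {set quartic_monomial}) (b : quartic_monomial -> R) :=
  (forall m, m \notin T -> b m = 0) /\ forall v, \sum_m b m * affine_eval v (pt m) = 0.

Hypothesis e_generic : forall T,
  (exists2 b, affine_dependency T b & exists m, b m != 0) ->
  exists2 b, affine_dependency T b & \sum_m b m * h m != 0.

(** On the tight points the heights are values of one affine function and satisfy every affine
    dependency, which genericity excludes for a dependent set. *)
Lemma tight_independent b : affine_dependency T b -> forall m, b m = 0.
Proof.
move=> bT m; apply/eqP/negPn/negP => bm.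
have [|b' [b'T b'v]] := @e_generic T; first by exists b => //; exists m.
case/eqP; rewrite -[RHS](b'v w); apply: eq_bigr => i _.
by have [/tightP[_ ->]|/b'T ->] := boolP (i \in T); rewrite ?mul0r.
Qed.

Lemma tight_orthogonal u : (forall m, m \in T -> dot u (pt m - p) = 0) -> u = 0.
Proof.
move=> uT; have /(congr1 usubmx) : col_mx u^T (- dot u p)%:M = 0 :> 'cV_(3 + 1).
  by apply: tight_spanning => m /uT; rewrite affine_eval_dot dotBr.
by rewrite col_mxKu => /(congr1 trmx); rewrite trmxK => ->; apply/rowP => j; rewrite !mxE.
Qed.

(** The differences from [p] of the noncentral tight points are independent by genericity and
    spanning by maximality; hence there are three of them. *)
Lemma tight_simplex : exists f : 'I_3 -> quartic_monomial,
  [/\ forall m, (m \in T) = (m == mp) || [exists j, f j == m], forall j, f j != mp &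
    \matrix_j (pt (f j) - p) \in unitmx].
Proof.
pose S := [set m in T | m != mp]%SET.
have ST m : m \in S = (m \in T) && (m != mp) by rewrite inE.
have TS m : m \in T -> m = mp \/ m \in S.
  by rewrite ST => ->; have [->|] := eqVneq m mp; [left | right].
pose C : 'M[R]_(#|S|, 3) := \matrix_i (pt (enum_val i) - p).
have Cfree : row_free C.
  rewrite -kermx_eq0; apply/eqP/row_matrixP => i; rewrite row0.
  have /sub_kermxP := row_sub i (kermx C); set u := row i _ => uC.
  have eT (j : 'I_#|S|) : enum_val j \in T by have := enum_valP j; rewrite ST => /andP[].
  pose b m := \sum_j u 0 j * ((enum_val j == m)%:R - (mp == m)%:R).
  have bE F : \sum_m b m * F m = \sum_j u 0 j * (F (enum_val j) - F mp).
    under eq_bigr do rewrite mulr_suml.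
    rewrite exchange_big; apply: eq_bigr => j _.
    under eq_bigr do rewrite -mulrA mulrBl.
    rewrite -mulr_sumr sumrB (bigD1 (enum_val j))//= eqxx mul1r big1 ?addr0.
      rewrite [X in _ - X](bigD1 mp)//= eqxx mul1r big1 ?addr0// => m.
      by rewrite eq_sym => /negPf ->; rewrite mul0r.
    by move=> m; rewrite eq_sym => /negPf ->; rewrite mul0r.
  have /tight_independent b0 : affine_dependency T b.
    split=> [m mT|v].
      have -> : b m = \sum_j u 0 j * (0 - 0); last by rewrite subrr big1// => j _; rewrite mulr0.
      have mpm : (mp == m) = false by apply: contraNF mT => /eqP <-; apply: center_tight.
      apply: eq_bigr => j _; rewrite mpm.
      by have -> : (enum_val j == m) = false by apply: contraNF mT => /eqP <-.
    rewrite bE; have : dot (usubmx v)^T (u *m C) = 0 by rewrite uC dotC dot0l.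
    rewrite dot_mulmx => uC0; rewrite -[RHS]uC0; apply: eq_bigr => j _; rewrite rowK dotBr ptmp.
    by rewrite !affine_eval_dotE; congr (_ * _); ring.
  apply/rowP => j; rewrite [RHS]mxE -(b0 (enum_val j)) /b (bigD1 j)//= eqxx.
  rewrite (_ : mp == _ = false); last first.
    by have := enum_valP j; rewrite ST eq_sym => /andP[_ /negPf].
  rewrite subr0 mulr1 big1 ?addr0// => l lj.
  by rewrite (inj_eq enum_val_inj) (negPf lj) subrr mulr0.
have dotC_row j u : (u *m C^T) 0 j = dot u (pt (enum_val j) - p).
  by rewrite mxE; apply: eq_bigr => l _; rewrite !mxE.
have Cfull : row_full C.
  rewrite /row_full -mxrank_tr -/(row_free C^T).
  rewrite -kermx_eq0; apply/eqP/row_matrixP => i; rewrite row0.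
  have /sub_kermxP := row_sub i (kermx C^T); set u := row i _ => uC.
  apply: tight_orthogonal => m /TS[->|mS]; first by rewrite ptmp subrr dotC dot0l.
  by rewrite -(enum_rankK_in mS mS) -dotC_row uC mxE.
have S3 : #|S| = 3%N.
  by have := Cfree; rewrite /row_free => /eqP r; have := Cfull; rewrite /row_full r => /eqP.
exists (fun j => enum_val (cast_ord (esym S3) j)).
have fS j : enum_val (cast_ord (esym S3) j) \in S by apply: enum_valP.
split.
- move=> m; apply/idP/idP => [/TS[->|mS]|]; first by rewrite eqxx.
    apply/orP; right; apply/existsP; exists (cast_ord S3 (enum_rank_in mS m)).
    by rewrite cast_ordK enum_rankK_in.
  case/orP => [/eqP->|/existsP[j /eqP <-]]; first exact: center_tight.
  by have := fS j; rewrite ST => /andP[].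
- by move=> j; have := fS j; rewrite ST => /andP[].
rewrite -unitmx_tr -row_free_unit -kermx_eq0; apply/eqP/row_matrixP => i; rewrite row0.
set B := (\matrix_j _)^T; have /sub_kermxP := row_sub i (kermx B); set u := row i _ => uB.
apply: tight_orthogonal => m /TS[->|mS]; first by rewrite ptmp subrr dotC dot0l.
rewrite -(enum_rankK_in mS mS) -[enum_rank_in _ _](cast_ordK S3).
have <- : (u *m B) 0 (cast_ord S3 (enum_rank_in mS m)) = 0 by rewrite uB mxE.
by rewrite mxE; apply: eq_bigr => l _; rewrite !mxE.
Qed.

Section Simplex.
Variable f : 'I_3 -> quartic_monomial.
Hypothesis fT : forall j, f j \in T.
Hypothesis f_noncentral : forall j, f j != mp.
Local Notation B := (\matrix_j (pt (f j) - p)).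
Hypothesis B_unit : B \in unitmx.

(** Another lattice point [m] of the triangle has distance at least 1 from the corners. By
    [dot_dist_center] the lifted triangle then passes over it at height at least
    [2 |m|^2 + 2 + depth], more than its own height with the perturbation below 1, so [w] would not
    be feasible. *)
Lemma facet_triangle_empty (q : 'rV[int]_3) (t : 'rV[R]_3) :
  (forall j, 0 <= t 0 j) -> \sum_j t 0 j = 1 -> int_pt R q = p + t *m B ->
  exists j, t = delta_mx 0 j.
Proof.
move=> t0 t1 qB.
have qE : int_pt R q = \sum_j t 0 j *: pt (f j).
  rewrite qB mulmx_sum_row; under eq_bigr do rewrite rowK scalerBr.
  by rewrite sumrB -scaler_suml t1 scale1r subrKC.
have qT : hull pt T (int_pt R q) by rewrite qE; apply: hull_combination.
have [m mD mq] : exists2 m, m \in D & pt m = int_pt R q.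
  by apply: D_lattice; apply: hullS qT; apply/fintype.subsetP => m /tight_in_D.
have [/existsP[j /eqP fj]|/existsPn fm] := boolP [exists j, f j == m].
  exists j; apply: (can_inj (mulmxK B_unit)); apply: (addrI p).
  by rewrite -qB -rowE rowK fj mq subrKC.
exfalso.
have dist j : 1 <= dot (pt (f j) - pt m) (pt (f j) - pt m).
  rewrite (lpointE _ (f j)) (lpointE _ m); apply: int_pt_dist_ge1.
  by apply: contra (fm j) => /eqP E; apply/eqP/(@lpoint_inj R); rewrite !lpointE E.
have : \sum_j t 0 j * h (f j) <= h m.
  have -> : \sum_j t 0 j * h (f j) = affine_eval w (pt m).
    rewrite mq qE affine_eval_conv//; apply: eq_bigr => j _.
    by have [_ ->] := tightP _ _ _ _ _ (fT j).
  by apply: wmax.1.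
have : h m <= base_height m + depth.
  by rewrite lerD2l -[leRHS]mulr1 ler_wpM2l ?(ltW depth_gt0)//; case: (_ != _).
have -> : \sum_j t 0 j * h (f j) =
    2 * \sum_j t 0 j * dot (pt (f j)) (pt (f j)) + \sum_j t 0 j * e (f j) + depth.
  have -> : depth = \sum_j t 0 j * depth by rewrite -mulr_suml t1 mul1r.
  rewrite mulr_sumr -!big_split/=; apply: eq_bigr => j _.
  by rewrite /central_height f_noncentral mulr1 /base_height; ring.
rewrite (dot_dist_center t1 (etrans mq qE)).
have : 1 <= \sum_j t 0 j * dot (pt (f j) - pt m) (pt (f j) - pt m).
  by rewrite -[leLHS]t1; apply: ler_sum => j _; rewrite -[leLHS]mulr1 ler_wpM2l.
have : 0 <= \sum_j t 0 j * e (f j).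
  by apply: sumr_ge0 => j _; rewrite mulr_ge0//; have /andP[] := e01 (f j).
have /andP[_] := e01 m; rewrite /base_height; lra.
Qed.

Let z (m : quartic_monomial) : 'rV[int]_3 := \row_j (val m (widen_ord (leqnSn 3) j))%:Z.
Let M : 'M[int]_3 := \matrix_j (z (f j) - const_mx 1).

Let ME : map_mx intr M = B.
Proof. by apply/matrixP => i j; rewrite !mxE rmorphB. Qed.

(* The fractional parts of the coordinates of a lattice point have integral sum [0], [1] or
   [2]; by symmetry, [1] and [2] would both give a nontrivial lattice point in the triangle. *)
Lemma facet_triangle_integral (q : 'rV[int]_3) (t : 'rV[R]_3) :
  t *m B = int_pt R q -> forall j, exists a : int, t 0 j = a%:~R.
Proof.
move=> tq; pose fl : 'rV[int]_3 := \row_j Num.floor (t 0 j).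
pose r := t - int_pt R fl; pose q' := q - fl *m M.
have int_ptM (u : 'rV[int]_3) : int_pt R (u *m M) = int_pt R u *m B.
  by rewrite /int_pt map_mxM ME.
have int_ptB (u v : 'rV[int]_3) : int_pt R (u - v) = int_pt R u - int_pt R v.
  by rewrite /int_pt map_mxB.
have int_ptD (u v : 'rV[int]_3) : int_pt R (u + v) = int_pt R u + int_pt R v.
  by rewrite /int_pt map_mxD.
have rE j : r 0 j = t 0 j - (Num.floor (t 0 j))%:~R by rewrite !mxE.
have r01 j : 0 <= r 0 j < 1.
  have /andP[fl1 fl2] := Num.Theory.floor_itv (t 0 j).
  by rewrite rE subr_ge0 fl1 ltrBlDl -[1]/(1%:~R) -rmorphD.
have rq : r *m B = int_pt R q' by rewrite mulmxBl tq int_ptB int_ptM.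
have [i iT] := tight_facet.
(* The facet normal takes the value -1 on each row of [B], so minus the sum of the coordinates is
   its value at the lattice point [q']. *)
have [s sE] : exists s : int, \sum_j r 0 j = s%:~R.
  exists (- \sum_k n i 0 k * (q' 0 k - (0 : 'rV[int]_3) 0 k)); rewrite rmorphN.
  have := dot_int_pt R (n i) q' 0; rewrite (_ : int_pt R 0 = 0); last by apply/rowP => j; rewrite !mxE.
  rewrite subr0 -rq dot_mulmx.
  under eq_bigr do rewrite rowK iT// mulrN1.
  rewrite sumrN => /(canRL opprK) ->; congr (- _).
have s0 : 0 <= s by rewrite -(ler0z R) -sE sumr_ge0// => j _; have /andP[] := r01 j.
have s3 : s < 3.
  rewrite -(ltr_int R) -sE; have -> : 3%:~R = \sum_(j < 3) 1 :> R by rewrite sumr_const card_ord.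
  apply: ltr_sum => [|j _]; last by have /andP[] := r01 j.
  by apply/hasP; exists ord0; rewrite ?mem_index_enum.
have : r = 0.
  have [s_eq|[s_eq|s_eq]] : s = 0 \/ s = 1 \/ s = 2 by move: s0 s3; clear; lia.
  - move: sE; rewrite s_eq => /eqP; rewrite psumr_eq0 => [/allP r0|j _]; last by have /andP[] := r01 j.
    by apply/rowP => j; rewrite [RHS]mxE; apply/eqP/r0; rewrite mem_index_enum.
  - have [|||j rj] := @facet_triangle_empty (const_mx 1 + q') r.
    + by move=> j; have /andP[] := r01 j.
    + by rewrite sE s_eq.
    + by rewrite int_ptD int_pt_center rq.
    by have /andP[_] := r01 j; rewrite rj mxE !eqxx ltxx.
  have r'E j : (const_mx 1 - r) 0 j = 1 - r 0 j by rewrite [LHS]mxE [(- r) 0 j]mxE [const_mx _ _ _]mxE.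
  have [|||j rj] := @facet_triangle_empty (const_mx 1 + (const_mx 1 *m M - q')) (const_mx 1 - r).
  - by move=> j; rewrite r'E subr_ge0; have /andP[_ /ltW] := r01 j.
  - under eq_bigr do rewrite r'E.
    by rewrite sumrB sE s_eq sumr_const card_ord; lra.
  - by rewrite int_ptD int_ptB int_ptM int_pt_center mulmxBl rq.
  pose l : 'I_3 := if j == ord0 then ord_max else ord0.
  have lj : l != j by rewrite /l; case: ifP => [/eqP-> //|/negbT]; rewrite eq_sym.
  have /andP[_] := r01 l; have := r'E l; rewrite rj mxE (negPf lj) andbF.
  by move=> /eqP; rewrite eq_sym subr_eq0 => /eqP <-; rewrite ltxx.
move=> r0 j; exists (Num.floor (t 0 j)); apply/eqP; rewrite -subr_eq0 -rE r0.
by rewrite mxE.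
Qed.

(** The standard basis vectors have integral coordinates in the rows of [B], so the inverse of [B]
    is integral too. *)
Lemma facet_triangle_unimodular : `|\det M|%N = 1%N.
Proof.
have a_int i j : exists x : int, invmx B i j = x%:~R.
  have [|x xE] := @facet_triangle_integral (delta_mx 0 i) (row i (invmx B)) _ j.
    by rewrite -row_mul mulVmx//; apply/rowP => l; rewrite !mxE eqxx/= eq_sym; case: eqP.
  by exists x; rewrite -xE mxE.
have /boolp.choice[X XE] : forall ij : 'I_3 * 'I_3, exists x : int, invmx B ij.1 ij.2 = x%:~R.
  by move=> [i j]; apply: a_int.
pose Y : 'M[int]_3 := \matrix_(i, j) X (i, j).
have YM : Y *m M = 1%:M.
  have E : map_mx intr (Y *m M) = 1%:M :> 'M[R]_3.
    rewrite map_mxM ME (_ : map_mx _ Y = invmx B) ?mulVmx//.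
    by apply/matrixP => i j; rewrite [LHS]mxE [Y i j]mxE; apply/esym/(XE (i, j)).
  apply/matrixP => i j; apply: (@intr_inj R).
  by have := congr1 (fun A : 'M_3 => A i j) E; rewrite mxE => ->; rewrite !mxE; case: (i == j).
have /(congr1 absz) := congr1 determinant YM; rewrite det_mulmx det1 abszM => /eqP.
by rewrite muln_eq1 => /andP[_ /eqP].
Qed.

End Simplex.

Lemma tight_unimodular : unimodular_simplex (hull pt T).
Proof.
have [f [Tf f_noncentral Bu]] := tight_simplex.
have fT j : f j \in T by rewrite Tf; apply/orP; right; apply/existsP; exists j.
have := facet_triangle_unimodular fT f_noncentral Bu.
set M := \matrix_j _ => M1.
pose V : 'M[int]_(4, 3) := \matrix_i (if unlift ord0 i is Some j then
  \row_l (val (f j) (widen_ord (leqnSn 3) l))%:Z else const_mx 1).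
have V0 : int_pt R (row ord0 V) = pt mp by rewrite rowK unlift_none int_pt_center.
have VS j : int_pt R (row (lift ord0 j) V) = pt (f j) by rewrite rowK liftK lpointE.
exists V; split.
  rewrite -conv_hull_finite; congr conv_hull; apply/seteqP; split=> x.
    move=> [m /=]; rewrite Tf => /orP[/eqP->|/existsP[j /eqP <-]] <-; first by exists ord0.
    by exists (lift ord0 j).
  move=> [i _ <-]; have [j ->|->] := unliftP ord0 i; first by exists (f j) => //=; apply: fT.
  by exists mp => //=; apply: center_tight.
rewrite /normalized_volume -[RHS]M1; congr (absz (\det _)); apply/matrixP => i j.
by rewrite !mxE unlift_none liftK !mxE.
Qed.

End Heights.
End CentralHeights.

(** * Boundedness of the central region *)

Section BoundedComponent.
Local Open Scope classical_set_scope.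
Variables (R : realType) (c : quartic_monomial -> \bar R).
Local Notation pt := (@lpoint R).
Local Notation D := (support_set c).
Hypothesis c_Noo : forall m, c m != -oo%E.
Variable m0 : quartic_monomial.
Hypothesis m0D : m0 \in D.

Let gap m x := dot (pt m - pt m0) x + (fine (c m) - fine (c m0)).

Lemma gapE m x : m \in D ->
  ((trop_term c x m0 <= trop_term c x m)%E = (0 <= gap m x)) *
  ((trop_term c x m0 < trop_term c x m)%E = (0 < gap m x)).
Proof.
move=> mD; rewrite !trop_termE// lee_fin lte_fin /gap dotBl.
by split; [rewrite -subr_ge0 | rewrite -subr_gt0]; congr (_ _ _ _); ring.
Qed.

Lemma dot_continuous n (a : 'rV[R]_n) : continuous (dot a).
Proof.
apply: (@continuous_big R _ _ _ _ (@add_continuous R)) => j _ x.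
have jx : {for x, continuous (fun y : 'rV[R]_n => y 0 j)} by exact: coord_continuous.
exact: (continuousM (@cst_continuous _ _ (a 0 j) x) jx).
Qed.

Lemma gap_continuous m : continuous (gap m).
Proof. by move=> x; apply: continuousD; [exact: dot_continuous | exact: cst_continuous]. Qed.

(** The region of [m0] is open, and it is closed in the complement of the surface because there a
    weak minimum is already strict; so it contains the connected component. *)
Lemma strict_min_component x : strict_min c x m0 ->
  connected_component (~` trop_surface c) x `<=` [set y | strict_min c y m0].
Proof.
move=> x0; set C := connected_component _ x; set U := [set y | _].
have Cx : C x by apply: connected_component_refl; apply: strict_min_not_surface x0.
suff <- : C `&` U = C by move=> y [].
apply: component_connected; first by exists x.
  exists U => //; rewrite openE => y yU.
  apply: (@filter_forall _ _ (fun m z => m != m0 -> (trop_term c z m0 < trop_term c z m)%E) (nbhs y)) => m.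
  have [mD|/(cPoo c_Noo) cm] := boolP (m \in D); last first.
    by apply: nearW => z _; rewrite trop_termE// /trop_term cm ltey.
  have [->|mm0] := eqVneq m m0; first by apply: nearW => z /eqP.
  have /cvgr_gt/(_ 0) := @gap_continuous m y.
  rewrite -(gapE y mD).2 yU// => /(_ isT); apply: filterS => z /=.
  by rewrite -(gapE z mD).2.
exists (\bigcap_(m in [set` D]) gap m @^-1` [set u | 0 <= u]).
  apply: closed_bigI => m _; apply: preimage_closed; last exact: closed_ge.
  by move=> y _; apply: gap_continuous.
apply/seteqP; split=> y [Cy yU]; split=> //.
  by move=> m mD /=; rewrite -(gapE y mD).1; have [->//|/yU/ltW] := eqVneq m m0.
have [m1 m1D m1y] := not_surface_strict_min c_Noo (connected_component_sub Cy).
have [E|m10] := eqVneq m0 m1; first by rewrite /U E.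
by have := yU m1 m1D; rewrite /= -(gapE y m1D).1 leNgt m1y.
Qed.

(** Minimality of [m0] at [y] bounds [dot (z - pt m0) y] from below for all [z] in the Newton
    polytope. Points [z] displaced from [pt m0] in the positive and negative coordinate directions
    bound each coordinate of [y]. *)
Lemma bounded_component x : alg_interior (trop_newton c) (pt m0) -> strict_min c x m0 ->
  bounded_set (connected_component (~` trop_surface c) x).
Proof.
rewrite trop_newton_hull => m0int /strict_min_component sub.
pose K := \sum_(m in D) `|fine (c m) - fine (c m0)|.
have KP y z : strict_min c y m0 -> hull pt D z -> - K <= dot (z - pt m0) y.
  move=> y0 [t [t0 tD t1 ->]]; rewrite dotC dotBr dot_sumr.
  rewrite -[X in _ - X]mul1r -t1 mulr_suml -sumrB -[K]mul1r -t1 mulr_suml -sumrN.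
  apply: ler_sum => m _; have [mD|/tD ->] := boolP (m \in D); last by rewrite !mul0r subrr oppr0.
  rewrite -mulrBr -mulrN ler_wpM2l// -dotBr dotC.
  have : 0 <= gap m y.
    have [->|/y0] := eqVneq m m0; first by rewrite /gap !subrr dot0l addr0.
    by rewrite (gapE y mD).2 => /ltW.
  have : fine (c m) - fine (c m0) <= K.
    by rewrite (le_trans (ler_norm _))// /K (bigD1 m)//= lerDl sumr_ge0.
  by rewrite /gap; lra.
have [e /all_and2[e0 eP]] : exists e : 'I_3 -> R, forall j, 0 < e j /\
    (hull pt D (pt m0 + e j *: delta_mx 0 j)).
  have /boolp.choice[e eP] : forall j : 'I_3, exists e : R, 0 < e /\ hull pt D (pt m0 + e *: delta_mx 0 j).
    by move=> j; have [e] := m0int (delta_mx 0 j); exists e.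
  by exists e.
have [f /all_and2[f0 fP]] : exists f : 'I_3 -> R, forall j, 0 < f j /\
    (hull pt D (pt m0 + f j *: - delta_mx 0 j)).
  have /boolp.choice[f fP] : forall j : 'I_3, exists f : R, 0 < f /\ hull pt D (pt m0 + f *: - delta_mx 0 j).
    by move=> j; have [f] := m0int (- delta_mx 0 j); exists f.
  by exists f.
pose N := \sum_j (K / e j + K / f j).
have K0 : 0 <= K by apply: sumr_ge0.
exists N; split=> [|M NM y /sub y0 /=]; first exact: num_real.
apply: le_trans (ltW NM); rewrite [leLHS]/Num.norm/= mx_normrE.
apply: bigmax_le => [|[i j] _] /=.
  by apply: sumr_ge0 => j _; rewrite addr_ge0// divr_ge0// ltW.
rewrite ord1; apply: (@le_trans _ _ (K / e j + K / f j)); last first.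
  by rewrite /N (bigD1 j)//= lerDl sumr_ge0// => l _; rewrite addr_ge0// divr_ge0// ltW.
have E := KP _ _ y0 (eP j); have F := KP _ _ y0 (fP j).
have dE s d : dot (pt m0 + s *: d - pt m0) y = s * dot y d.
  by rewrite addrAC subrr add0r dotZl dotC.
move: E F; rewrite !dE dotNr dot_delta => E F.
have Ke : 0 <= K / e j by rewrite divr_ge0// ltW.
have Kf : 0 <= K / f j by rewrite divr_ge0// ltW.
have {}E : - (K / e j) <= y 0 j.
  by rewrite -mulNr ler_pdivrMr// mulrC.
have {}F : y 0 j <= K / f j.
  by rewrite ler_pdivlMr// mulrC -lerN2 -mulrN.
by rewrite ler_norml; apply/andP; split; lra.
Qed.

End BoundedComponent.

Lemma tight_ext (R : realType) n (I : finType) (pt : I -> 'rV[R]_n) (D : {set I}) (h h' : I -> R) w :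
  {in D, h =1 h'} -> tight pt D h w = tight pt D h' w.
Proof.
by move=> hh'; apply/finset.setP => i; rewrite !inE; case: (boolP (i \in D)) => // /hh' ->.
Qed.

Lemma tight_max_ext (R : realType) n (I : finType) (pt : I -> 'rV[R]_n) (D : {set I}) (h h' : I -> R) w :
  {in D, h =1 h'} -> tight_max pt D h w -> tight_max pt D h' w.
Proof.
move=> hh' [wf wmax]; split=> [i iD|w' w'f]; first by rewrite -hh'// wf.
rewrite -!(tight_ext _ _ hh'); apply: wmax => i iD; by rewrite hh'// w'f.
Qed.

Section CentralOfReflexive.
Local Open Scope classical_set_scope.
Variables (R : realType) (P : set 'rV[R]_3).
Hypotheses (P_lattice : lattice_polytope P) (P_sub : P `<=` @simplex4 R).
Local Notation pt := (@lpoint R).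
Local Notation p := (const_mx 1 : 'rV[R]_3).

Lemma central_of_reflexive : reflexive3 P -> central_tropical_polytope P.
Proof.
move=> [_ _ [p0 [p0P [k [A [b [[PE _ _ _] Ab]]]]]]].
have p_int : alg_interior P p.
  have /interior_alg_interior p0int : interior P (int_pt R p0) by apply/p0P.
  by move: (p0int); rewrite (center_of_alg_interior P_sub p0int) int_pt_center.
have p0E : p0 = const_mx 1.
  by apply: (center_of_alg_interior P_sub); apply: interior_alg_interior; apply/p0P.
pose D : {set quartic_monomial} := [set m | `[< P (pt m) >]]%SET.
have DP : P = hull pt D by apply: lattice_polytope_hull.
have inD m : m \in D <-> P (pt m) by rewrite inE; split=> /asboolP.
have lattice q : P (int_pt R q) -> exists2 m, m \in D & pt m = int_pt R q.
  by move=> Pq; have [m mq] := simplex4_lattice_point (P_sub Pq); exists m => //; apply/inD; rewrite mq.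
have [mp mpD ptmp] : exists2 m, m \in D & pt m = p.
  by have := lattice (const_mx 1); rewrite int_pt_center; apply; apply: alg_interior_mem.
have bE i : (b i 0)%:~R = dot (int_pt R (row i A)) p - 1 :> R.
  have := congr1 (fun M : 'cV_k => M i 0) Ab; rewrite [LHS]mxE [(- b) i 0]mxE [const_mx _ _ _]mxE p0E.
  move=> /(canRL (subrK _)) /(congr1 (fun x : int => x%:~R - 1 : R)).
  rewrite rmorphD/= addrAC subrr add0r => <-; congr (_ - _).
  by rewrite mxE rmorph_sum; apply: eq_bigr => j _; rewrite !mxE rmorphM.
have half_spaces y : hull pt D y <-> forall i, -1 <= dot (int_pt R (row i A)) (y - p).
  rewrite -DP [in P y]PE; split=> yP i; have := yP i; rewrite /= bE dotBr; lra.
have D_spanning : affinely_spanning pt D by apply: (alg_interior_spanning (x := p)); rewrite -DP.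
(* One dependency [d T] is fixed for each dependent set, so that genericity amounts to finitely many
   nonvanishing conditions on the heights. *)
pose dependent T := `[< exists2 d : quartic_monomial -> R, affine_dependency T d & exists m, d m != 0 >].
have /boolp.choice[d dP] : forall T, exists d : quartic_monomial -> R, dependent T -> affine_dependency T d /\ exists m, d m != 0.
  move=> T; have [/asboolP[d dT d0]|_] := boolP (dependent T); first by exists d.
  by exists (fun=> 0).
have [e e01 eP] := @generic_perturbation R _ _ dependent d
  (fun m => 2 * dot (pt m) (pt m) + depth R * (m != mp)%:R) (fun T dT => (dP T dT).2).
pose h := central_height mp e.
have e_generic T : (exists2 b : quartic_monomial -> R, affine_dependency T b & exists m, b m != 0) ->
    exists2 b : quartic_monomial -> R, affine_dependency T b & \sum_m b m * h m != 0.
  move=> /asboolP dT; exists (d T); first exact: (dP T dT).1.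
  apply: contraNN (eP T dT) => /eqP E; apply/eqP; rewrite -[RHS]E.
  by apply: eq_bigr => m _; rewrite /h /central_height /base_height addrAC.
pose c m : \bar R := if m \in D then (h m)%:E else +oo%E.
have c_Noo m : c m != -oo%E by rewrite /c; case: ifP.
have cD : support_set c = D.
  by apply/finset.setP => m; rewrite [LHS]inE /c; case: ifP.
have ch : {in D, (fun m => fine (c m)) =1 h} by move=> m mD; rewrite /c mD.
have cells S : maximal_cell c S -> exists2 w, tight_max pt D h w & S = hull pt (tight pt D h w).
  move=> /maximal_cellP[w]; rewrite cD => wmax ->; exists w.
    exact: tight_max_ext ch wmax.
  by rewrite (tight_ext _ _ ch).
have D_lattice q : hull pt D (int_pt R q) -> exists2 m, m \in D & pt m = int_pt R q.
  by rewrite -DP; apply: lattice.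
exists c; split=> //.
- by rewrite trop_newton_hull cD.
- move=> S /cells[w wmax ->].
  exact: (tight_unimodular mpD ptmp half_spaces D_lattice D_spanning e01 wmax e_generic).
(* At the origin the tropical terms are the heights themselves, and [depth] makes that of the centre
   strictly smallest. *)
- have p_min : strict_min c 0 mp.
    move=> m mmp; have [mD|mD] := boolP (m \in D); last first.
      by rewrite trop_termE ?cD// /trop_term /c (negPf mD) ltey.
    rewrite !trop_termE ?cD// lte_fin !(dotC _ 0) !dot0l !addr0 !ch//.
    rewrite /h /central_height eqxx mmp mulr0 addr0 mulr1.
    apply: le_lt_trans (base_height_le e01 mp) _.
    rewrite ltr_wpDl ?base_height_ge0// /depth.
    have bb1 : 0 < base_bound R + 1 by rewrite ltr_wpDl// (base_bound_ge0 mp e01).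
    by apply: (@lt_le_trans _ _ (base_bound R + 1)); rewrite ?ltrDl// ler_peMl ?ler1n// ltW.
  exists 0; first exact: strict_min_not_surface p_min.
  by apply: (@bounded_component _ _ c_Noo mp) => //; rewrite ?cD// trop_newton_hull cD -DP ptmp.
move=> S /cells[w wmax ->].
exact: (central_tight_vertex mpD ptmp half_spaces D_spanning e01 wmax).
Qed.

End CentralOfReflexive.

(** * General forms with the given monomials *)

Section GeneralForms.
Local Open Scope classical_set_scope.
Variables (R : realType) (P : set 'rV[R]_3).
Hypotheses (P_lattice : lattice_polytope P) (P_sub : P `<=` @simplex4 R).
Hypothesis p_int : alg_interior P (const_mx 1).

Lemma general_polytope_form_stable : exists U : set (polytope_monomial P -> R[i]),
  [/\ zariski_open U, U !=set0 & forall lam, U lam -> stable_quartic (polytope_form lam)].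
Proof.
pose mon (m : polytope_monomial P) : 'X_{1..4} := val (val m).
have mon4 m : mdeg (mon m) = 4%N by apply/eqP/(valP (val m)).
exists [set lam : polytope_monomial P -> R[i] | numerically_stable (form_of mon lam)].
have [m1 m1E] : exists m1, lpoint R m1 = const_mx 1.
  have Pp := alg_interior_mem p_int; rewrite -int_pt_center in Pp *; move/P_sub: Pp.
  exact: simplex4_lattice_point.
have Pm1 : `[< P (lpoint R m1) >] by rewrite m1E; apply/asboolP; exact: alg_interior_mem p_int.
split; first exact: numerically_stable_open mon4.
  have [|//|lam smooth] := @torus_smooth_exists _ _ mon R[i] 4 _ _ mon4; first exact: pchar_num.
  (* The case [n = 3]: degree and number of variables are both 4. The monomial [m1] of the interior
     lattice point serves as the required index. *)
  exists lam; apply: (@torus_smooth_numerically_stable _ 3 _ mon lam (exist _ m1 Pm1)) => //.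
  move=> a aP; apply: (alg_interior_weights P_lattice P_sub p_int) => m /asboolP Pm.
  exact: aP (exist _ m Pm).
move=> lam; apply: numerically_stable_stable_quartic.
by apply: rpred_sum => m _; apply: rpredZ; rewrite dhomogX/= mon4.
Qed.

End GeneralForms.

Local Open Scope classical_set_scope.
Local Open Scope ring_scope.

Theorem theorem2 (R : realType) (P : set 'rV[R]_3)
    (P_lattice : lattice_polytope P) (P_sub : P `<=` @simplex4 R) :
  (central_tropical_polytope P <-> reflexive3 P) /\
  (central_tropical_polytope P ->
   exists U : set (polytope_monomial P -> R[i]),
     [/\ zariski_open U, U !=set0
       & forall lam, U lam -> stable_quartic (polytope_form lam)]).
Proof.
split.
  split; first exact: reflexive_of_central.
  exact: central_of_reflexive.
move=> Pcentral; apply: general_polytope_form_stable => //.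
have [c [c_Noo cP _ c_region _]] := Pcentral.
by rewrite -cP; have [] := bounded_region_center c_Noo _ c_region; rewrite cP.
Qed.
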